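(* Let $\mathcal{M}=(M,V)$ and $\mathcal{N}=(N,W)$ be QP-representations of the same nondegenerate QP $(Q,S)$, let $k\in Q_0$, and let $\overline{\mathcal{M}}=\mu_k(\mathcal{M})=(\overline M,\overline V)$ and $\overline{\mathcal{N}}=\mu_k(\mathcal{N})=(\overline N,\overline W)$. Then $$E^{\rm inj}(\overline{\mathcal{M}},\overline{\mathcal{N}})-E^{\rm inj}(\mathcal{M},\mathcal{N})=h_k(\overline M)\,h_k(N)-h_k(M)\,h_k(\overline N).$$ In particular, $E^{\rm sym}(\mathcal{M},\mathcal{N})$ and $E(\mathcal{M})$ are invariant under QP-mutations, i.e. $$E^{\rm sym}(\mu_k(\mathcal{M}),\mu_k(\mathcal{N}))=E^{\rm sym}(\mathcal{M},\mathcal{N}),\qquad E(\mu_k(\mathcal{M}))=E(\mathcal{M})$$ for any vertex $k$.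
   Context: **Quivers with potentials (QPs).** Vector spaces are over $\mathbb{C}$. A quiver $Q=(Q_0,Q_1,h,t)$ has finite vertex set $Q_0=\{1,\dots,n\}$, finite arrow set $Q_1$, no loops; an arrow $a$ goes from its tail $t(a)$ to its head $h(a)$. $R=\bigoplus_i\mathbb{C}e_i$ with $e_ie_j=\delta_{ij}e_i$; $A$ is the $R$-bimodule with basis $Q_1$, $e_iAe_j$ being spanned by the arrows $j\to i$; $R\langle\langle A\rangle\rangle=\prod_{d\ge0}A^{\otimes_R d}$ (paths written right to left) with the $\mathfrak{m}$-adic topology, $\mathfrak{m}=\prod_{d\ge1}A^{\otimes_R d}$. A potential $S$ is a possibly infinite linear combination of cyclic paths of positive length, up to cyclic equivalence ($S\sim S'$ if $S-S'$ lies in the closure of the span of all $a_1\cdots a_d-a_2\cdots a_da_1$, $a_1\cdots a_d$ cyclic). Cyclic derivatives are the continuous linear maps with $\partial_a(a_1\cdots a_d)=\sum_{p:a_p=a}a_{p+1}\cdots a_da_1\cdots a_{p-1}$; $J(S)$ is the closure of the two-sided ideal generated by all $\partial_aS$; $\mathcal{P}(Q,S)=R\langle\langle A\rangle\rangle/J(S)$. For arrows $a,b$ with $h(a)=t(b)$, $\partial_{ba}S$ is defined by replacing $S$ by a cyclically equivalent potential in which no occurring cyclic path $a_1\cdots a_d$ has $a_1=a$ and then setting $\partial_{ba}(a_1\cdots a_d)=\sum_{\nu:a_{\nu-1}=b,a_\nu=a}a_{\nu+1}\cdots a_da_1\cdots a_{\nu-2}$ (extended linearly and continuously). $(Q,S)$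 is reduced if $S\in\mathfrak{m}^3$, and trivial if $S$ is a linear combination of cyclic $2$-paths and $J(S)=\mathfrak{m}$. **QP-representations.** A QP-representation of $(Q,S)$ is $\mathcal{M}=(M,V)$ with $M$ a finite-dimensional $\mathcal{P}(Q,S)$-module (spaces $M(i)$ and maps $a_M:M(t(a))\to M(h(a))$, annihilated by all sufficiently long paths and all $\partial_aS$) and $V=(V(i))_{i\in Q_0}$ a family of finite-dimensional vector spaces. For $k\in Q_0$ put $M_{\rm in}(k)=\bigoplus_{h(a)=k}M(t(a))$, $M_{\rm out}(k)=\bigoplus_{t(b)=k}M(h(b))$; $\alpha_k:M_{\rm in}(k)\to M(k)$ has components $a_M$, $\beta_k=\beta_{k;M}:M(k)\to M_{\rm out}(k)$ has components $b_M$, and $\gamma_k:M_{\rm out}(k)\to M_{\rm in}(k)$ has components $(\partial_{ba}S)_M:M(h(b))\to M(t(a))$. **Invariants.** $g_k(\mathcal{M})=\dim\ker\gamma_k-\dim M(k)+\dim V(k)$; $h_k(M)=-\dim\ker\beta_{k;M}$; $E^{\rm inj}(\mathcal{M},\mathcal{N})=\dim\mathrm{Hom}_Q(M,N)+\sum_{i=1}^n\dim M(i)\cdot g_i(\mathcal{N})$, where $\mathrm{Hom}_Q$ denotes homomorphisms of quiver representations; $E^{\rm sym}(\mathcal{M},\mathcal{N})=E^{\rm inj}(\mathcal{M},\mathcal{N})+E^{\rm inj}(\mathcal{N},\mathcal{M})$; $E(\mathcal{M})=E^{\rm inj}(\mathcal{M},\mathcal{M})$. **Right-equivalence and reduction.**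 $(Q,S)$ and $(Q,S')$ are right-equivalent if some algebra automorphism $\varphi$ of $R\langle\langle A\rangle\rangle$, identical on $R$, takes $S$ to a potential cyclically equivalent to $S'$; then $(M',V')$ over $(Q,S')$ is right-equivalent to $(M,V)$ over $(Q,S)$ if, for such a $\varphi$, $M'\cong{}^\varphi M$ (same space, $\varphi(u)\star m=um$) and $V'\cong V$. Every QP is right-equivalent to a direct sum (same vertices, disjoint union of arrows, sum of potentials) of a reduced QP $(Q,S)_{\rm red}$ and a trivial QP, each unique up to right-equivalence; the reduced part of a QP-representation is obtained by transporting it along such a right-equivalence and restricting to the arrows of $(Q,S)_{\rm red}$. (When two representations are mutated at the same time, the same right-equivalence is used for both.) **Mutation at $k$.** Let $(Q,S)$ be reduced with no oriented $2$-cycles through $k$. The quiver $\widetilde Q$ is obtained from $Q$ by adding an arrow $[ba]:t(a)\to h(b)$ for each pair of arrows $a,b$ with $h(a)=k=t(b)$, and replacing each arrow $a$ with $h(a)=k$ by $a^\star:k\to t(a)$ and each arrow $b$ with $t(b)=k$ by $b^\star:h(b)\to k$. Choose $S$ in its cyclic class so that no cyclic path in it starts and ends at $k$; put $\widetilde S=[S]+\sum_{h(a)=t(b)=k}[ba]a^\star b^\star$, where $[S]$ is obtained by replacing each factor $ba$ through $k$ by $[ba]$. Then $\mu_k(Q,S)=(\widetilde Q,\widetilde S)_{\rm red}$. For $\mathcal{M}=(M,V)$, $\mu_k(\mathcal{M})$ is the reduced part of the QP-representation $(\overline M,\overline V)$ of $(\widetilde Q,\widetilde S)$ given by: $\overline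 M(i)=M(i)$, $\overline V(i)=V(i)$ for $i\ne k$; $\overline M(k)=\frac{\ker\gamma_k}{\mathrm{im}\,\beta_k}\oplus\mathrm{im}\,\gamma_k\oplus\frac{\ker\alpha_k}{\mathrm{im}\,\gamma_k}\oplus V(k)$, $\overline V(k)=\frac{\ker\beta_k}{\ker\beta_k\cap\mathrm{im}\,\alpha_k}$; arrows not incident to $k$ act as before, $[ba]$ acts as $b_Ma_M$; the arrows $b^\star$ are the components of $\overline\alpha_k=(-\pi\rho,-\gamma_k,0,0)^T:M_{\rm out}(k)\to\overline M(k)$ and the arrows $a^\star$ are the components of $\overline\beta_k=(0,\iota,\iota\sigma,0):\overline M(k)\to M_{\rm in}(k)$, where $\rho:M_{\rm out}(k)\to\ker\gamma_k$ is a chosen linear retraction, $\sigma:\ker\alpha_k/\mathrm{im}\,\gamma_k\to\ker\alpha_k$ a chosen linear section of the projection, and $\pi,\iota$ are natural projections and inclusions. Everything is well defined up to right-equivalence, and $\mu_k$ is an involution up to right-equivalence. **Nondegeneracy.** $(Q,S)$, with $Q$ having no loops or oriented $2$-cycles, is nondegenerate if every finite sequence of mutations can be applied to it without creating oriented $2$-cycles along the way. *)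

(* Defs.v *)
From HB Require Import structures.
From mathcomp Require Import all_boot all_order all_algebra.
From mathcomp Require Import boolp reals complex zify.

Set Implicit Arguments.
Unset Strict Implicit.
Unset Printing Implicit Defensive.

Import Order.TTheory GRing.Theory Num.Theory.
Local Open Scope ring_scope.

Record quiver (n : nat) := Quiver {
  arrow :> finType;
  ahd : arrow -> 'I_n;
  atl : arrow -> 'I_n;
  noloop : forall a, atl a != ahd a }.
Arguments ahd {n q} a.
Arguments atl {n q} a.
Arguments noloop {n q} a.

(* A path a_1 a_2 ... a_d, written right to left, is the word (h(a_1), [:: a_1; a_2; ...; a_d])
   with t(a_j) = h(a_(j+1)); the lazy path e_i is (i, [::]). *)
Section Words.
Variables (n : nat) (Q : quiver n).

Definition word := ('I_n * seq Q)%type.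

Fixpoint is_path_from (i : 'I_n) (s : seq Q) : bool :=
  if s is a :: s' then (ahd a == i) && is_path_from (atl a) s' else true.

Definition is_path (w : word) := is_path_from w.1 w.2.

Definition wtail (i : 'I_n) (s : seq Q) : 'I_n := last i (map atl s).

Definition is_cycle (w : word) :=
  [&& is_path w, w.2 != [::] & wtail w.1 w.2 == w.1].

Lemma wtail_cat i s t : wtail i (s ++ t) = wtail (wtail i s) t.
Proof. by rewrite /wtail map_cat last_cat. Qed.

Lemma is_path_cat i s t :
  is_path_from i (s ++ t) = is_path_from i s && is_path_from (wtail i s) t.
Proof.
by elim: s i => [//|a s IH] i /=; rewrite IH andbA.
Qed.

End Words.

Record cpalg (K : fieldType) (n : nat) (Q : quiver n) := CPAlg {
  coef : word Q -> K;
  _ : forall w, ~~ is_path w -> coef w = 0 }.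

Section PathAlgebra.
Variables (K : fieldType) (n : nat) (Q : quiver n).
Local Notation A := (cpalg K Q).

Lemma coef_out (x : A) w : ~~ is_path w -> coef x w = 0.
Proof. by case: x => f Hf; apply: Hf. Qed.

Fact pseries_subproof (f : word Q -> K) w :
  ~~ is_path w -> (if is_path w then f w else 0) = 0.
Proof. by move/negbTE->. Qed.

Definition pseries (f : word Q -> K) : A := CPAlg (pseries_subproof f).

Lemma coef_pseries f w : coef (pseries f) w = if is_path w then f w else 0.
Proof. by []. Qed.

Lemma cpalgP (x y : A) : (forall w, is_path w -> coef x w = coef y w) -> x = y.
Proof.
move=> H; have E : coef x = coef y.
  apply/funext=> w; have [/H//|Hw] := boolP (is_path w).
  by rewrite !coef_out.
case: x y E {H} => [f Hf] [g Hg] /= E.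
by rewrite E in Hf *; congr CPAlg; apply: Prop_irrelevance.
Qed.

HB.instance Definition _ := gen_eqMixin A.
HB.instance Definition _ := gen_choiceMixin A.

Let addS (x y : A) := pseries (fun w => coef x w + coef y w).
Let oppS (x : A) := pseries (fun w => - coef x w).
Let zeroS := pseries (fun=> 0).

Fact addS_assoc : associative addS.
Proof. by move=> x y z; apply: cpalgP => w Hw /=; rewrite Hw addrA. Qed.
Fact addS_comm : commutative addS.
Proof. by move=> x y; apply: cpalgP => w Hw /=; rewrite Hw addrC. Qed.
Fact add0S : left_id zeroS addS.
Proof. by move=> x; apply: cpalgP => w Hw /=; rewrite Hw add0r. Qed.
Fact addNS : left_inverse zeroS oppS addS.
Proof. by move=> x; apply: cpalgP => w Hw /=; rewrite Hw addNr. Qed.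

HB.instance Definition _ := GRing.isZmodule.Build A addS_assoc addS_comm add0S addNS.

Lemma coefD (x y : A) w : coef (x + y) w = coef x w + coef y w.
Proof.
have [Hw|Hw] := boolP (is_path w); last by rewrite !coef_out ?addr0.
by rewrite [LHS]coef_pseries Hw.
Qed.
Lemma coefN (x : A) w : coef (- x) w = - coef x w.
Proof.
have [Hw|Hw] := boolP (is_path w); last by rewrite !coef_out ?oppr0.
by rewrite [LHS]coef_pseries Hw.
Qed.
Lemma coef0 w : coef (0 : A) w = 0.
Proof. by rewrite [LHS]coef_pseries if_same. Qed.
Lemma coef_sum I (r : seq I) (P : pred I) (F : I -> A) w :
  coef (\sum_(i <- r | P i) F i) w = \sum_(i <- r | P i) coef (F i) w.
Proof. exact: (big_morph (fun x : A => coef x w) (fun x y => coefD x y w) (coef0 w)). Qed.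

Let scaleS c (x : A) := pseries (fun w => c * coef x w).

Fact scaleS_A c d x : scaleS c (scaleS d x) = scaleS (c * d) x.
Proof. by apply: cpalgP => w Hw /=; rewrite Hw mulrA. Qed.
Fact scale1S : left_id 1 scaleS.
Proof. by move=> x; apply: cpalgP => w Hw /=; rewrite Hw mul1r. Qed.
Fact scaleS_Dr : right_distributive scaleS +%R.
Proof. by move=> c x y; apply: cpalgP => w Hw /=; rewrite Hw mulrDr. Qed.
Fact scaleS_Dl x : {morph scaleS^~ x : c d / c + d}.
Proof. by move=> c d; apply: cpalgP => w Hw /=; rewrite Hw mulrDl. Qed.

HB.instance Definition _ :=
  GRing.Zmodule_isLmodule.Build K A scaleS_A scale1S scaleS_Dr scaleS_Dl.

Lemma coefZ c (x : A) w : coef (c *: x) w = c * coef x w.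
Proof.
have [Hw|Hw] := boolP (is_path w); last by rewrite !coef_out ?mulr0.
by rewrite [LHS]coef_pseries Hw.
Qed.

(* The coefficient of a path in x * y is the sum over all its factorizations into two paths. *)
Definition conv (f g : word Q -> K) (w : word Q) : K :=
  \sum_(j < (size w.2).+1)
    f (w.1, take j w.2) * g (wtail w.1 (take j w.2), drop j w.2).

Lemma conv_nil f g i : conv f g (i, [::]) = f (i, [::]) * g (i, [::]).
Proof. by rewrite /conv big_ord1. Qed.

Lemma conv_cons f g i a s :
  conv f g (i, a :: s) =
    f (i, [::]) * g (i, a :: s) + conv (fun w => f (i, a :: w.2)) g (atl a, s).
Proof. by rewrite /conv big_ord_recl. Qed.

Lemma eq_convl f f' g i s :
  (forall t, f (i, t) = f' (i, t)) -> conv f g (i, s) = conv f' g (i, s).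
Proof. by move=> E; apply: eq_bigr => j _; rewrite E. Qed.

Lemma convDl f f' g w : conv (fun v => f v + f' v) g w = conv f g w + conv f' g w.
Proof. by rewrite -big_split; apply: eq_bigr => j _; rewrite mulrDl. Qed.

Lemma convDr f g g' w : conv f (fun v => g v + g' v) w = conv f g w + conv f g' w.
Proof. by rewrite -big_split; apply: eq_bigr => j _; rewrite mulrDr. Qed.

Lemma convZl c f g w : conv (fun v => c * f v) g w = c * conv f g w.
Proof. by rewrite mulr_sumr; apply: eq_bigr => j _; rewrite mulrA. Qed.

Lemma conv_assoc f g h i s : conv f (conv g h) (i, s) = conv (conv f g) h (i, s).
Proof.
elim: s i f g => [|a s IH] i f g; first by rewrite !conv_nil mulrA.
rewrite !conv_cons conv_nil IH mulrDr mulrA -addrA; congr (_ + _).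
rewrite -convZl -convDl; apply: eq_convl => t.
by rewrite /= conv_cons.
Qed.

Let mulS (x y : A) := pseries (conv (coef x) (coef y)).
Let oneS := pseries (fun w => (w.2 == [::])%:R).

Lemma conv_out (x y : A) w : ~~ is_path w -> conv (coef x) (coef y) w = 0.
Proof.
case: w => i s Hw; rewrite /conv big1 // => j _ /=.
move: Hw; rewrite /is_path /= -{1}(cat_take_drop j s) is_path_cat negb_and.
by case/orP=> H; [rewrite (@coef_out x (_, _) H) mul0r | rewrite (@coef_out y (_, _) H) mulr0].
Qed.

Fact coef_mulS x y w : coef (mulS x y) w = conv (coef x) (coef y) w.
Proof. by rewrite /=; case: ifPn => // Hw; rewrite conv_out. Qed.

Fact mulS_assoc : associative mulS.
Proof.
move=> x y z; apply: cpalgP => -[i s] Hw; rewrite !coef_mulS.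
transitivity (conv (coef x) (conv (coef y) (coef z)) (i, s)).
  by apply: eq_bigr => j _; rewrite coef_mulS.
rewrite conv_assoc; apply: eq_convl => t; by rewrite coef_mulS.
Qed.

Fact mul1S : left_id oneS mulS.
Proof.
move=> x; apply: cpalgP => -[i s] Hw; rewrite coef_mulS /conv big_ord_recl /= take0 drop0.
rewrite big1 ?addr0 ?mul1r // => j _.
by case: s {Hw} j => [|a s] [] //= j _; rewrite if_same mul0r.
Qed.

Fact mulS1 : right_id oneS mulS.
Proof.
move=> x; apply: cpalgP => -[i s] Hw; rewrite coef_mulS /conv big_ord_recr /=.
rewrite take_size drop_size /= mulr1 big1 ?add0r // => j _.
have -> : (drop j s == [::]) = false.
  by apply/negbTE; rewrite -size_eq0 size_drop subn_eq0 -ltnNge.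
by rewrite if_same mulr0.
Qed.

Fact mulS_Dl : left_distributive mulS +%R.
Proof.
move=> x y z; apply: cpalgP => w Hw; rewrite coefD !coef_mulS -convDl.
by apply: eq_bigr => j _; rewrite coefD.
Qed.

Fact mulS_Dr : right_distributive mulS +%R.
Proof.
move=> x y z; apply: cpalgP => w Hw; rewrite coefD !coef_mulS -convDr.
by apply: eq_bigr => j _; rewrite coefD.
Qed.

HB.instance Definition _ :=
  GRing.Zmodule_isPzRing.Build A mulS_assoc mul1S mulS1 mulS_Dl mulS_Dr.

Lemma coefM (x y : A) i s :
  coef (x * y) (i, s) =
    \sum_(j < (size s).+1) coef x (i, take j s) * coef y (wtail i (take j s), drop j s).
Proof. exact: coef_mulS. Qed.

Lemma coef1 i s : coef (1 : A) (i, s) = (s == [::])%:R.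
Proof. by rewrite [LHS]coef_pseries; case: s => [|a s] //=; rewrite if_same. Qed.

Local Arguments coef : simpl never.

Definition pathS (w : word Q) : A := pseries (fun v => (v == w)%:R).
Definition vtx (i : 'I_n) : A := pathS (i, [::]).
Definition arr (a : Q) : A := pathS (ahd a, [:: a]).

Lemma coef_pathS w v : is_path w -> coef (pathS w) v = (v == w)%:R.
Proof.
move=> Hw; rewrite coef_pseries; case: ifPn => // Hv.
by case: eqP Hv => // ->; rewrite Hw.
Qed.

(* The closed ideal m^d. *)
Definition madic (d : nat) (x : A) : Prop :=
  forall w, (size w.2 < d)%N -> coef x w = 0.

Definition madic_closure (X : A -> Prop) (x : A) : Prop :=
  forall d, exists2 y, X y & madic d (x - y).

Definition linspan (X : A -> Prop) (x : A) : Prop :=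
  exists (m : nat) (c : 'I_m -> K) (g : 'I_m -> A),
    (forall j, X (g j)) /\ x = \sum_j c j *: g j.

Definition ideal_gen (X : A -> Prop) (x : A) : Prop :=
  exists (m : nat) (u g v : 'I_m -> A),
    (forall j, X (g j)) /\ x = \sum_j u j * g j * v j.

Definition potential (S : A) : Prop := forall w, ~~ is_cycle w -> coef S w = 0.

(* a_1 a_2 ... a_d - a_2 ... a_d a_1 *)
Definition rotation_diff (x : A) : Prop :=
  exists (a : Q) (s : seq Q), is_cycle (ahd a, a :: s) /\
    x = pathS (ahd a, a :: s) - pathS (atl a, rcons s a).

Definition cyc_equiv (x y : A) : Prop := madic_closure (linspan rotation_diff) (x - y).

Definition coef_cyc (S : A) (s : seq Q) : K :=
  if s is a :: _ then coef S (ahd a, s) else 0.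

(* The cyclic paths a_1 ... a_d with a_p = a and a_(p+1) ... a_d a_1 ... a_(p-1) = q are the
   words u_2 a u_1 for the factorizations q = u_1 u_2; see cderE. *)
Definition cder (a : Q) (S : A) : A := pseries (fun v =>
  if v.1 == atl a then
    \sum_(j < (size v.2).+1) coef_cyc S (drop j v.2 ++ a :: take j v.2)
  else 0).

(* The formula for the second derivative by ba, which requires that no cyclic path occurring
   in S starts with a; see dder0E. *)
Definition dder0 (b a : Q) (S : A) : A := pseries (fun v =>
  if v.1 == atl a then
    \sum_(j < (size v.2).+1) coef_cyc S (drop j v.2 ++ b :: a :: take j v.2)
  else 0).

(* Replaces every cyclic path a a_2 ... a_d by a_2 ... a_d a; as there are no loops, the result
   does not start with a.  See rotate_off_equiv and rotate_off_start. *)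
Definition rotate_off (a : Q) (S : A) : A := pseries (fun v =>
  if ohead v.2 == Some a then 0
  else coef S v +
       (if ohead (rotr 1 v.2) == Some a then coef S (ahd a, rotr 1 v.2) else 0)).

Definition dder (b a : Q) (S : A) : A := dder0 b a (rotate_off a S).

Definition jacobian_ideal (S : A) : A -> Prop :=
  madic_closure (ideal_gen (fun x => exists a, x = cder a S)).

Lemma is_path_head i (a : Q) s : is_path (i, a :: s) -> ahd a = i.
Proof. by case/andP=> /eqP. Qed.

Lemma coef_cyc_pathS i (s t : seq Q) :
  is_path (i, s) -> t != [::] -> coef_cyc (pathS (i, s)) t = (t == s)%:R.
Proof.
case: t => // a t Hs _; rewrite [LHS] coef_pathS // xpair_eqE.
case: ((a :: t : seq Q) =P s) => [E|_]; last by rewrite andbF.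
by subst s; rewrite (is_path_head Hs) eqxx.
Qed.

Lemma cut_infix (s : seq Q) p m : s = take p s ++ take m (drop p s) ++ drop (p + m) s.
Proof. by rewrite addnC -drop_drop !cat_take_drop. Qed.

Lemma is_cycle_rot i (s : seq Q) (a : Q) p m : is_cycle (i, s) ->
  wtail i (take (p + m) s) = atl a -> is_path (atl a, drop (p + m) s ++ take p s).
Proof.
case/and3P=> /= Hs _ /eqP Et Ha; move: Hs.
rewrite /is_path /= -{1}(cat_take_drop (p + m) s) is_path_cat Ha => /andP[H1 H2].
rewrite is_path_cat H2 -Ha -wtail_cat cat_take_drop Et /=.
by move: H1; rewrite takeD is_path_cat => /andP[].
Qed.

Lemma splitE (u q s : seq Q) (j : 'I_(size q).+1) :
  (drop j q ++ u ++ take j q == s) =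
  [&& size s == (size q + size u)%N, take (size u) (drop (size q - j) s) == u &
      q == drop (size q - j + size u) s ++ take (size q - j) s].
Proof.
case: j => j /= Hj; rewrite ltnS in Hj.
apply/eqP/and3P => [<-|[/eqP Es /eqP Ha /eqP Eq]].
  have Ed : size (drop j q) = (size q - j)%N by rewrite size_drop.
  split.
  - by rewrite !size_cat size_drop size_take_min (minn_idPl Hj) addnCA addnC subnK.
  - by rewrite -Ed drop_size_cat // take_size_cat.
  - by rewrite -Ed take_size_cat // catA drop_size_cat ?size_cat // cat_take_drop.
have Ed : size (drop (size q - j + size u) s) = j.
  by rewrite size_drop Es subnDr subKn.
have -> : drop j q = take (size q - j) s by rewrite {1}Eq drop_size_cat.
have -> : take j q = drop (size q - j + size u) s by rewrite {1}Eq take_size_cat.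
by rewrite -[X in _ ++ X ++ _]Ha -cut_infix.
Qed.

Lemma sum_rotE (i i' : 'I_n) (u q s : seq Q) (a : Q) :
    is_cycle (i, s) -> u != [::] -> wtail i' u = atl a ->
  \sum_(j < (size q).+1) coef_cyc (pathS (i, s)) (drop j q ++ u ++ take j q) =
  \sum_(p < (size s - size u).+1 | take (size u) (drop p s) == u)
     coef (pathS (atl a, drop (p + size u) s ++ take p s)) (atl a, q).
Proof.
move=> Hc; have Hs : is_path (i, s) by case/and3P: Hc.
case: u => // c u _ Hu; set v := c :: u in Hu *.
transitivity (\sum_(j < (size q).+1) ((drop j q ++ v ++ take j q == s)%:R : K)).
  by apply: eq_bigr => j _; rewrite coef_cyc_pathS //; case: (drop _ _).
symmetry; transitivity (\sum_(p < (size s - size v).+1 | take (size v) (drop p s) == v)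
    ((q == drop (p + size v) s ++ take p s)%:R : K)).
  apply: eq_bigr => p /eqP Hp; rewrite coef_pathS ?xpair_eqE ?eqxx //.
  by apply: (is_cycle_rot Hc); rewrite takeD Hp wtail_cat; exact: Hu.
symmetry; under eq_bigr => j _ do rewrite splitE.
have [Es|Es] := eqVneq (size s) (size q + size v)%N; last first.
  rewrite !big1 // => p /eqP Hp; case: eqP => // Eq; case/eqP: Es.
  have Hv : size (take (size v) (drop p s)) = size v by rewrite Hp.
  by rewrite Eq {1}(cut_infix s p (size v)) !size_cat Hv addnA addnC addnA.
have -> : (size s - size v)%N = size q by rewrite Es addnK.
rewrite [RHS]big_mkcond [RHS](reindex_inj rev_ord_inj).
apply: eq_bigr => j _.
have -> : rev_ord j = (size q - j)%N :> nat by [].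
by case: (take _ _ == v).
Qed.

Lemma sum_rot_widen (F : nat -> A) (u s : seq Q) : u != [::] -> s != [::] ->
  \sum_(p < (size s - size u).+1 | take (size u) (drop p s) == u) F p =
  \sum_(p < size s | take (size u) (drop p s) == u) F p.
Proof.
move=> Hu Hs; have {}Hu : (0 < size u)%N by rewrite lt0n size_eq0.
have {}Hs : (0 < size s)%N by rewrite lt0n size_eq0.
have Hle : ((size s - size u).+1 <= size s)%N by lia.
rewrite (big_ord_widen_cond _ (fun p => take (size u) (drop p s) == u) F Hle).
apply: eq_bigl => p; case: eqP => //= Hp.
have := congr1 size Hp; rewrite size_take_min size_drop.
by have := ltn_ord p; lia.
Qed.

Lemma take1_drop (s : seq Q) p a : (take 1 (drop p s) == [:: a]) = (onth s p == Some a).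
Proof. by elim: s p => [|x s IH] [|p] //=; rewrite ?take0 ?eqseq_cons ?andbT. Qed.

Lemma take2_drop (s : seq Q) p b a : (take 2 (drop p s) == [:: b; a]) =
  (onth s p == Some b) && (onth s p.+1 == Some a).
Proof.
by elim: s p => [|x s IH] [|p] //=; rewrite eqseq_cons -(take1_drop s 0) drop0.
Qed.

Lemma cderE a i (s : seq Q) : is_cycle (i, s) ->
  cder a (pathS (i, s)) =
    \sum_(p < size s | onth s p == Some a) pathS (atl a, drop p.+1 s ++ take p s).
Proof.
move=> Hc; have /and3P[_ Hs _] := Hc.
under [RHS]eq_bigl => p do rewrite -take1_drop.
rewrite -(sum_rot_widen (fun p => pathS (atl a, drop p.+1 s ++ take p s)) (u := [:: a])) //.
apply: cpalgP => -[i' q] Hq; rewrite coef_pseries Hq coef_sum /=.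
case: eqP => [->|Ne].
  rewrite (@sum_rotE i i' [:: a] q s a Hc) //.
  by apply: eq_bigr => p _; rewrite addn1.
rewrite big1 // => p _; rewrite /pathS coef_pseries Hq xpair_eqE.
by case: eqP Ne.
Qed.

Lemma dder0E b a i (s : seq Q) : is_cycle (i, s) ->
  dder0 b a (pathS (i, s)) =
    \sum_(p < size s | (onth s p == Some b) && (onth s p.+1 == Some a))
      pathS (atl a, drop p.+2 s ++ take p s).
Proof.
move=> Hc; have /and3P[_ Hs _] := Hc.
under [RHS]eq_bigl => p do rewrite -take2_drop.
rewrite -(sum_rot_widen (fun p => pathS (atl a, drop p.+2 s ++ take p s)) (u := [:: b; a])) //.
apply: cpalgP => -[i' q] Hq; rewrite coef_pseries Hq coef_sum /=.
case: eqP => [->|Ne].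
  rewrite (@sum_rotE i i' [:: b; a] q s a Hc) //.
  by apply: eq_bigr => p _; rewrite addn2.
rewrite big1 // => p _; rewrite /pathS coef_pseries Hq xpair_eqE.
by case: eqP Ne.
Qed.

Lemma rotate_off_start (S : A) a s i : coef (rotate_off a S) (i, a :: s) = 0.
Proof. by rewrite coef_pseries /= eqxx if_same. Qed.

Lemma linspan0 X : linspan X (0 : A).
Proof.
by exists 0%N, (fun=> 0), (fun=> 0); split=> [[]//|]; rewrite big_ord0.
Qed.

Lemma linspanZ X (c : K) (x : A) : X x -> linspan X (c *: x).
Proof. by move=> Xx; exists 1%N, (fun=> c), (fun=> x); rewrite big_ord1. Qed.

Lemma linspanD X (x y : A) : linspan X x -> linspan X y -> linspan X (x + y).
Proof.
move=> [m [c [g [Hg ->]]]] [m' [c' [g' [Hg' ->]]]].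
exists (m + m')%N, (fun j => match split j with inl i => c i | inr i => c' i end),
  (fun j => match split j with inl i => g i | inr i => g' i end).
split=> [j|]; first by case: (split j).
rewrite big_split_ord; congr (_ + _); apply: eq_bigr => i _.
  by rewrite (unsplitK (inl i)).
by rewrite (unsplitK (inr i)).
Qed.

Lemma linspan_sum X I (r : seq I) (P : pred I) (F : I -> A) :
  (forall i, P i -> linspan X (F i)) -> linspan X (\sum_(i <- r | P i) F i).
Proof. by move=> H; elim/big_ind: _ => //; [exact: linspan0 | exact: linspanD]. Qed.

Lemma sum_tuple_pred1 (d : nat) (G : seq Q -> K) (u : seq Q) : (size u < d)%N ->
  \sum_(l < d) \sum_(t : l.-tuple Q) G t * (tval t == u)%:R = G u.
Proof.
move=> Hu; rewrite (bigD1 (Ordinal Hu)) //= [X in _ + X]big1 ?addr0.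
  rewrite (bigD1 (in_tuple u)) //= eqxx mulr1 big1 ?addr0 // => t Ht.
  by rewrite -val_eqE /= in Ht; rewrite (negbTE Ht) mulr0.
move=> l Hl; rewrite big1 // => t _; case: eqP => [E|]; last by rewrite mulr0.
by case/eqP: Hl; apply: val_inj; rewrite /= -E size_tuple.
Qed.

Lemma rotate_off_equiv (S : A) a : potential S -> cyc_equiv S (rotate_off a S).
Proof.
move=> HS d.
pose G (t : seq Q) := coef S (ahd a, a :: t).
pose D (t : seq Q) : A := pathS (ahd a, a :: t) - pathS (atl a, rcons t a).
exists (\sum_(l < d) \sum_(t : l.-tuple Q) G t *: D t).
  apply: linspan_sum => l _; apply: linspan_sum => t _.
  have [Hc|Hc] := boolP (is_cycle (ahd a, a :: t)).
    by apply: linspanZ; exists a, t.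
  by rewrite /G HS // scale0r; exact: linspan0.
move=> [i s] Hs; rewrite !coefD !coefN.
have [Hw|Hw] := boolP (is_path (i, s)); last by rewrite !coef_out // !subr0.
rewrite coef_pseries Hw coef_sum.
have E1 (l : nat) (t : l.-tuple Q) : coef (G t *: D t) (i, s) =
    (if ohead s == Some a then G t * (tval t == behead s)%:R else 0) -
    (if ohead (rotr 1 s) == Some a then G t * (tval t == behead (rotr 1 s))%:R else 0).
  have [Hc|Hc] := boolP (is_cycle (ahd a, a :: t)); last first.
    by rewrite /G HS // scale0r coef0 !mul0r !if_same subr0.
  have /and3P[Hp _ /eqP Ht] := Hc.
  have Hr : is_path (atl a, rcons t a).
    have Ht' : wtail (atl a) t = ahd a by [].
    by move: Hp; rewrite /is_path /= eqxx -cats1 is_path_cat Ht' /= eqxx => ->.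
  rewrite coefZ coefD coefN !coef_pathS // mulrBr !xpair_eqE.
  congr (_ - _).
    case: s {Hs} Hw => [|c s] Hw /=; first by rewrite andbF mulr0.
    rewrite eqseq_cons -(is_path_head Hw) -[Some c == Some a]/(c == a) [s == _]eq_sym.
    by case: (c =P a) => [->|_]; rewrite ?eqxx ?andbF ?mulr0.
  case/lastP: s {Hs} Hw => [|s c] Hw.
    by rewrite [[::] == _]eq_sym -size_eq0 size_rcons andbF mulr0.
  rewrite eqseq_rcons -[rcons s c]cats1 -[1%N]/(size [:: c]) rotr_size_cat /=.
  rewrite -[Some c == Some a]/(c == a) [s == _]eq_sym.
  case: (c =P a) Hw => [->|_] Hw; last by rewrite !andbF mulr0.
  case: (tval t =P s) => [Et|_]; last by rewrite !andbF.
  rewrite Et in Hr; rewrite andbT.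
  by case: s Hw Hr {Et} => [|b s] /is_path_head <- /is_path_head <-; rewrite eqxx.
under eq_bigr => l _ do (rewrite coef_sum; under eq_bigr => t _ do rewrite E1; rewrite sumrB).
have E2 (u : seq Q) (b : bool) : (size u < d)%N ->
    \sum_(l < d) \sum_(t : l.-tuple Q) (if b then G t * (tval t == u)%:R else 0) =
    if b then G u else 0.
  by move=> Hu; case: b; [rewrite sum_tuple_pred1 | rewrite big1 // => l _; rewrite big1].
rewrite sumrB !E2 ?size_behead ?size_rotr ?(leq_ltn_trans (leq_pred _)) //=.
case: eqP => [Ha|_]; last first.
  rewrite !sub0r opprK opprD addrA subrr sub0r.
  case: eqP => [Ha|_]; last by rewrite oppr0 addr0.
  by rewrite /G; case: (rotr 1 s) Ha => //= c u [->]; rewrite addNr.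
rewrite subr0; case: s Hw Ha {Hs E1} => //= c s Hw [E]; subst c.
rewrite {1}/G -(is_path_head Hw); case: eqP => [Hb|_]; last by rewrite subr0 subrr.
suff -> : G (behead (rotr 1 (a :: s))) = 0 by rewrite subr0 subrr.
rewrite /G HS //; apply/negP; move/and3P=> [H1 _ /eqP H2]; move: H1 H2.
case/lastP: s Hb {Hw} => [|s c] Hb /=.
  by move=> _ /eqP; rewrite (negbTE (noloop a)).
move: Hb; rewrite -rcons_cons -cats1 -[1%N]/(size [:: c]) rotr_size_cat /= => _.
by rewrite /is_path /= eq_sym (negbTE (noloop a)) andbF.
Qed.

Lemma rotate_off_potential (S : A) a : potential S -> potential (rotate_off a S).
Proof.
move=> HS [i s] Hc; rewrite coef_pseries; case: ifP => // Hw.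
case: ifP => // _; rewrite HS // add0r; case: eqP => // Ha.
apply: HS; apply: contra Hc; rewrite /is_cycle Hw /=.
case/lastP: s Hw Ha => // s c Hw.
rewrite -cats1 -[1%N]/(size [:: c]) rotr_size_cat /= => -[Ec]; subst c.
case/andP=> H1 H2; rewrite cats1 -size_eq0 size_rcons -cats1 wtail_cat /=.
case: s Hw H1 H2 => [_ _|b s Hw H1 _]; first by rewrite (negbTE (noloop a)).
rewrite -(is_path_head Hw); case/and3P: H1 => _ /eqP -> _; exact: eqxx.
Qed.

Lemma pathSM i (s t : seq Q) : is_path (i, s ++ t) ->
  pathS (i, s) * pathS (wtail i s, t) = pathS (i, s ++ t) :> A.
Proof.
move=> Hst; have := Hst; rewrite {1}/is_path is_path_cat => /andP[Hs Ht].
apply: cpalgP => -[i' u] Hu; rewrite coefM coef_pathS //.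
case: eqP => [[-> ->]|Ne].
  have Hj : (size s < (size (s ++ t)).+1)%N by rewrite size_cat ltnS leq_addr.
  rewrite (bigD1 (Ordinal Hj)) //= [X in _ + X]big1 ?addr0 => [|j Hne].
    by rewrite take_size_cat // drop_size_cat // !coef_pathS // !eqxx mulr1.
  rewrite coef_pathS // xpair_eqE eqxx; case: eqP => [E|]; last by rewrite mul0r.
  case/eqP: Hne; apply: val_inj; rewrite /= -[in RHS]E size_take_min.
  by apply/esym/minn_idPl; rewrite -ltnS.
rewrite big1 // => j _; rewrite !coef_pathS //.
case: eqP => [[Ei Es]|]; last by rewrite mul0r.
case: eqP => [[_ Et]|]; last by rewrite mulr0.
by case: Ne; rewrite Ei -Es -Et cat_take_drop.
Qed.

End PathAlgebra.
Arguments coef : simpl never.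
Arguments pathS K {n Q} w.
Arguments vtx K {n} Q i.
Arguments arr K {n Q} a.

Section PullBack.
Variables (K : fieldType) (n : nat) (Q Q' : quiver n) (f : Q -> option (seq Q')).

(* If f identifies some of the arrows of Q with paths of Q' with the same ends, the coefficient
   of pullback x at a word in these arrows is the coefficient of x at the corresponding path,
   and the other coefficients are 0. *)
Definition pullback (x : cpalg K Q') : cpalg K Q := pseries (fun w =>
  if all f w.2 then coef x (w.1, flatten (pmap f w.2)) else 0).

Lemma pullback_potential (x : cpalg K Q') :
  (forall c t, f c = Some t -> t != [::] /\ wtail (ahd c) t = atl c) ->
  potential x -> potential (pullback x).
Proof.
move=> Hf Hx [i s] Hc; rewrite coef_pseries /=; case: ifP => // Hp; case: ifP => // Ha.
apply: Hx; apply: contra Hc; case/and3P=> /= _ H1 H2.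
rewrite /is_cycle Hp /=; apply/andP; split; first by case: s H1 {Ha Hp H2}.
suff E : forall j, wtail j (flatten (pmap f s)) = wtail j s by rewrite -(E i).
elim: s Ha {Hp H1 H2} => [//|c s IH] /= /andP[Hc Ha] j.
case E: (f c) Hc => [t|//] _; have [Ht Et] := Hf _ _ E.
rewrite /= wtail_cat (IH Ha) -[RHS]/(wtail (atl c) s); congr wtail.
by rewrite -Et; case: t Ht {E Et}.
Qed.

End PullBack.

Record qp (K : fieldType) (n : nat) := QP {
  qv :> quiver n;
  pot : cpalg K qv;
  potP : potential pot }.

Section QP.
Variables (K : fieldType) (n : nat).
Implicit Types X Y : qp K n.

Definition reduced X : Prop := madic 3 (pot X).

Definition trivial_qp X : Prop :=
  (forall w, size w.2 != 2%N -> coef (pot X) w = 0) /\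
  (forall x, jacobian_ideal (pot X) x <-> madic 1 x).

Section DirectSum.
Variables X Y : qp K n.

Definition dsum_hd (c : X + Y) : 'I_n := match c with inl a => ahd a | inr b => ahd b end.
Definition dsum_tl (c : X + Y) : 'I_n := match c with inl a => atl a | inr b => atl b end.
Fact dsum_noloop c : dsum_tl c != dsum_hd c.
Proof. by case: c => c; exact: noloop. Qed.
Definition dsum_quiver : quiver n := Quiver dsum_noloop.

Definition dsum_left (c : dsum_quiver) : option (seq X) :=
  if c is inl a then Some [:: a] else None.
Definition dsum_right (c : dsum_quiver) : option (seq Y) :=
  if c is inr b then Some [:: b] else None.

Definition dsum_pot : cpalg K dsum_quiver :=
  pullback dsum_left (pot X) + pullback dsum_right (pot Y).

Fact dsum_potP : potential dsum_pot.
Proof.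
move=> w Hw; rewrite coefD !pullback_potential ?addr0 //; try exact: potP.
  by move=> [] // a t [<-].
by move=> [] // a t [<-].
Qed.

Definition dsum : qp K n := QP dsum_potP.
End DirectSum.

Definition right_equiv X Y (phi : {rmorphism cpalg K X -> cpalg K Y}) : Prop :=
  [/\ scalable phi, bijective phi, forall i, phi (vtx K X i) = vtx K Y i &
      cyc_equiv (phi (pot X)) (pot Y)].

Record reduction X := Reduction {
  red : qp K n;
  triv : qp K n;
  redP : reduced red;
  trivP : trivial_qp triv;
  red_phi : {rmorphism cpalg K X -> cpalg K (dsum red triv)};
  red_phiP : right_equiv (Y := dsum red triv) red_phi }.

Definition no2cyc_at (Q : quiver n) (k : 'I_n) : Prop :=
  forall a b : Q, ahd a = k -> atl b = k -> atl a != ahd b.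

Definition no2cyc (Q : quiver n) : Prop := forall k, no2cyc_at Q k.

Section PreMutation.
Variables (k : 'I_n) (Q : quiver n).
Hypothesis H2 : no2cyc_at Q k.

(* The arrows of the quiver before reduction: the arrows not incident to k, the arrows [ba],
   indexed by pairs (b, a), the arrows a*, and the arrows b*. *)
Definition mut_arrow := ({c : Q | (ahd c != k) && (atl c != k)} +
  {p : Q * Q | (atl p.1 == k) && (ahd p.2 == k)} + {a : Q | ahd a == k} + {b : Q | atl b == k})%type.

Definition mut_hd (c : mut_arrow) : 'I_n :=
  match c with
  | inl (inl (inl c)) => ahd (val c)
  | inl (inl (inr p)) => ahd (val p).1
  | inl (inr a) => atl (val a)
  | inr b => k
  end.
Definition mut_tl (c : mut_arrow) : 'I_n :=
  match c with
  | inl (inl (inl c)) => atl (val c)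
  | inl (inl (inr p)) => atl (val p).2
  | inl (inr a) => k
  | inr b => ahd (val b)
  end.

Fact mut_noloop c : mut_tl c != mut_hd c.
Proof.
case: c => [[[c|[[b a] /= /andP[/eqP Hb /eqP Ha]]]|[a /= /eqP <-]]|[b /= /eqP <-]] /=.
- exact: noloop.
- exact: H2.
- by rewrite eq_sym noloop.
- by rewrite eq_sym noloop.
Qed.

Definition mut_quiver : quiver n := Quiver mut_noloop.

Definition mut_old (c : {c : Q | (ahd c != k) && (atl c != k)}) : mut_quiver := inl (inl (inl c)).
Fact mut_comp_subproof (b : {b : Q | atl b == k}) (a : {a : Q | ahd a == k}) :
  (atl (val b, val a).1 == k) && (ahd (val b, val a).2 == k).
Proof. by rewrite (valP a) (valP b). Qed.
Definition mut_comp (b : {b : Q | atl b == k}) (a : {a : Q | ahd a == k}) : mut_quiver :=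
  inl (inl (inr (exist _ (val b, val a) (mut_comp_subproof b a)))).
Definition mut_star_in (a : {a : Q | ahd a == k}) : mut_quiver := inl (inr a).
Definition mut_star_out (b : {b : Q | atl b == k}) : mut_quiver := inr b.

Definition unbracket (c : mut_quiver) : option (seq Q) :=
  match c with
  | inl (inl (inl c)) => Some [:: val c]
  | inl (inl (inr p)) => Some [:: (val p).1; (val p).2]
  | _ => None
  end.

Definition mut_pot (S : cpalg K Q) : cpalg K mut_quiver :=
  pullback unbracket S +
  \sum_(a : {a : Q | ahd a == k}) \sum_(b : {b : Q | atl b == k})
    arr K (mut_comp b a) * arr K (mut_star_in a) * arr K (mut_star_out b).

Fact mut_potP S : potential S -> potential (mut_pot S).
Proof.
move=> HS w Hw; rewrite coefD pullback_potential ?add0r //; last first.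
  move=> [[[c|p]|a]|b] t //= [<-] //; split=> //.
rewrite coef_sum big1 // => a _; rewrite coef_sum big1 // => b _.
set c1 := mut_comp b a; set c2 := mut_star_in a; set c3 := mut_star_out b.
have Hp : is_path (ahd c1, [:: c1; c2; c3]) by rewrite /is_path /= !eqxx.
rewrite /arr.
rewrite (_ : ahd c2 = wtail (ahd c1) [:: c1]) // pathSM //.
rewrite (_ : ahd c3 = wtail (ahd c1) ([:: c1] ++ [:: c2])) // pathSM //.
rewrite coef_pathS //; case: eqP Hw => // ->.
by rewrite /is_cycle Hp /= eqxx.
all: by rewrite /is_path /= ?eqxx.
Qed.

End PreMutation.

Definition premut X k (H2 : no2cyc_at X k) S (HS : potential S) : qp K n :=
  QP (@mut_potP k X H2 S HS).

(* A possible outcome of the mutation of X at k; it depends on the choice of S in its cyclic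
   class and on the choice of the reduction, and is unique up to right-equivalence. *)
Record qp_mutation X (k : 'I_n) := QPMutation {
  qm_reduced : reduced X;
  qm_no2cyc : no2cyc_at X k;
  qm_pot : cpalg K X;
  qm_potP : potential qm_pot;
  qm_equiv : cyc_equiv (pot X) qm_pot;
  qm_start : forall s, coef qm_pot (k, s) = 0;
  qm_red : reduction (premut qm_no2cyc qm_potP) }.

Definition qm_pre X k (D : qp_mutation X k) : qp K n := premut (qm_no2cyc D) (qm_potP D).
Definition qm_target X k (D : qp_mutation X k) : qp K n := red (qm_red D).

(* ks is a sequence of mutations that creates no oriented 2-cycles; as the outcome of each
   mutation is unique up to right-equivalence, it is enough to quantify over all of them. *)
Fixpoint mutable (ks : seq 'I_n) X : Prop :=
  no2cyc X /\
  if ks is k :: ks' then forall D : qp_mutation X k, mutable ks' (qm_target D) else True.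

Definition nondegenerate_qp X : Prop := forall ks, mutable ks X.

(* Finite-dimensional modules over the complete path algebra. *)
Record pamod (Q : quiver n) := PAMod {
  space : vectType K;
  act : {linear cpalg K Q -> 'End(space)};
  actM : forall x y, act (x * y) = (act x \o act y)%VF;
  act1 : act 1 = \1%VF }.

Record qprep X := QPRep {
  rmod :> pamod X;
  rnil : exists N, forall w, is_path w -> (N <= size w.2)%N -> act rmod (pathS K w) = 0;
  rjac : forall a, act rmod (cder a (pot X)) = 0;
  dec : 'I_n -> vectType K }.

Definition finj (I : finType) (V : vectType K) (i : I) : 'Hom(V, {ffun I -> V}) :=
  linfun (fun v => [ffun j => if j == i then v else 0]).
Definition fproj (I : finType) (V : vectType K) (i : I) : 'Hom({ffun I -> V}, V) :=
  linfun (fun f : {ffun I -> V} => f i).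

Section Rep.
Variables (X : qp K n) (M : qprep X).

(* M(i) = e_i M. *)
Definition vsp (i : 'I_n) : {vspace space M} := limg (act M (vtx K X i)).

Section AtVertex.
Variable k : 'I_n.

(* M_in(k) and M_out(k) are subspaces of the space of families of elements of M indexed by all
   the arrows; the components at the other arrows are 0. *)
Definition M_in : {vspace {ffun X -> space M}} :=
  (\sum_(a : X | ahd a == k) finj (space M) a @: vsp (atl a))%VS.
Definition M_out : {vspace {ffun X -> space M}} :=
  (\sum_(b : X | atl b == k) finj (space M) b @: vsp (ahd b))%VS.

Definition alpha : 'Hom({ffun X -> space M}, space M) :=
  \sum_(a : X | ahd a == k) (act M (arr K a) \o fproj (space M) a)%VF.
Definition beta : 'Hom(space M, {ffun X -> space M}) :=
  \sum_(b : X | atl b == k) (finj (space M) b \o act M (arr K b))%VF.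
Definition gamma : 'End({ffun X -> space M}) :=
  \sum_(a : X | ahd a == k) \sum_(b : X | atl b == k)
    (finj (space M) a \o act M (dder b a (pot X)) \o fproj (space M) b)%VF.

(* alpha, beta and gamma as maps on M_in(k), M(k) and M_out(k). *)
Definition ker_alpha := (M_in :&: lker alpha)%VS.
Definition im_alpha := (alpha @: M_in)%VS.
Definition ker_beta := (vsp k :&: lker beta)%VS.
Definition im_beta := (beta @: vsp k)%VS.
Definition ker_gamma := (M_out :&: lker gamma)%VS.
Definition im_gamma := (gamma @: M_out)%VS.

Definition g_inv : int := (\dim ker_gamma)%:Z - (\dim (vsp k))%:Z + (\dim {:dec M k})%:Z.
Definition h_inv : int := - (\dim ker_beta)%:Z.

End AtVertex.
End Rep.

Section Invariants.
Variable X : qp K n.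

Definition commutator (M N : qprep X) (x : cpalg K X) :
    'Hom('Hom(space M, space N), 'Hom(space M, space N)) :=
  linfun (fun f : 'Hom(space M, space N) => (f \o act M x)%VF - (act N x \o f)%VF).

(* A family of maps f_i : M(i) -> N(i) is the same as a linear map M -> N that commutes with
   the e_i. *)
Definition Hom_Q (M N : qprep X) : {vspace 'Hom(space M, space N)} :=
  ((\bigcap_(i : 'I_n) lker (commutator M N (vtx K X i))) :&:
   (\bigcap_(a : X) lker (commutator M N (arr K a))))%VS.

Definition E_inj (M N : qprep X) : int :=
  (\dim (Hom_Q M N))%:Z + \sum_(i < n) (\dim (vsp M i))%:Z * g_inv N i.

Definition E_sym (M N : qprep X) : int := E_inj M N + E_inj N M.

Definition E_self (M : qprep X) : int := E_inj M M.

End Invariants.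

Definition is_quotient (V W : vectType K) (p : 'Hom(V, W)) (U U' : {vspace V}) : Prop :=
  (p @: U = fullv)%VS /\ (U :&: lker p = U')%VS.

Definition iso_on (V W : vectType K) (f : 'Hom(V, W)) (U : {vspace V}) (U' : {vspace W}) : Prop :=
  (f @: U = U')%VS /\ (U :&: lker f = 0)%VS.

Section MutateRep.
Variables (X : qp K n) (k : 'I_n) (D : qp_mutation X k).

(* The representation of the QP before reduction, up to isomorphism: theta identifies M(i) with
   Mt(i) for i <> k, psi identifies Mt(k) with the direct sum of the four spaces, and pi1, pi3
   are the projections onto the two quotients. *)
Record premut_rep (M : qprep X) (Mt : qprep (qm_pre D)) := PremutRep {
  pr_theta : 'Hom(space M, space Mt);
  pr_theta_iso : forall i, i != k -> iso_on pr_theta (vsp M i) (vsp Mt i);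
  pr_old : forall (c : {c : X | (ahd c != k) && (atl c != k)}) x, x \in vsp M (atl (val c)) ->
    act Mt (arr K (mut_old (qm_no2cyc D) c)) (pr_theta x) =
    pr_theta (act M (arr K (val c)) x);
  pr_comp : forall (b : {b : X | atl b == k}) (a : {a : X | ahd a == k}) x,
    x \in vsp M (atl (val a)) ->
    act Mt (arr K (mut_comp (qm_no2cyc D) b a)) (pr_theta x) =
    pr_theta (act M (arr K (val b)) (act M (arr K (val a)) x));
  pr_X1 : vectType K;
  pr_X3 : vectType K;
  pr_pi1 : 'Hom({ffun X -> space M}, pr_X1);
  pr_pi3 : 'Hom({ffun X -> space M}, pr_X3);
  pr_quot1 : is_quotient pr_pi1 (ker_gamma M k) (im_beta M k);
  pr_quot3 : is_quotient pr_pi3 (ker_alpha M k) (im_gamma M k);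
  pr_rho : 'End({ffun X -> space M});
  pr_rho_im : (pr_rho @: M_out M k <= ker_gamma M k)%VS;
  pr_rho_id : forall x, x \in ker_gamma M k -> pr_rho x = x;
  pr_sigma : 'Hom(pr_X3, {ffun X -> space M});
  pr_sigma_ker : forall x, pr_sigma x \in ker_alpha M k;
  pr_sigma_sec : forall x, pr_pi3 (pr_sigma x) = x;
  pr_psi : 'Hom(space Mt, (pr_X1 * subvs_of (im_gamma M k) * pr_X3 * dec M k)%type);
  pr_psi_iso : iso_on pr_psi (vsp Mt k) fullv;
  pr_star_out : forall (b : {b : X | atl b == k}) x, x \in vsp M (ahd (val b)) ->
    pr_psi (act Mt (arr K (mut_star_out (qm_no2cyc D) b)) (pr_theta x)) =
    (- pr_pi1 (pr_rho (finj (space M) (val b) x)),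
     - vsproj (im_gamma M k) (gamma M k (finj (space M) (val b) x)), 0, 0);
  pr_star_in : forall (a : {a : X | ahd a == k}) y x1 x2 x3 v, y \in vsp Mt k ->
    pr_psi y = (x1, x2, x3, v) ->
    act Mt (arr K (mut_star_in (qm_no2cyc D) a)) y =
    pr_theta (fproj (space M) (val a) (vsval x2 + pr_sigma x3));
  pr_dec : forall i, 'Hom(dec M i, dec Mt i);
  pr_dec_iso : forall i, i != k -> iso_on (pr_dec i) fullv fullv;
  pr_dec_k : 'Hom(space M, dec Mt k);
  pr_dec_quot : is_quotient pr_dec_k (ker_beta M k) (ker_beta M k :&: im_alpha M k)%VS }.

(* Mb is obtained from Mt by transport along the right-equivalence of the reduction D and
   restriction to the arrows of the reduced part. *)
Record reduction_rep (Mt : qprep (qm_pre D)) (Mb : qprep (qm_target D)) := ReductionRep {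
  rr_iso : 'Hom(space Mt, space Mb);
  rr_isoP : iso_on rr_iso fullv fullv;
  rr_vtx : forall i x, rr_iso (act Mt (vtx K _ i) x) = act Mb (vtx K _ i) (rr_iso x);
  rr_arr : forall (c : qm_target D) (u : cpalg K (qm_pre D)) x,
    red_phi (qm_red D) u = arr K (inl c : dsum (red (qm_red D)) (triv (qm_red D))) ->
    rr_iso (act Mt u x) = act Mb (arr K c) (rr_iso x);
  rr_dec : forall i, 'Hom(dec Mt i, dec Mb i);
  rr_dec_iso : forall i, iso_on (rr_dec i) fullv fullv }.

Record rep_mutation (M : qprep X) (Mb : qprep (qm_target D)) := RepMutation {
  rm_pre : qprep (qm_pre D);
  rm_premut : premut_rep M rm_pre;
  rm_red : reduction_rep rm_pre Mb }.

End MutateRep.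

End QP.
Arguments rep_mutation {K n X k} D M Mb.

(* Main.v *)
(* Both terms of E^inj are compared through the representations before reduction.

   Reduction: a nilpotent module E is killed by the Jacobian ideal of S if and only if the trace
   of delta(S) vanishes for every derivation delta of the path algebra with values in End(E).
   This criterion does not refer to the arrows, so it is preserved by right-equivalences. Applied
   to the one-point extensions of M by the simple module at i, which are parametrized by M_out(i)
   and among which ker gamma_i selects those killed by the Jacobian ideal, it shows that
   dim ker gamma_i does not change under reduction.

   Mutation: the arrows a*, b* are built so that ker(alpha) and im(beta) at k trade places, and
   gamma_k is exchanged, up to sign, with beta_k alpha_k. Hence a family of maps given away from k
   extends to a morphism M -> N if and only if it extends to a morphism between the mutated
   representations, and dim Hom_Q changes only through the maps supported at k, which form the
   space Hom(coker alpha_k(M), ker beta_k(N)). For i <> k the relations from the arrows at i yield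
   g_i(mu_k N) = g_i(N) + p h_k(N) - q h_k(mu_k N), with p and q the numbers of arrows i -> k and
   k -> i, and g_k changes sign; the theorem follows by summation over i. *)
From HB Require Import structures.
From mathcomp Require Import all_boot all_order all_algebra.
From mathcomp Require Import reals complex zify ring.
Require Import Defs.

Set Implicit Arguments.
Unset Strict Implicit.
Unset Printing Implicit Defensive.

Import Order.TTheory GRing.Theory Num.Theory VectorInternalTheory.
Local Open Scope ring_scope.

(** * Quotients of paths by their last arrow *)

(** A right-equivalence mixes arrows with longer paths, so neither [M_out] nor the second
    derivatives are carried to their counterparts by a formula on generators. Hence a vector of
    [M_out] is treated as a module, and composing its connecting map [conn] with an algebra morphism
    replaces a change of variables. Modules let the last letter of a path act first. For this reason
    series are divided by their last arrows, and statements about infinite series are proved by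
    induction on a power of m that kills a vector. The second derivative by [ba] is the quotient of
    the derivative by [a] by its last arrow [b]. At a vertex i other than k, the absence of 2-cycles
    through k leaves two cases: without arrows k -> i, the relations of the arrows a* are solved
    because the mutated alpha has kernel im(beta); without arrows i -> k, those of the arrows [ba]
    are solved because the mutated beta has image ker(alpha). For each arrow between i and k the
    solution is unique up to [ker_beta] of one of the two representations; this is the origin of the
    correction terms in g_i. *)

Lemma dropl_cat (T : Type) p (s t : seq T) :
  (p <= size s)%N -> drop p (s ++ t) = drop p s ++ t.
Proof.
rewrite drop_cat leq_eqVlt => /orP[/eqP->|->//].
by rewrite ltnn subnn drop0 drop_size.
Qed.

Section PathSeries.
Variables (K : fieldType) (n : nat) (Q : quiver n).
Local Notation A := (cpalg K Q).
Implicit Types (u v x y : A) (a b c : Q) (s t : seq Q) (i j : 'I_n).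

(** The character through which the path algebra acts on the simple module at [i]. *)
Definition eps i u : K := coef u (i, [::]).

(** Right division by the arrow [b]: it keeps the paths on which [b] is the letter that acts first
    on a module. *)
Definition rquo b u : A := pseries (fun w => coef u (w.1, rcons w.2 b)).

Lemma is_path_rcons i s b :
  is_path (i, rcons s b) = is_path (i, s) && (ahd b == wtail i s).
Proof. by rewrite -cats1 /is_path /= is_path_cat /= andbT. Qed.

Lemma wtail_rcons i s b : wtail i (rcons s b) = atl b.
Proof. by rewrite -cats1 wtail_cat. Qed.

Lemma coef_rquo b u i s : coef (rquo b u) (i, s) = coef u (i, rcons s b).
Proof.
rewrite coef_pseries; case: ifPn => //= Hs; rewrite coef_out //.
by rewrite is_path_rcons negb_and Hs.
Qed.

Lemma is_path_arr b : is_path (ahd b, [:: b]).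
Proof. by rewrite /is_path /= eqxx. Qed.

Lemma coef_vtx i j s : coef (vtx K Q i) (j, s) = ((j == i) && (s == [::]))%:R.
Proof. by rewrite coef_pathS. Qed.

Lemma coef_arr b i s : coef (arr K b) (i, s) = ((i == ahd b) && (s == [:: b]))%:R.
Proof. by rewrite coef_pathS // is_path_arr. Qed.

Lemma eps_vtx i j : eps i (vtx K Q j) = (i == j)%:R.
Proof. by rewrite /eps coef_vtx andbT. Qed.

Lemma eps_arr i b : eps i (arr K b) = 0.
Proof. by rewrite /eps coef_arr andbF. Qed.

Lemma epsM i u v : eps i (u * v) = eps i u * eps i v.
Proof. by rewrite /eps coefM big_ord1. Qed.

Lemma eps1 i : eps i (1 : A) = 1.
Proof. by rewrite /eps coef1. Qed.

Lemma scaleS_mull (z : K) u v : (z *: u) * v = z *: (u * v).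
Proof.
apply: cpalgP => -[i s] _; rewrite coefZ !coefM mulr_sumr.
by apply: eq_bigr => j _; rewrite coefZ mulrA.
Qed.

Lemma scaleS_mulr (z : K) u v : u * (z *: v) = z *: (u * v).
Proof.
apply: cpalgP => -[i s] _; rewrite coefZ !coefM mulr_sumr.
by apply: eq_bigr => j _; rewrite coefZ mulrCA.
Qed.

Fact eps_is_linear i : linear (eps i : A -> K^o).
Proof. by move=> c u v; rewrite /eps coefD coefZ. Qed.
HB.instance Definition _ i := GRing.isLinear.Build K A K^o _ (eps i) (eps_is_linear i).

Fact rquo_is_linear b : linear (rquo b).
Proof.
by move=> c u v; apply: cpalgP => -[i s] _; rewrite !(coefD, coefZ, coef_rquo).
Qed.
HB.instance Definition _ b := GRing.isLinear.Build K A A _ (rquo b) (rquo_is_linear b).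

(** A twisted Leibniz rule: the last letter of a product comes from [v], unless [v] contributes only
    its constant term, necessarily the one at the vertex [atl b] where [b] starts. *)
Lemma rquoM b u v : rquo b (u * v) = u * rquo b v + eps (atl b) v *: rquo b u.
Proof.
apply: cpalgP => -[i s] _; rewrite coefD coefZ !coef_rquo !coefM size_rcons.
rewrite big_ord_recr /=; congr (_ + _).
  apply: eq_bigr => j _; have Hj : (j <= size s)%N by rewrite -ltnS.
  by rewrite coef_rquo -!cats1 takel_cat // dropl_cat.
by rewrite -(size_rcons s b) take_size drop_size wtail_rcons mulrC.
Qed.

Lemma rquo_vtx b i : rquo b (vtx K Q i) = 0.
Proof.
apply: cpalgP => -[j s] _; rewrite coef_rquo coef_vtx coef0.
by rewrite -size_eq0 size_rcons andbF.
Qed.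

Lemma rquo_arr b c : rquo b (arr K c) = if b == c then vtx K Q (ahd b) else 0.
Proof.
apply: cpalgP => -[j s] _; rewrite coef_rquo coef_arr.
rewrite -[[:: c]]/(rcons [::] c) eqseq_rcons.
by case: (b =P c) => [->|_]; rewrite ?andbT ?andbF ?coef_vtx ?coef0.
Qed.

Lemma coef_vtxM i u j s : coef (vtx K Q i * u) (j, s) = (j == i)%:R * coef u (j, s).
Proof.
rewrite coefM big_ord_recl /= take0 drop0 big1 ?addr0; first by rewrite coef_vtx andbT.
by case: s => [|a s] [] //= l _; rewrite coef_vtx andbF mul0r.
Qed.

Lemma coef_Mvtx i u j s : coef (u * vtx K Q i) (j, s) = (wtail j s == i)%:R * coef u (j, s).
Proof.
rewrite coefM big_ord_recr /= take_size drop_size big1 ?add0r.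
  by rewrite coef_vtx andbT mulrC.
move=> [l Hl] _ /=; rewrite coef_vtx -size_eq0 size_drop subn_eq0.
by rewrite leqNgt Hl andbF mulr0.
Qed.

Lemma vtxM i j : vtx K Q i * vtx K Q j = if i == j then vtx K Q i else 0.
Proof.
apply: cpalgP => -[l s] _; rewrite coef_vtxM !coef_vtx.
case: (i =P j) => [<-|Ne]; rewrite ?coef0 ?coef_vtx.
  by case: (l == i); rewrite ?mul1r ?mul0r.
by case: (l =P i) => [->|]; rewrite ?mul0r //; case: eqP Ne; rewrite ?mulr0.
Qed.

Lemma sum_vtx : \sum_i vtx K Q i = 1.
Proof.
apply: cpalgP => -[l s] _; rewrite coef_sum coef1 (bigD1 l) //= big1 ?addr0.
  by rewrite coef_vtx eqxx.
by move=> i Hi; rewrite coef_vtx eq_sym (negbTE Hi).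
Qed.

Lemma vtx_arr b : vtx K Q (ahd b) * arr K b = arr K b.
Proof.
apply: cpalgP => -[l s] _; rewrite coef_vtxM coef_arr.
by case: eqP; rewrite ?mul1r ?mul0r.
Qed.

Lemma arr_vtx b : arr K b * vtx K Q (atl b) = arr K b.
Proof.
apply: cpalgP => -[l s] _; rewrite coef_Mvtx coef_arr.
by case: andP => [[/eqP-> /eqP->]|]; rewrite ?mulr0 // /wtail /= eqxx mulr1.
Qed.

Lemma coef_Marr_nil u b i : coef (u * arr K b) (i, [::]) = 0.
Proof. by rewrite coefM big_ord1 coef_arr andbF mulr0. Qed.

Lemma coef_Marr u b i s c : is_path (i, rcons s c) ->
  coef (u * arr K b) (i, rcons s c) = (c == b)%:R * coef u (i, s).
Proof.
rewrite is_path_rcons => /andP[Hs /eqP Hc].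
rewrite coefM size_rcons 2!big_ord_recr /= big1 ?add0r => [|[l Hl] _ /=].
  have -> : take (size s) (rcons s c) = s by rewrite -cats1 take_size_cat.
  have -> : drop (size s) (rcons s c) = [:: c] by rewrite -cats1 drop_size_cat.
  rewrite -(size_rcons s c) drop_size !coef_arr andbF mulr0 addr0 -Hc eqseq_cons andbT.
  by case: (c =P b) => [->|]; rewrite ?eqxx ?andbF ?mulr1 ?mul1r ?mulr0 ?mul0r.
rewrite coef_arr; case: andP => [[_ /eqP E]|]; last by rewrite mulr0.
have := congr1 size E; rewrite size_drop size_rcons /= => /eqP; lia.
Qed.

(** The arrows generate the radical as a left ideal, with [rquo] giving the coefficients. Every
    recursion on last letters rests on this finite expansion of an infinite series. *)
Lemma rquo_expand u : u = \sum_i eps i u *: vtx K Q i + \sum_b rquo b u * arr K b.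
Proof.
apply: cpalgP => -[i s]; rewrite coefD !coef_sum; case/lastP: s => [|s c] Hp.
  rewrite [X in _ = _ + X]big1 ?addr0 => [|b _]; last exact: coef_Marr_nil.
  rewrite (bigD1 i) //= big1 ?addr0 => [|j Hj]; first by rewrite coefZ coef_vtx !eqxx mulr1.
  by rewrite coefZ coef_vtx eq_sym (negbTE Hj) mulr0.
rewrite [X in _ = X + _]big1 ?add0r => [|j _]; last first.
  by rewrite coefZ coef_vtx -size_eq0 size_rcons andbF mulr0.
rewrite (bigD1 c) //= big1 ?addr0 => [|b Hb]; first by rewrite coef_Marr // eqxx mul1r coef_rquo.
by rewrite coef_Marr // eq_sym (negbTE Hb) mul0r.
Qed.

Lemma madicW p q u : (q <= p)%N -> madic p u -> madic q u.
Proof. by move=> Hpq Hu w Hw; apply: Hu; apply: leq_trans Hpq. Qed.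

Lemma madic0 p : madic p (0 : A).
Proof. by move=> w _; rewrite coef0. Qed.

Lemma madicD p u v : madic p u -> madic p v -> madic p (u + v).
Proof. by move=> Hu Hv w Hw; rewrite coefD Hu // Hv // addr0. Qed.

Lemma madic_sum p (I : Type) (r : seq I) (P : pred I) (F : I -> A) :
  (forall l, P l -> madic p (F l)) -> madic p (\sum_(l <- r | P l) F l).
Proof. by move=> H; elim/big_ind: _ => //; [exact: madic0 | exact: madicD]. Qed.

Lemma madicM p q u v : madic p u -> madic q v -> madic (p + q) (u * v).
Proof.
move=> Hu Hv [i s] /= Hs; rewrite coefM big1 // => -[l Hl] _ /=.
have [Hp|Hp] := ltnP l p.
  rewrite Hu ?mul0r //= size_take_min; apply: leq_ltn_trans Hp; exact: geq_minl.
by rewrite Hv ?mulr0 //= size_drop; lia.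
Qed.

Lemma madic_rquo p b u : madic p.+1 u -> madic p (rquo b u).
Proof. by move=> Hu [i s] /= Hs; rewrite coef_rquo Hu //= size_rcons. Qed.

Lemma madic_arr b : madic 1 (arr K b).
Proof. by move=> [i [|c s]] //= _; rewrite coef_arr andbF. Qed.

Lemma madic_eps p i u : madic p.+1 u -> eps i u = 0.
Proof. by move=> Hu; apply: Hu. Qed.

(* Without loops, a cycle has length at least 2. *)
Lemma potential_madic2 (S : A) : potential S -> madic 2 S.
Proof.
move=> HS [i [|a [|b s]]] //= _; apply: HS; rewrite /is_cycle /is_path /= ?andbF ?andbT //.
by rewrite /wtail /=; apply/negP=> /andP[/eqP<-]; rewrite (negbTE (noloop a)).
Qed.

(** A map that kills some power of m sees only finitely many words of [S], so it is enough to test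
    it on cyclic paths. *)
Lemma potential_dense (V : lmodType K) (L : {linear A -> V}) N (S : A) :
    (forall u, madic N u -> L u = 0) -> (forall w, is_cycle w -> L (pathS K w) = 0) ->
  potential S -> L S = 0.
Proof.
move=> HN Hc HS.
pose T := \sum_(l < N) \sum_(t : l.-tuple Q) \sum_i
  coef S (i, val t) *: pathS K (i, val t).
have HT : madic N (S - T).
  move=> [i s] /= Hs; rewrite coefD coefN coef_sum.
  have [Hp|Hp] := boolP (is_path (i, s)); last first.
    rewrite coef_out // sub0r big1 ?oppr0 // => l _.
    rewrite coef_sum big1 // => t _; rewrite coef_sum big1 // => j _.
    by rewrite [coef (_ *: _) _]coef_out.
  rewrite -(@sum_tuple_pred1 K n Q N (fun t => coef S (i, t)) s Hs) -sumrB big1 // => l _.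
  rewrite coef_sum -sumrB big1 // => t _; rewrite coef_sum (bigD1 i) //= big1.
    rewrite addr0 coefZ coef_pseries Hp xpair_eqE eqxx [s == _]eq_sym.
    by rewrite subrr.
  move=> j Hj; rewrite coefZ coef_pseries Hp xpair_eqE [i == j]eq_sym (negbTE Hj).
  by rewrite mulr0.
have -> : S = (S - T) + T by rewrite subrK.
rewrite linearD HN // add0r !linear_sum big1 // => l _.
rewrite linear_sum big1 // => t _; rewrite linear_sum big1 // => i _.
rewrite linearZ /=; have [/Hc->|/HS->] := boolP (is_cycle (i, val t)).
  by rewrite scaler0.
by rewrite scale0r.
Qed.

End PathSeries.

(** * Derivations and traces on nilpotent modules *)

Section LinearPred.
Variables (K : fieldType) (V W : lmodType K) (f : V -> W).
Hypothesis Hf : linear f.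
Let f' : {linear V -> W} :=
  HB.pack_for {linear V -> W} f (GRing.isLinear.Build K V W _ f Hf).

Lemma lin_fun0 : f 0 = 0. Proof. exact: (linear0 f'). Qed.
Lemma lin_funD : {morph f : x y / x + y}. Proof. exact: (linearD f'). Qed.
Lemma lin_funN : {morph f : x / - x}. Proof. exact: (linearN f'). Qed.
Lemma lin_funZ (c : K) : {morph f : x / c *: x}. Proof. exact: (linearZ_LR f' c). Qed.
Lemma lin_fun_sum (I : Type) (r : seq I) (P : pred I) (g : I -> V) :
  f (\sum_(l <- r | P l) g l) = \sum_(l <- r | P l) f (g l).
Proof. exact: (linear_sum f'). Qed.
End LinearPred.

Lemma linfunE (K : fieldType) (V W : vectType K) (f : V -> W) :
  linear f -> linfun f =1 f.
Proof.
move=> Hf; exact: (lfunE (HB.pack_for {linear V -> W} f (GRing.isLinear.Build K V W _ f Hf))).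
Qed.

Section Trace.
Variable K : fieldType.
Implicit Types V W : vectType K.

Definition stdb V (j : 'I_(dim V)) : V := r2v (delta_mx 0 j).

Definition lftrace V (f : 'End(V)) : K := \sum_j v2r (f (stdb j)) 0 j.

Lemma stdb_expand V (x : V) : x = \sum_j v2r x 0 j *: stdb j.
Proof.
rewrite -[LHS]v2rK {1}[v2r x]row_sum_delta linear_sum.
by apply: eq_bigr => j _; rewrite linearZ.
Qed.

Fact lftrace_is_linear V : linear (@lftrace V : _ -> K^o).
Proof.
move=> c f g; rewrite /lftrace scaler_sumr -big_split; apply: eq_bigr => j _ /=.
by rewrite add_lfunE scale_lfunE linearP !mxE.
Qed.

Lemma lftrace0 V : lftrace (0 : 'End(V)) = 0.
Proof. exact: (lin_fun0 (@lftrace_is_linear V)). Qed.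
Lemma lftraceD V (f g : 'End(V)) : lftrace (f + g) = lftrace f + lftrace g.
Proof. exact: (lin_funD (@lftrace_is_linear V)). Qed.
Lemma lftraceN V (f : 'End(V)) : lftrace (- f) = - lftrace f.
Proof. exact: (lin_funN (@lftrace_is_linear V)). Qed.
Lemma lftraceZ V c (f : 'End(V)) : lftrace (c *: f) = c * lftrace f.
Proof. exact: (lin_funZ (@lftrace_is_linear V)). Qed.
Lemma lftrace_sum V (I : Type) (r : seq I) (P : pred I) (f : I -> 'End(V)) :
  lftrace (\sum_(l <- r | P l) f l) = \sum_(l <- r | P l) lftrace (f l).
Proof. exact: (lin_fun_sum (@lftrace_is_linear V)). Qed.

Lemma lftraceC V W (f : 'Hom(V, W)) (g : 'Hom(W, V)) : lftrace (f \o g)%VF = lftrace (g \o f)%VF.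
Proof.
have E (V1 V2 : vectType K) (f1 : 'Hom(V1, V2)) (g1 : 'Hom(V2, V1)) :
    lftrace (f1 \o g1)%VF =
    \sum_j \sum_l v2r (g1 (stdb j)) 0 l * v2r (f1 (stdb l)) 0 j.
  apply: eq_bigr => j _; rewrite comp_lfunE {1}[g1 _]stdb_expand !linear_sum summxE.
  by apply: eq_bigr => l _; rewrite !linearZ mxE.
rewrite !E exchange_big; apply: eq_bigr => j _; apply: eq_bigr => l _.
by rewrite mulrC.
Qed.

(** The trace form is nondegenerate: against the rank one map sending [x] to its m-th coordinate
    times [h], the trace is the m-th coordinate of [f h]. *)
Lemma lftrace_nondeg V W (f : 'Hom(V, W)) : (forall g : 'Hom(W, V), lftrace (f \o g)%VF = 0) -> f = 0.
Proof.
move=> H; apply/lfunP=> h; rewrite zero_lfunE; apply: v2r_inj; rewrite linear0.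
apply/rowP=> m; rewrite mxE.
have lin_g : linear (fun x : W => v2r x 0 m *: h).
  by move=> c x y; rewrite linearP !mxE scalerDl scalerA.
pose g : 'Hom(W, V) := linfun (fun x : W => v2r x 0 m *: h).
have gE : g =1 _ := linfunE lin_g.
rewrite -[RHS](H g) /lftrace (bigD1 m) //= big1 ?addr0 => [|j Hj].
  by rewrite comp_lfunE gE linearZ linearZ mxE r2vK mxE !eqxx mul1r.
by rewrite comp_lfunE gE linearZ linearZ mxE r2vK mxE eqxx eq_sym (negbTE Hj) mul0r.
Qed.

End Trace.

(** * Nilpotent modules and derivations prescribed on the arrows *)

Section Modules.
Variables (K : fieldType) (n : nat) (Q : quiver n).
Local Notation A := (cpalg K Q).
Implicit Types (u v : A) (a b c : Q) (s t : seq Q) (i j : 'I_n) (E F G : pamod K Q).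

(** A [pamod] carries no continuity condition; vanishing on a power of m, for all series and not
    only for paths, supplies it. *)
Definition nilpotent E := exists N, forall u, madic N u -> act E u = 0.

(** The cyclic derivatives suffice: on a nilpotent module the annihilator is a closed two-sided
    ideal. *)
Definition jac_killed E (S : A) := forall a, act E (cder a S) = 0.

Lemma actME E u v x : act E (u * v) x = act E u (act E v x).
Proof. by rewrite actM comp_lfunE. Qed.

Lemma actZE E (z : K) u x : act E (z *: u) x = z *: act E u x.
Proof. by rewrite linearZ /= scale_lfunE. Qed.

Lemma actDE E u v x : act E (u + v) x = act E u x + act E v x.
Proof. by rewrite linearD add_lfunE. Qed.

Lemma act0E E x : act E 0 x = 0.
Proof. by rewrite linear0 zero_lfunE. Qed.

Lemma act_sumE E (I : Type) (r : seq I) (P : pred I) (f : I -> A) x :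
  act E (\sum_(l <- r | P l) f l) x = \sum_(l <- r | P l) act E (f l) x.
Proof. by rewrite linear_sum /= sum_lfunE. Qed.

Lemma act_vtx_sum E x : x = \sum_i act E (vtx K Q i) x.
Proof. by rewrite -act_sumE sum_vtx act1 id_lfunE. Qed.

Lemma act_expand E u x : act E u x =
  \sum_i eps i u *: act E (vtx K Q i) x + \sum_b act E (rquo b u) (act E (arr K b) x).
Proof.
rewrite {1}(rquo_expand u) actDE !act_sumE; congr (_ + _).
  by apply: eq_bigr => i _; rewrite actZE.
by apply: eq_bigr => b _; rewrite actME.
Qed.

(** Induction on a power of m that kills the vector; each arrow lowers the exponent. *)
Lemma nilpotent_ind E (P : space E -> Prop) : nilpotent E -> P 0 ->
  (forall x, (forall b, P (act E (arr K b) x)) -> P x) -> forall x, P x.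
Proof.
move=> [N HN] P0 PS x; have {HN} : forall u, madic N u -> act E u x = 0.
  by move=> u Hu; rewrite HN // zero_lfunE.
elim: N x => [|N IH] x Hx.
  (* The power m^0 is the whole algebra, so even [1] kills [x]. *)
  suff -> : x = 0 by [].
  by rewrite -(Hx 1) ?act1 ?id_lfunE // => w.
apply: PS => b; apply: IH => u Hu; rewrite -actME; apply: Hx.
by rewrite -addn1; apply: madicM => //; exact: madic_arr.
Qed.

(** Linearity alone does not evaluate an infinite series term by term. Dividing [N] times by a last
    arrow writes a series in m^N as a finite sum of series times paths of length [N], and these
    paths act as zero. *)
Lemma paths_nilpotent E :
  (exists N, forall w, is_path w -> (N <= size w.2)%N -> act E (pathS K w) = 0) ->
  nilpotent E.
Proof.
move=> [N HN]; exists N => u Hu; apply/lfunP=> x; rewrite zero_lfunE.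
have {HN} : forall w, is_path w -> size w.2 = N -> act E (pathS K w) x = 0.
  by move=> w Hw Hs; rewrite HN ?Hs // zero_lfunE.
elim: N u Hu x => [|N IH] u Hu x Hx.
  rewrite (act_vtx_sum x) linear_sum big1 // => i _.
  by rewrite Hx // linear0.
rewrite act_expand big1 ?add0r => [|i _]; last by rewrite (madic_eps _ Hu) scale0r.
rewrite big1 // => b _; apply: IH; first exact: madic_rquo.
move=> [i s] Hw Hs; rewrite -actME.
have [Hp|Hp] := boolP (is_path (i, rcons s b)).
  suff -> : pathS K (i, s) * arr K b = pathS K (i, rcons s b).
    by apply: Hx => //=; rewrite size_rcons Hs.
  move: (Hp); rewrite -cats1 => /pathSM <-; congr (_ * pathS K (_, _)).
  by move: Hp; rewrite is_path_rcons => /andP[_ /eqP].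
suff -> : pathS K (i, s) * arr K b = 0 by rewrite act0E.
apply: cpalgP => -[j t]; case/lastP: t => [|t c] Ht.
  by rewrite coef_Marr_nil coef0.
rewrite coef_Marr // coef0 coef_pathS // xpair_eqE.
case: (c =P b) Ht => [->|_]; last by rewrite mul0r.
case: (j =P i) => [->|]; last by rewrite mulr0.
case: (t =P s) => [->|]; last by rewrite mulr0.
by rewrite (negbTE Hp).
Qed.

(** Continuous derivations over the vertex idempotents with values in the bimodule Hom(G, F), that
    is, cocycles of extensions of [G] by [F]. *)
Record derivation G F (D : A -> 'Hom(space G, space F)) : Prop := Derivation {
  der_lin : linear D;
  der_mul : forall u v, D (u * v) = ((act F u \o D v) + (D u \o act G v))%VF;
  der_vtx : forall i, D (vtx K Q i) = 0;
  der_cont : exists N, forall u, madic N u -> D u = 0 }.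

Section DerExist.
Variables (G F : pamod K Q) (d : Q -> 'Hom(space G, space F)).

(* Unfolds u = eps(u) + sum_b (u / b) b along its last arrows; since long paths kill G, the value
   does not change once m is large. *)
Fixpoint dern m u : 'Hom(space G, space F) :=
  if m is m'.+1 then
    \sum_b ((dern m' (rquo b u) \o act G (arr K b))
            + (act F (rquo b u) \o (d b \o act G (vtx K Q (atl b)))))%VF
  else 0.

Lemma dern_linear m : linear (dern m).
Proof.
elim: m => [|m IH] c u v /=; first by rewrite scaler0 addr0.
rewrite scaler_sumr -big_split; apply: eq_bigr => b _ /=.
rewrite !linearP /= IH; apply/lfunP=> x.
by rewrite !(add_lfunE, comp_lfunE, scale_lfunE) scalerDr addrACA.
Qed.

Variable N : nat.
Hypothesis HG : forall u, madic N u -> act G u = 0.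
Hypothesis HF : nilpotent F.

Lemma dern_stable m x u : (forall v, madic m v -> act G v x = 0) ->
  dern m.+1 u x = dern m u x.
Proof.
elim: m x u => [|m IH] x u Hx.
  have -> : x = 0; last by rewrite !linear0.
  by rewrite -(Hx 1) ?act1 ?id_lfunE // => w.
rewrite [dern m.+2 u]/= [dern m.+1 u in RHS]/= !sum_lfunE; apply: eq_bigr => b _.
rewrite !add_lfunE !comp_lfunE; congr (_ + _).
rewrite -[LHS]/(dern m.+1 (rquo b u) (act G (arr K b) x)).
apply: IH => v Hv; rewrite -actME; apply: Hx.
by rewrite -addn1; apply: madicM => //; exact: madic_arr.
Qed.

(** Depth [N] already exhausts [G], so [dern N] satisfies its own recursion with unchanged depth. *)
Lemma dern_fix u x : dern N u x = \sum_b (dern N (rquo b u) (act G (arr K b) x)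
  + act F (rquo b u) (d b (act G (vtx K Q (atl b)) x))).
Proof.
rewrite -dern_stable => [|v Hv]; last by rewrite HG // zero_lfunE.
rewrite /= sum_lfunE; apply: eq_bigr => b _.
by rewrite add_lfunE !comp_lfunE.
Qed.

Lemma dern_derivation : derivation (dern N).
Proof.
have L := dern_linear N.
have DZ (c : K) u : dern N (c *: u) = c *: dern N u by exact: lin_funZ.
have DD u v : dern N (u + v) = dern N u + dern N v by exact: lin_funD.
split.
- exact: L.
- move=> u v; apply/lfunP=> x; rewrite add_lfunE !comp_lfunE.
  have nG : nilpotent G by exists N.
  move: x u v; apply: (nilpotent_ind nG) => [|x IH] u v; first by rewrite !linear0 addr0.
  rewrite dern_fix.
  (* Dividing the product by [b] matches the two sides arrow by arrow, except for the constant term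
     of [v]; [act_expand] accounts for it in the action of [v] on [x]. *)
  have E b : dern N (rquo b (u * v)) (act G (arr K b) x) +
      act F (rquo b (u * v)) (d b (act G (vtx K Q (atl b)) x)) =
    act F u (dern N (rquo b v) (act G (arr K b) x)
              + act F (rquo b v) (d b (act G (vtx K Q (atl b)) x))) +
    dern N u (act G (rquo b v) (act G (arr K b) x)) +
    eps (atl b) v *: (dern N (rquo b u) (act G (arr K b) x)
              + act F (rquo b u) (d b (act G (vtx K Q (atl b)) x))).
    rewrite rquoM DD DZ actDE actZE add_lfunE scale_lfunE IH actME.
    rewrite scalerDr linearD -!addrA; congr (_ + _).
    rewrite [RHS]addrCA; congr (_ + _); rewrite addrCA; congr (_ + _).
  under eq_bigr => b _ do rewrite E.
  rewrite !big_split /= -!linear_sum /= -dern_fix -addrA; congr (_ + _).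
  rewrite [act G v x]act_expand linearD [RHS]addrC; congr (_ + _); rewrite [RHS]linear_sum.
  under [RHS]eq_bigr => i _ do rewrite linearZ /= dern_fix scaler_sumr.
  rewrite exchange_big; apply: eq_bigr => b _ /=.
  rewrite (bigD1 (atl b)) //= big1 ?addr0 => [|i Hi].
    by rewrite -!actME arr_vtx vtxM eqxx.
  rewrite -!actME vtxM eq_sym (negbTE Hi) act0E linear0 linear0 addr0.
  by rewrite -arr_vtx -mulrA vtxM eq_sym (negbTE Hi) mulr0 act0E linear0 scaler0.
- move=> i; apply/lfunP=> x; rewrite dern_fix zero_lfunE big1 // => b _.
  rewrite rquo_vtx act0E addr0; by rewrite (lin_fun0 L) zero_lfunE.
(* The recursion divides by at most [N] arrows, so a series in m^(N+p) leaves quotients in m^p,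
   which kill [F]. *)
- have [p Hp] := HF; exists (N + p)%N; elim: N => [|m IH] u Hu //=.
  rewrite big1 // => b _; rewrite IH ?comp_lfun0l ?add0r; last exact: madic_rquo.
  rewrite Hp ?comp_lfun0l //; apply: (@madicW _ _ _ (m + p)); first exact: leq_addl.
  exact: madic_rquo.
Qed.

(** Derivations can be prescribed freely on the arrows, up to cutting each value down to the end
    vertices. *)
Lemma dern_arr b : dern N (arr K b) =
  (act F (vtx K Q (ahd b)) \o (d b \o act G (vtx K Q (atl b))))%VF.
Proof.
have [L _ V _] := dern_derivation.
have D0 : dern N 0 = 0 by exact: lin_fun0.
apply/lfunP=> x; rewrite dern_fix (bigD1 b) //= big1 ?addr0 => [|c Hc].
  by rewrite rquo_arr eqxx V zero_lfunE add0r !comp_lfunE.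
by rewrite rquo_arr (negbTE Hc) act0E D0 zero_lfunE addr0.
Qed.

End DerExist.

End Modules.

(** * The Jacobian ideal as a critical point condition *)

Section CyclicDerivative.
Variables (K : fieldType) (n : nat) (Q : quiver n).
Local Notation A := (cpalg K Q).
Implicit Types (u v : A) (a b c : Q) (s t : seq Q) (i j : 'I_n) (E F G : pamod K Q).

Lemma pathS_cons c s : is_path (ahd c, c :: s) ->
  pathS K (ahd c, c :: s) = arr K c * pathS K (atl c, s).
Proof. by move=> /(@pathSM K n Q (ahd c) [:: c] s) <-. Qed.

Lemma pathS_rcons i s c : is_path (i, rcons s c) ->
  pathS K (i, rcons s c) = pathS K (i, s) * arr K c.
Proof.
move=> Hp; move: (Hp); rewrite -cats1 => /pathSM <-; congr (_ * pathS K (_, _)).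
by move: Hp; rewrite is_path_rcons => /andP[_ /eqP].
Qed.

Lemma is_cycle_rotate c s : is_cycle (ahd c, c :: s) -> is_cycle (atl c, rcons s c).
Proof.
case/and3P=> /andP[_ Hp] _ Ht; apply/and3P; split=> /=; last by rewrite wtail_rcons.
  by rewrite is_path_rcons; apply/andP; split; [exact: Hp | rewrite eq_sym].
by rewrite -size_eq0 size_rcons.
Qed.

Lemma coef_cyc_linear s : linear (@coef_cyc K n Q ^~ s : A -> K^o).
Proof. by move=> c u v; case: s => [|a s] /=; rewrite ?coefD ?coefZ // scaler0 addr0. Qed.

Lemma cder_linear a : linear (@cder K n Q a).
Proof.
move=> c u v; apply: cpalgP => w Hw; rewrite coefD coefZ !coef_pseries Hw.
case: ifP => _; last by rewrite mulr0 addr0.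
rewrite mulr_sumr -big_split; apply: eq_bigr => j _ /=; exact: coef_cyc_linear.
Qed.

Lemma madic_cder p a u : madic p.+1 u -> madic p (cder a u).
Proof.
move=> Hu [i s] Hs; rewrite coef_pseries; case: ifP => // _; case: ifP => // _.
rewrite big1 // => -[j Hj] _ /=; set w := _ ++ _.
have Hw : (size w < p.+1)%N.
  by rewrite /w size_cat /= size_drop size_take_min; move: Hs Hj => /=; lia.
by case: w Hw => // b t Hw; apply: Hu.
Qed.

Lemma cder_rotation a c s : is_cycle (ahd c, c :: s) ->
  cder a (pathS K (ahd c, c :: s)) = cder a (pathS K (atl c, rcons s c)).
Proof.
move=> Hc; rewrite (cderE _ _ Hc) (cderE _ _ (is_cycle_rotate Hc)).
(* The first letter on the left corresponds to the last one on the right; all other positions shift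
   by one. *)
rewrite size_rcons big_mkcond big_ord_recl [RHS]big_mkcond big_ord_recr /= addrC.
congr (_ + _).
  apply: eq_bigr => -[p Hp] _ /=; rewrite /bump /= add1n add0n /=.
  rewrite -cats1 onth_cat Hp drop_cat.
  have -> : take p (s ++ [:: c]) = take p s by rewrite takel_cat // ltnW.
  case: ltnP => Hp'; first by rewrite -catA.
  have Ep : p.+1 = size s by apply/eqP; rewrite eqn_leq Hp Hp'.
  by rewrite Ep subnn drop0 drop_size.
rewrite drop0 cats0 -cats1 onth_cat ltnn subnn /= take_size_cat //.
by rewrite drop_oversize // size_cat addn1.
Qed.

Lemma cder_cyc_equiv a u v : cyc_equiv u v -> cder a u = cder a v.
Proof.
move=> H; apply/eqP; rewrite -subr_eq0; apply/eqP; apply: cpalgP => w Hw.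
have L := cder_linear a.
rewrite -(lin_funN L) -(lin_funD L).
(* One unit of precision reaches beyond the length of [w], the other is lost by [cder]. *)
have [y [m [c [g [Hg Ey]]]] Hy] := H (size w.2).+2.
rewrite -[u - v](subrK y) (lin_funD L) coefD (madic_cder a Hy) ?ltnS // add0r.
rewrite Ey (lin_fun_sum L) coef_sum coef0 big1 // => j _.
rewrite (lin_funZ L) coefZ; have [b [s [Hc ->]]] := Hg j.
by rewrite (lin_funD L) (lin_funN L) (cder_rotation _ Hc) subrr coef0 mulr0.
Qed.

Section TraceFormula.
Variables (E : pamod K Q) (D : A -> 'End(space E)).
Hypothesis HD : derivation D.
Hypothesis HE : nilpotent E.

Lemma derivation_path i s : is_path (i, s) -> D (pathS K (i, s)) =
  \sum_a \sum_(p < size s | onth s p == Some a)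
    (act E (pathS K (i, take p s)) \o (D (arr K a) \o act E (pathS K (atl a, drop p.+1 s))))%VF.
Proof.
elim: s i => [|c s IH] i Hp.
  by rewrite (der_vtx HD) big1 // => a _; rewrite big_ord0.
have Ei := is_path_head Hp; rewrite -Ei in Hp *.
have Hs : is_path (atl c, s) by move: Hp => /andP[].
rewrite pathS_cons // (der_mul HD) IH // addrC.
under [RHS]eq_bigr => a _ do rewrite big_mkcond big_ord_recl -big_mkcond /=.
rewrite big_split /=; congr (_ + _).
  rewrite (bigD1 c) //= big1 ?addr0 => [|a Ha]; last first.
    by rewrite -[Some c == _]/(c == a) eq_sym (negbTE Ha).
  have Hc : D (arr K c) = (act E (vtx K Q (ahd c)) \o D (arr K c))%VF.
    by rewrite -{1}(vtx_arr K c) (der_mul HD) (der_vtx HD) comp_lfun0l addr0.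
  by rewrite -[Some c == _]/(c == c) eqxx drop0 {1}Hc comp_lfunA.
apply/lfunP=> x; rewrite comp_lfunE !sum_lfunE linear_sum; apply: eq_bigr => a _.
rewrite !sum_lfunE linear_sum; apply: eq_bigr => p Ha.
rewrite /= !comp_lfunE -actME -pathS_cons //; move: Hs Hp.
rewrite -{1 2}(cat_take_drop p s) /is_path /= !is_path_cat.
by case/andP=> -> _; rewrite eqxx.
Qed.

(** The Leibniz rule puts [D] on one letter at a time; cyclicity of the trace then moves the part
    before that letter behind the part after it, which is the rotation in the cyclic derivative. *)
Lemma trace_path i s : is_cycle (i, s) -> lftrace (D (pathS K (i, s))) =
  \sum_a lftrace (act E (cder a (pathS K (i, s))) \o D (arr K a))%VF.
Proof.
move=> Hc; have /and3P[Hp _ Ht] := Hc.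
rewrite (derivation_path Hp) lftrace_sum; apply: eq_bigr => a _.
rewrite (cderE _ _ Hc) lftrace_sum linear_sum /=.
rewrite (big_morph (fun f => (f \o D (arr K a))%VF) (id1 := 0) (op1 := +%R)); last 2 first.
- by move=> f g; exact: comp_lfunDl.
- exact: comp_lfun0l.
rewrite lftrace_sum; apply: eq_bigr => p Hpa; rewrite comp_lfunA lftraceC comp_lfunA -actM.
have Hps : wtail i (take p.+1 s) = atl a.
  rewrite (take_nth a) // wtail_rcons; congr atl.
  by move: Hpa; rewrite onthE (nth_map a) // => /eqP [].
congr (lftrace (act E _ \o _)%VF).
have Hr := is_cycle_rot (p := p) (m := 1) Hc; rewrite addn1 in Hr.
rewrite -pathSM ?Hr //; congr (_ * pathS K (_, _)).
by rewrite -Hps -wtail_cat cat_take_drop (eqP Ht).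
Qed.

Lemma trace_derivation S : potential S ->
  lftrace (D S) = \sum_a lftrace (act E (cder a S) \o D (arr K a))%VF.
Proof.
move=> HS; have [N HN] := der_cont HD; have [p Hp] := HE.
pose L u : K^o := lftrace (D u) - \sum_a lftrace (act E (cder a u) \o D (arr K a))%VF.
have linL : linear L.
  move=> c u v; rewrite /L (der_lin HD) lftraceD lftraceZ scalerBr addrACA; congr (_ + _).
  rewrite scaler_sumr -!sumrN -!big_split; apply: eq_bigr => a _ /=.
  rewrite cder_linear linearP /= comp_lfunDl -comp_lfunZl lftraceD lftraceZ.
  by rewrite opprD -mulrN.
apply/eqP; rewrite -subr_eq0; apply/eqP.
(* Both terms vanish on a high power of m; the successor of [p] pays for the letter removed by
   [cder]. *)
apply: (potential_dense (L := HB.pack_for {linear A -> K^o} L (GRing.isLinear.Build K A K^o _ L linL))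
  (N := (N + p.+1)%N)) HS => [u Hu|[i s] Hw] /=; rewrite /L.
  rewrite HN; last by apply: madicW Hu; exact: leq_addr.
  rewrite lftrace0 sub0r big1 ?oppr0 // => a _; rewrite Hp ?comp_lfun0l ?lftrace0 //.
  by apply: madic_cder; apply: madicW Hu; exact: leq_addl.
by rewrite trace_path // subrr.
Qed.

(** A rotation difference is a commutator, and [D] maps it to a sum of commutators of linear maps,
    which have trace zero. Continuity of [D] takes care of the closure. *)
Lemma trace_cyc_equiv u v : cyc_equiv u v -> lftrace (D u) = lftrace (D v).
Proof.
move=> H; have [N HN] := der_cont HD.
have L := der_lin HD.
apply/eqP; rewrite -subr_eq0 -lftraceN -lftraceD -(lin_funN L) -(lin_funD L).
have [y [m [c [g [Hg ->]]]] Hy] := H N.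
rewrite -[u - v](subrK (\sum_j c j *: g j)) (lin_funD L) HN // add0r.
rewrite (lin_fun_sum L) lftrace_sum big1 // => j _.
rewrite (lin_funZ L) lftraceZ; have [b [s [Hc ->]]] := Hg j.
rewrite (lin_funD L) (lin_funN L) lftraceD lftraceN.
have /and3P[Hp1 _ _] := Hc; have /and3P[Hp2 _ _] := is_cycle_rotate Hc.
rewrite pathS_cons // pathS_rcons // !(der_mul HD) !lftraceD.
rewrite (lftraceC (D (arr K b))) (lftraceC (D (pathS K (atl b, s)))).
by rewrite [X in _ - X]addrC subrr mulr0.
Qed.

End TraceFormula.

Lemma vtx_cder a (S : A) : vtx K Q (atl a) * cder a S = cder a S.
Proof.
apply: cpalgP => -[i s] Hs; rewrite coef_vtxM coef_pseries Hs /=.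
by case: eqP; rewrite ?mul1r ?mul0r.
Qed.

Lemma cder_vtx a (S : A) : potential S -> cder a S * vtx K Q (ahd a) = cder a S.
Proof.
move=> HS; apply: cpalgP => -[i s] Hs; rewrite coef_Mvtx coef_pseries Hs /=.
case: (i =P atl a) => [Ei|_]; last by rewrite mulr0.
case: eqP => [_|Ht]; first by rewrite mul1r.
rewrite mul0r big1 // => -[j Hj] _ /=; rewrite Ei in Ht.
move: Ht; rewrite -{1}(cat_take_drop j s) wtail_cat.
case: (drop j s) => [|b t] Ht /=; rewrite HS //; apply/negP=> /and3P[/= Hp _ /eqP Ht'].
  by apply: Ht; exact: Ht'.
move: Hp; rewrite /is_path /= is_path_cat /= => /andP[_ /andP[_ /andP[/eqP E _]]].
by apply: Ht; rewrite E.
Qed.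

(* A derivation of E is a tangent vector at E to the variety of representations, and lftrace (D S)
   is the differential along it of the trace of S: the Jacobian ideal kills exactly the critical
   points of this trace, a condition that does not refer to the choice of arrows. *)
Lemma jac_killedP E S : nilpotent E -> potential S ->
  (jac_killed E S <-> forall D : A -> 'End(space E), derivation D -> lftrace (D S) = 0).
Proof.
move=> HE HS; split=> [HJ D HD|HD a].
  by rewrite (trace_derivation HD HE HS) big1 // => a _; rewrite HJ comp_lfun0l lftrace0.
apply: lftrace_nondeg => g; have [N HN] := HE.
(* The tangent direction that moves only the arrow [a], by an arbitrary [g]: its trace isolates the
   pairing of [g] with the derivative by [a]. *)
pose d b : 'End(space E) := if b == a then g else 0.
have HD' := dern_derivation d HN HE.
have := HD _ HD'; rewrite (trace_derivation HD' HE HS) (bigD1 a) //= big1 ?addr0 => [|b Hb].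
  rewrite (dern_arr d HN HE) /d eqxx => <-; rewrite !comp_lfunA [RHS]lftraceC !comp_lfunA -!actM.
  by rewrite -mulrA cder_vtx // vtx_cder.
by rewrite (dern_arr d HN HE) /d (negbTE Hb) comp_lfun0l !comp_lfun0r lftrace0.
Qed.

End CyclicDerivative.

(** * Change of algebra and one-point extensions *)

Section Morphisms.
Variables (K : fieldType) (n : nat).
Implicit Types (Q : quiver n).

Record alg_morph Q Q' (f : cpalg K Q -> cpalg K Q') : Prop := AlgMorph {
  am_lin : linear f;
  am_mul : forall u v, f (u * v) = f u * f v;
  am_vtx : forall i, f (vtx K Q i) = vtx K Q' i }.

Lemma am_one Q Q' (f : cpalg K Q -> cpalg K Q') : alg_morph f -> f 1 = 1.
Proof.
move=> Hf; rewrite -(sum_vtx K Q) (lin_fun_sum (am_lin Hf)) -(sum_vtx K Q').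
by apply: eq_bigr => i _; rewrite (am_vtx Hf).
Qed.

(* As there are no loops, the image of an arrow has no component along the idempotents. *)
Lemma am_madic Q Q' (f : cpalg K Q -> cpalg K Q') : alg_morph f ->
  forall N u, madic N u -> madic N (f u).
Proof.
move=> Hf; have Ha b : madic 1 (f (arr K b)).
  rewrite -(vtx_arr K b) -(arr_vtx K b) !(am_mul Hf) !(am_vtx Hf) => -[i [|c s]] //= _.
  rewrite coef_vtxM coef_Mvtx; case: (i =P ahd b) => [->|_]; last by rewrite mul0r.
  by rewrite [_ == atl b]eq_sym (negbTE (noloop b)) mul0r mulr0.
elim=> [|N IH] u Hu; first by [].
rewrite (rquo_expand u) (lin_funD (am_lin Hf)) !(lin_fun_sum (am_lin Hf)).
rewrite big1 ?add0r => [|i _]; last by rewrite (madic_eps _ Hu) scale0r (lin_fun0 (am_lin Hf)).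
apply: madic_sum => b _; rewrite (am_mul Hf) -addn1; apply: madicM => //.
by apply: IH; exact: madic_rquo.
Qed.

Section Pull.
Variables (Q Q' : quiver n) (f : cpalg K Q -> cpalg K Q').
Hypothesis Hf : alg_morph f.
Variable E : pamod K Q'.

Definition pull_act (u : cpalg K Q) : 'End(space E) := act E (f u).
Fact pull_act_linear : linear pull_act.
Proof. by move=> c u v; rewrite /pull_act (am_lin Hf) linearP. Qed.
HB.instance Definition _ :=
  GRing.isLinear.Build K (cpalg K Q) 'End(space E) _ pull_act pull_act_linear.

Fact pull_actM u v : pull_act (u * v) = (pull_act u \o pull_act v)%VF.
Proof. by rewrite /pull_act (am_mul Hf) actM. Qed.
Fact pull_act1 : pull_act 1 = \1%VF.
Proof. by rewrite /pull_act (am_one Hf) act1. Qed.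

Definition pullmod : pamod K Q := PAMod pull_actM pull_act1.

Lemma pullmodE u : act pullmod u = act E (f u).
Proof. by []. Qed.

Lemma pullmod_nilpotent : nilpotent E -> nilpotent pullmod.
Proof. by move=> [N HN]; exists N => u Hu; apply: HN; exact: am_madic. Qed.

Lemma derivation_pull D : derivation D -> @derivation K n Q pullmod pullmod (D \o f).
Proof.
move=> HD; split=> [c u v|u v|i|] /=.
- by rewrite (am_lin Hf) (der_lin HD).
- by rewrite (am_mul Hf) (der_mul HD).
- by rewrite (am_vtx Hf) (der_vtx HD).
- by have [N HN] := der_cont HD; exists N => u Hu; apply: HN; exact: am_madic.
Qed.

Lemma derivation_push g D : alg_morph g -> cancel g f ->
  @derivation K n Q pullmod pullmod D -> @derivation K n Q' E E (D \o g).
Proof.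
move=> Hg gK HD; split=> [c u v|u v|i|] /=.
- by rewrite (am_lin Hg) (der_lin HD).
- by rewrite (am_mul Hg) (der_mul HD) !pullmodE !gK.
- by rewrite (am_vtx Hg) (der_vtx HD).
- by have [N HN] := der_cont HD; exists N => u Hu; apply: HN; exact: am_madic.
Qed.

(** Composition with [f] and [g] matches the derivations of the two modules and preserves the trace
    of the potential, so critical points correspond. *)
Lemma jac_killed_pull g S S' : alg_morph g -> cancel f g -> cancel g f -> nilpotent E ->
  potential S -> potential S' -> cyc_equiv (f S) S' ->
  jac_killed pullmod S <-> jac_killed E S'.
Proof.
move=> Hg fK gK HE HS HS' Heq.
rewrite (jac_killedP (pullmod_nilpotent HE) HS) (jac_killedP HE HS').
split=> H D HD; last first.
  have HD' := derivation_push Hg gK HD.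
  by rewrite -[S]fK -[D (g _)]/((D \o g) (f S)) (trace_cyc_equiv HD' Heq) H.
by rewrite -(trace_cyc_equiv HD Heq); exact: (H _ (derivation_pull HD)).
Qed.
End Pull.

Lemma right_equiv_morph (X Y : qp K n) (phi : {rmorphism cpalg K X -> cpalg K Y}) :
  right_equiv phi -> alg_morph phi /\
  exists2 psi, alg_morph psi & cancel phi psi /\ cancel psi phi.
Proof.
move=> [Z [g phiK gK] V _].
have Hphi : alg_morph phi.
  by split=> //; [move=> c u v; rewrite rmorphD Z | exact: rmorphM].
split=> //; exists g => //; split.
- move=> c u v; apply: (can_inj phiK); rewrite gK.
  by rewrite (am_lin Hphi) !gK.
- by move=> u v; apply: (can_inj phiK); rewrite (am_mul Hphi) !gK.
- by move=> i; apply: (can_inj phiK); rewrite (am_vtx Hphi) gK.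
Qed.

End Morphisms.

(** * Extensions given by cocycles and one-point extensions *)

Section Extension.
Variables (K : fieldType) (n : nat) (Q : quiver n).
Local Notation A := (cpalg K Q).
Implicit Types (u v : A) (a b c : Q) (i j : 'I_n).

Section ExtMod.
Variables (F G : pamod K Q) (D : A -> 'Hom(space G, space F)).
Hypothesis HD : derivation D.
Let V : vectType K := (space F * space G)%type.

(** Block triangular action with [D] above the diagonal; multiplicativity is the Leibniz rule. *)
Definition ext_fun u (p : V) : V := (act F u p.1 + D u p.2, act G u p.2).
Definition ext_act u : 'End(V) := linfun (ext_fun u).

Lemma ext_fun_linear u : linear (ext_fun u).
Proof.
move=> c p q; rewrite /ext_fun /= !linearP /=; congr (_, _).
by rewrite addrACA -scalerDr.
Qed.

Lemma ext_actE u p : ext_act u p = (act F u p.1 + D u p.2, act G u p.2).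
Proof. by rewrite /ext_act (linfunE (@ext_fun_linear u)). Qed.

Fact ext_act_linear : linear ext_act.
Proof.
move=> c u v; apply/lfunP=> p; rewrite add_lfunE scale_lfunE !ext_actE.
rewrite (der_lin HD) !linearP !add_lfunE !scale_lfunE; congr (_, _).
by rewrite /= scalerDr addrACA.
Qed.
HB.instance Definition _ := GRing.isLinear.Build K A 'End(V) _ ext_act ext_act_linear.

Fact ext_actM u v : ext_act (u * v) = (ext_act u \o ext_act v)%VF.
Proof.
apply/lfunP=> p; rewrite comp_lfunE !ext_actE /= (der_mul HD) !actM.
rewrite add_lfunE !comp_lfunE; congr (_, _).
by rewrite linearD addrA.
Qed.

Fact ext_act1 : ext_act 1 = \1%VF.
Proof.
apply/lfunP=> -[x y]; rewrite ext_actE id_lfunE /= !act1 !id_lfunE.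
rewrite -(sum_vtx K Q) (lin_fun_sum (der_lin HD)) big1 ?zero_lfunE ?addr0 // => i _.
exact: der_vtx.
Qed.

Definition extmod : pamod K Q := PAMod ext_actM ext_act1.

Lemma extmodE u p : act extmod u p = (act F u p.1 + D u p.2, act G u p.2).
Proof. exact: ext_actE. Qed.

Lemma extmod_nilpotent : nilpotent F -> nilpotent G -> nilpotent extmod.
Proof.
move=> [N1 H1] [N2 H2]; have [N3 H3] := der_cont HD.
exists (N1 + N2 + N3)%N => u Hu; apply/lfunP=> p; rewrite extmodE.
rewrite H1 ?H2 ?H3 ?zero_lfunE ?addr0 //; apply: madicW Hu; lia.
Qed.
End ExtMod.

Section Simple.
Variable i : 'I_n.
Let V : vectType K := K^o.
Definition simple_act u : 'End(V) := eps i u *: \1%VF.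
Fact simple_act_linear : linear simple_act.
Proof. by move=> c u v; rewrite /simple_act eps_is_linear scalerDl -scalerA. Qed.
HB.instance Definition _ := GRing.isLinear.Build K A 'End(V) _ simple_act simple_act_linear.
Fact simple_actM u v : simple_act (u * v) = (simple_act u \o simple_act v)%VF.
Proof.
apply/lfunP=> x; rewrite comp_lfunE /simple_act epsM !scale_lfunE !id_lfunE.
by rewrite scalerA.
Qed.
Fact simple_act1 : simple_act 1 = \1%VF.
Proof. by rewrite /simple_act eps1 scale1r. Qed.
Definition simple : pamod K Q := PAMod simple_actM simple_act1.

Lemma simpleE u x : act simple u x = eps i u *: x.
Proof. by rewrite /= /simple_act scale_lfunE id_lfunE. Qed.

Lemma simple_nilp u : madic 1 u -> act simple u = 0.
Proof. by move=> Hu; apply/lfunP=> x; rewrite simpleE (madic_eps _ Hu) scale0r zero_lfunE. Qed.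
End Simple.

(* The families x of elements indexed by the arrows b with tail i classify the extensions of the
   simple module at i by F; the arrow b maps the added basis vector to x b. *)
Section Conn.
Variables (F : pamod K Q) (i : 'I_n) (x : {ffun Q -> space F}).
Hypothesis HF : nilpotent F.

(** The component in [F] of the action of [u] on the added vector, see [connmodE]. *)
Definition conn u : space F := \sum_(b | atl b == i) act F (rquo b u) (x b).

Let d b : 'Hom(space (simple i), space F) := linfun (fun z : K^o => z *: x b).
Let dE b z : d b z = z *: x b.
Proof. by rewrite /d linfunE // => c y y'; rewrite scalerDl scalerA. Qed.

(** Depth [1] is enough, since m kills the simple module. *)
Definition conn_der := dern d 1.

Lemma conn_derE u z : conn_der u z = z *: conn u.
Proof.
rewrite /conn_der /= sum_lfunE /conn scaler_sumr [RHS]big_mkcond; apply: eq_bigr => b _.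
rewrite comp_lfun0l add0r !comp_lfunE dE simpleE eps_vtx linearZ /= eq_sym.
by case: eqP => _; rewrite ?scale1r // scale0r scale0r.
Qed.

Lemma conn_derivation : derivation conn_der.
Proof. by apply: dern_derivation => // u; exact: simple_nilp. Qed.

Definition connmod := extmod conn_derivation.

Lemma connmodE u y z : act connmod u (y, z) = (act F u y + z *: conn u, eps i u *: z).
Proof. by rewrite extmodE /= conn_derE simpleE. Qed.

Lemma connmod_nilpotent : nilpotent connmod.
Proof. by apply: extmod_nilpotent => //; exists 1%N; exact: simple_nilp. Qed.

Lemma conn_linear : linear conn.
Proof.
move=> c u v; rewrite /conn scaler_sumr -big_split; apply: eq_bigr => b _ /=.
by rewrite !linearP /= add_lfunE scale_lfunE.
Qed.

Lemma connM u v : conn (u * v) = act F u (conn v) + eps i v *: conn u.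
Proof.
(* The rule is read off from the multiplicativity of the extension at the vector [(0, 1)]. *)
have := congr1 fst (actME u v ((0, 1) : space connmod)); rewrite !connmodE /= !linear0 !add0r.
by rewrite !scale1r => ->; rewrite -[X in X *: _]/(eps i v * 1) mulr1.
Qed.

Lemma conn_vtx j : conn (vtx K Q j) = 0.
Proof. by rewrite /conn big1 // => b _; rewrite rquo_vtx act0E. Qed.

Lemma conn_arr b : conn (arr K b) = if atl b == i then act F (vtx K Q (ahd b)) (x b) else 0.
Proof.
rewrite /conn big_mkcond (bigD1 b) //= big1 ?addr0 ?rquo_arr ?eqxx // => c Hc.
by rewrite rquo_arr (negbTE Hc) act0E if_same.
Qed.

Lemma conn_jac_killed S : potential S -> jac_killed F S ->
  jac_killed connmod S <-> forall a, conn (cder a S) = 0.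
Proof.
move=> HS HJ; split=> H a.
  by have := congr1 (fun f : 'End(space connmod) => (f (0, 1)).1) (H a);
    rewrite connmodE zero_lfunE /= linear0 add0r scale1r.
apply/lfunP=> -[y z]; rewrite connmodE zero_lfunE H HJ zero_lfunE scaler0 addr0.
(* Cycles have length at least two, so the derivatives have no constant term and act as zero on the
   simple quotient. *)
by rewrite (madic_eps _ (madic_cder a (potential_madic2 HS))) scale0r.
Qed.

Lemma conn_cder0 a S : potential S -> ahd a != i -> conn (cder a S) = 0.
Proof.
move=> HS Ha; rewrite -(cder_vtx a HS) connM conn_vtx linear0 add0r eps_vtx.
by rewrite eq_sym (negbTE Ha) scale0r.
Qed.
End Conn.

End Extension.

(** * Dimension counts and the maps at a vertex *)

Section Dimensions.
Variable K : fieldType.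
Implicit Types V W : vectType K.

(** Rank-nullity with kernel and image given elementwise, the form used in the dimension counts
    below. *)
Lemma dim_exact V W (f : 'Hom(V, W)) (U U0 : {vspace V}) (U' : {vspace W}) :
    {in U, forall x, f x \in U'} -> {in U', forall y, exists2 x, x \in U & f x = y} ->
    (forall x, (x \in U0) = (x \in U) && (f x == 0)) ->
  (\dim U = \dim U0 + \dim U')%N.
Proof.
move=> H1 H2 H0; rewrite -(limg_ker_dim f U); congr addn; congr (dimv _).
  by apply/vspaceP=> x; rewrite memv_cap memv_ker H0.
apply/vspaceP=> y; apply/memv_imgP/idP => [[x Hx ->]|Hy]; first exact: H1.
by have [x Hx Exy] := H2 _ Hy; exists x.
Qed.

Lemma dim_le_inj V W (f : 'Hom(V, W)) (U : {vspace V}) (U' : {vspace W}) :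
    {in U, forall x, f x \in U'} -> {in U, forall x, f x = 0 -> x = 0} ->
  (\dim U <= \dim U')%N.
Proof.
move=> H1 H2; rewrite -(@limg_dim_eq _ _ _ f U); last first.
  apply/eqP; rewrite -subv0; apply/subvP=> x; rewrite memv_cap memv_ker memv0.
  by case/andP=> Hx /eqP /(H2 _ Hx) ->.
by apply/dimvS/subvP=> y /memv_imgP [x Hx ->]; exact: H1.
Qed.

Section FiniteFamilies.
Variables (I : finType) (V : vectType K).
Implicit Types (x : {ffun I -> V}) (i j : I) (P : pred I).

Lemma finjE i (v : V) : finj V i v = [ffun j => if j == i then v else 0].
Proof.
rewrite /finj linfunE // => c u w; apply/ffunP=> j; rewrite !ffunE.
by case: ifP => _ //; rewrite scaler0 addr0.
Qed.

Lemma fprojE i x : fproj V i x = x i.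
Proof. by rewrite /fproj linfunE // => c u w; rewrite !ffunE. Qed.

Lemma finj_sum x : x = \sum_i finj V i (x i).
Proof.
apply/ffunP=> j; rewrite sum_ffunE (bigD1 j) //= big1 ?addr0 => [|i Hi].
  by rewrite finjE ffunE eqxx.
by rewrite finjE ffunE eq_sym (negbTE Hi).
Qed.

Variables (P : pred I) (Us : I -> {vspace V}).

Definition fsum : {vspace {ffun I -> V}} := (\sum_(i | P i) finj V i @: Us i)%VS.

Lemma mem_fsum x :
  reflect (forall i, if P i then x i \in Us i else x i == 0) (x \in fsum).
Proof.
apply: (iffP memv_sumP) => [[y Hy ->] i|Hx].
  have E j : P j -> exists2 v, v \in Us j & y j = finj V j v.
    by move=> Pj; have /memv_imgP [v Hv ->] := Hy _ Pj; exists v.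
  rewrite sum_ffunE; case: ifPn => Pi.
    rewrite (bigD1 i) //= big1 ?addr0 => [|j /andP[Pj Hj]].
      by have [v Hv ->] := E _ Pi; rewrite finjE ffunE eqxx.
    by have [v _ ->] := E _ Pj; rewrite finjE ffunE eq_sym (negbTE Hj).
  rewrite big1 // => j Pj; have [v _ ->] := E _ Pj; rewrite finjE ffunE.
  by case: (i =P j) Pi => // ->; rewrite Pj.
exists (fun i => finj V i (x i)) => [i Pi|].
  by apply: memv_img; have := Hx i; rewrite Pi.
rewrite {1}(finj_sum x) (bigID P) /= [X in _ + X]big1 ?addr0 // => i Pi.
by have := Hx i; rewrite (negbTE Pi) => /eqP ->; rewrite linear0.
Qed.

Lemma dim_fsum : \dim fsum = (\sum_(i | P i) \dim (Us i))%N.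
Proof.
have Hi i (U : {vspace V}) : \dim (finj V i @: U) = \dim U.
  apply: limg_dim_eq; apply/eqP; rewrite -subv0; apply/subvP=> v.
  rewrite memv_cap memv_ker memv0 => /andP[_ /eqP E].
  by have := congr1 (fun f : {ffun I -> V} => f i) E; rewrite finjE !ffunE eqxx => ->.
under [RHS]eq_bigr => i _ do rewrite -(Hi i).
apply/eqP; rewrite -[_ == _]/(directv _); apply/directv_sum_independent => us Hus E i Pi.
have /memv_imgP [v Hv Ev] := Hus _ Pi; rewrite Ev.
have := congr1 (fun f : {ffun I -> V} => f i) E; rewrite sum_ffunE ffunE.
rewrite (bigD1 i) //= big1 => [|j /andP[Pj Hj]]; last first.
  have /memv_imgP [w _ ->] := Hus _ Pj.
  by rewrite finjE ffunE eq_sym (negbTE Hj).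
by rewrite Ev finjE ffunE eqxx addr0 => ->; rewrite -finjE linear0.
Qed.

End FiniteFamilies.
End Dimensions.

(** * Second derivatives as quotients of cyclic derivatives *)

Section SecondDerivative.
Variables (K : fieldType) (n : nat) (Q : quiver n).
Local Notation A := (cpalg K Q).
Implicit Types (S : A) (a b : Q) (s u : seq Q) (i j : 'I_n).

Lemma coef_cyc_open S s (l : nat) b u : potential S ->
  wtail (wtail (atl b) u) s != ahd b -> coef_cyc S (drop l s ++ b :: u ++ take l s) = 0.
Proof.
move=> HS; rewrite -{1}(cat_take_drop l s) wtail_cat.
case: (drop l s) => [|c t] Ht /=; rewrite HS //; apply/negP=> /and3P[/= Hp _ /eqP Ht'].
  case/eqP: Ht; apply: etrans Ht'.
  by rewrite -!wtail_cat cats0.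
move: Hp; rewrite /is_path /= is_path_cat /= => /andP[_ /andP[_ /andP[/eqP E _]]].
by case/eqP: Ht; rewrite E.
Qed.

(** Dividing the derivative by [b] selects the occurrences of [a] that directly follow a [b] in the
    cyclic order. *)
Lemma rquo_cder S a b : potential S -> (forall i s, coef S (i, a :: s) = 0) ->
  rquo b (cder a S) = dder0 b a S.
Proof.
move=> HS Ha; apply: cpalgP => -[i s] Hs; rewrite coef_rquo !coef_pseries Hs /=.
case: (i =P atl a) => [Ei|_]; last by rewrite if_same.
rewrite is_path_rcons Hs /=; case: eqP => [Hb|Hb]; last first.
  rewrite big1 // => l _; apply: (@coef_cyc_open S s l b [:: a]) => //.
  by apply/eqP=> E; apply: Hb; rewrite Ei; exact: esym E.
(* The cut after the whole word puts [a] in front, where the hypothesis makes the coefficient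
   zero. *)
rewrite size_rcons big_ord_recr /= [X in X ++ _](_ : _ = [::]); last first.
  by rewrite drop_oversize // size_rcons.
rewrite /= Ha addr0.
apply: eq_bigr => -[l Hl] _ /=; rewrite -cats1 dropl_cat // takel_cat //.
by rewrite -catA.
Qed.

(** Frees the second derivative from the rotated representative, since [cder] depends only on the
    cyclic class. *)
Lemma dderE S a b : potential S -> dder b a S = rquo b (cder a S).
Proof.
move=> HS; rewrite /dder (cder_cyc_equiv a (rotate_off_equiv a HS)) rquo_cder //.
  exact: rotate_off_potential.
by move=> i s; exact: rotate_off_start.
Qed.
End SecondDerivative.

(** * Vertex spaces and the maps alpha, beta, gamma *)

Section RepBasics.
Variables (K : fieldType) (n : nat) (X : qp K n) (M : qprep X).
Implicit Types (i j k : 'I_n) (a b c : X) (x : {ffun X -> space M}) (m : space M).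

Lemma rep_nilpotent : nilpotent M.
Proof. by apply: paths_nilpotent; exact: rnil. Qed.

Lemma rep_jac_killed : jac_killed M (pot X).
Proof. exact: rjac. Qed.

Lemma mem_vsp i m : (m \in vsp M i) = (act M (vtx K X i) m == m).
Proof.
apply/memv_imgP/eqP => [[m' _ ->]|<-]; first by rewrite -actME vtxM eqxx.
by exists m => //; exact: memvf.
Qed.

Lemma vsp_act i m : m \in vsp M i -> act M (vtx K X i) m = m.
Proof. by rewrite mem_vsp => /eqP. Qed.

Lemma vsp_act0 i j m : m \in vsp M i -> i != j -> act M (vtx K X j) m = 0.
Proof.
by move=> /vsp_act <- Hij; rewrite -actME vtxM eq_sym (negbTE Hij) act0E.
Qed.

Lemma act_vtx_mem i m : act M (vtx K X i) m \in vsp M i.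
Proof. by rewrite mem_vsp -actME vtxM eqxx. Qed.

Lemma vtx_act_mem i u m : vtx K X i * u = u -> act M u m \in vsp M i.
Proof. by move=> H; rewrite mem_vsp -actME H. Qed.

Lemma arr_mem b m : act M (arr K b) m \in vsp M (ahd b).
Proof. by apply: vtx_act_mem; exact: vtx_arr. Qed.

Lemma arr_act0 b m i : m \in vsp M i -> i != atl b -> act M (arr K b) m = 0.
Proof.
by move=> Hm Hi; rewrite -(arr_vtx K b) actME (vsp_act0 Hm) // linear0.
Qed.

Lemma arr_act_vtx b m : act M (arr K b) (act M (vtx K X (atl b)) m) = act M (arr K b) m.
Proof. by rewrite -actME arr_vtx. Qed.

Lemma alphaE k x : alpha M k x = \sum_(a | ahd a == k) act M (arr K a) (x a).
Proof. by rewrite /alpha sum_lfunE; apply: eq_bigr => a _; rewrite comp_lfunE fprojE. Qed.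

Lemma betaE k m : beta M k m = [ffun b => if atl b == k then act M (arr K b) m else 0].
Proof.
rewrite /beta sum_lfunE; apply/ffunP=> b; rewrite sum_ffunE ffunE.
case: ifPn => Hb.
  rewrite (bigD1 b) //= big1 ?addr0 => [|c /andP[_ Hc]]; first by rewrite comp_lfunE finjE ffunE eqxx.
  by rewrite comp_lfunE finjE ffunE eq_sym (negbTE Hc).
rewrite big1 // => c Hc; rewrite comp_lfunE finjE ffunE.
by case: (b =P c) Hb => // ->; rewrite Hc.
Qed.

Lemma gammaE k x : gamma M k x =
  [ffun a => if ahd a == k then
    \sum_(b | atl b == k) act M (rquo b (cder a (pot X))) (x b) else 0].
Proof.
rewrite /gamma sum_lfunE; apply/ffunP=> a; rewrite sum_ffunE ffunE.
have E c : (\sum_(b | atl b == k) (finj (space M) c \o act M (dder b c (pot X)) \o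
    fproj (space M) b)%VF) x =
    finj (space M) c (\sum_(b | atl b == k) act M (rquo b (cder c (pot X))) (x b)).
  rewrite sum_lfunE linear_sum; apply: eq_bigr => b _.
  by rewrite !comp_lfunE fprojE dderE //; exact: potP.
under eq_bigr => c _ do rewrite E finjE ffunE.
case: ifPn => Ha.
  rewrite (bigD1 a) //= eqxx [X in _ + X]big1 ?addr0 // => c /andP[_ Hc].
  by rewrite eq_sym (negbTE Hc).
by rewrite big1 // => c Hc; case: (a =P c) Ha => // ->; rewrite Hc.
Qed.

Lemma mem_M_out k x :
  reflect (forall b, if atl b == k then x b \in vsp M (ahd b) else x b == 0) (x \in M_out M k).
Proof. exact: mem_fsum. Qed.

Lemma mem_M_in k x :
  reflect (forall a, if ahd a == k then x a \in vsp M (atl a) else x a == 0) (x \in M_in M k).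
Proof. exact: mem_fsum. Qed.

Lemma dim_M_out k : \dim (M_out M k) = (\sum_(b : X | atl b == k) \dim (vsp M (ahd b)))%N.
Proof. exact: dim_fsum. Qed.

Lemma dim_M_in k : \dim (M_in M k) = (\sum_(a : X | ahd a == k) \dim (vsp M (atl a)))%N.
Proof. exact: dim_fsum. Qed.

(** The component of [gamma] at [a] is [conn k x (cder a (pot X))], so kernel vectors are the
    one-point extensions of [M] that satisfy all Jacobian relations. *)
Lemma mem_ker_gamma k x :
  reflect (x \in M_out M k /\ forall a, conn k x (cder a (pot X)) = 0) (x \in ker_gamma M k).
Proof.
rewrite /ker_gamma memv_cap memv_ker gammaE; apply: (iffP andP) => -[Hx H]; split=> //.
  move=> a; have [/eqP Ha|Ha] := boolP (ahd a == k).
    by have := congr1 (fun f : {ffun X -> space M} => f a) (eqP H); rewrite !ffunE Ha eqxx.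
  by apply: conn_cder0 => //; [exact: rep_nilpotent | exact: potP].
apply/eqP/ffunP=> a; rewrite !ffunE; case: ifP => // _; exact: H.
Qed.

Lemma mem_ker_beta k m : reflect (m \in vsp M k /\ forall b, act M (arr K b) m = 0)
  (m \in ker_beta M k).
Proof.
rewrite /ker_beta memv_cap memv_ker betaE; apply: (iffP andP) => -[Hm H]; split=> //.
  move=> b; have [/eqP Hb|Hb] := boolP (atl b == k).
    by have := congr1 (fun f : {ffun X -> space M} => f b) (eqP H); rewrite !ffunE Hb eqxx.
  by apply: arr_act0 Hm _; rewrite eq_sym.
by apply/eqP/ffunP=> b; rewrite !ffunE H if_same.
Qed.

End RepBasics.

(** * The projection of a direct sum onto the reduced part *)

Lemma mem_rot_insert (T : eqType) (s : seq T) (x y : T) l :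
  x \in s -> x \in drop l s ++ y :: take l s.
Proof.
by rewrite -{1}(cat_take_drop l s) !mem_cat inE => /orP[->|->]; rewrite ?orbT.
Qed.

Section DirectSumProjection.
Variables (K : fieldType) (n : nat) (X Y : qp K n).
Local Notation Q := (dsum_quiver X Y).
Local Notation inL := (inl : X -> Q).
Local Notation inR := (inr : Y -> Q).

(** The quotient map that sets the arrows of [Y] to zero. *)
Definition dsum_proj (u : cpalg K Q) : cpalg K X :=
  pseries (fun w => coef u (w.1, map inL w.2)).

Lemma is_path_inL i s : is_path (i, map inL s) = is_path (i, s).
Proof. by rewrite /is_path /=; elim: s i => //= c s IH i; rewrite IH. Qed.

Lemma wtail_inL i s : wtail i (map inL s) = wtail i s.
Proof. by rewrite /wtail -map_comp. Qed.

Lemma coef_dsum_proj u i s : coef (dsum_proj u) (i, s) = coef u (i, map inL s).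
Proof.
rewrite coef_pseries; case: ifPn => // Hs.
by rewrite coef_out // is_path_inL.
Qed.

Lemma dsum_proj_morph : alg_morph dsum_proj.
Proof.
split=> [c u v|u v|i]; apply: cpalgP => -[j s] _.
- by rewrite !(coefD, coefZ, coef_dsum_proj).
- rewrite coef_dsum_proj !coefM size_map; apply: eq_bigr => l _.
  by rewrite !coef_dsum_proj map_take map_drop -map_take wtail_inL.
- by rewrite coef_dsum_proj !coef_vtx; case: s.
Qed.

Lemma rquo_dsum_proj c u : rquo c (dsum_proj u) = dsum_proj (rquo (inL c) u).
Proof.
apply: cpalgP => -[i s] _.
by rewrite coef_rquo !coef_dsum_proj coef_rquo map_rcons.
Qed.

Lemma dsum_proj_inL c : dsum_proj (arr K (inL c)) = arr K c.
Proof.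
apply: cpalgP => -[i s] _; rewrite coef_dsum_proj !coef_arr.
congr ((_ && _)%:R); rewrite -[[:: inL c]]/(map inL [:: c]) inj_eq //.
by apply: inj_map => x y [].
Qed.

Lemma dsum_proj_inR c : dsum_proj (arr K (inR c)) = 0.
Proof.
apply: cpalgP => -[i s] _; rewrite coef_dsum_proj coef_arr coef0.
by case: s => [|a [|b s]]; rewrite ?andbF.
Qed.

Lemma coef_dsum_inL i s : s != [::] ->
  coef (dsum_pot X Y) (i, map inL s) = coef (pot X) (i, s).
Proof.
move=> Hs; rewrite coefD !coef_pseries is_path_inL /=.
have -> : all (@dsum_right K n X Y) (map inL s) = false by case: s Hs.
have -> : all (@dsum_left K n X Y) (map inL s) by elim: s {Hs}.
have -> : flatten (pmap (@dsum_left K n X Y) (map inL s)) = s.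
  by elim: s {Hs} => //= c s ->.
by rewrite if_same addr0; case: ifPn => // H; rewrite coef_out.
Qed.

Lemma coef_dsum_inR i s : s != [::] ->
  coef (dsum_pot X Y) (i, map inR s) = coef (pot Y) (i, s).
Proof.
have Ep : is_path (i, map inR s) = is_path (i, s).
  by rewrite /is_path /=; elim: s i => //= c s IH i; rewrite IH.
move=> Hs; rewrite coefD !coef_pseries Ep /=.
have -> : all (@dsum_left K n X Y) (map inR s) = false by case: s Hs {Ep}.
have -> : all (@dsum_right K n X Y) (map inR s) by elim: s {Hs Ep}.
have -> : flatten (pmap (@dsum_right K n X Y) (map inR s)) = s.
  by elim: s {Hs Ep} => //= c s ->.
by rewrite if_same add0r; case: ifPn => // H; rewrite coef_out.
Qed.

Lemma coef_cyc_inR s : coef_cyc (dsum_pot X Y) (map inR s) = coef_cyc (pot Y) s.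
Proof. by case: s => // a s; exact: (@coef_dsum_inR _ (a :: s)). Qed.

Lemma inR_word (s : seq Q) : (exists t, s = map inR t) \/ (exists a, inL a \in s).
Proof.
elim: s => [|[a|c] s IH]; first by left; exists [::].
  by right; exists a; rewrite inE eqxx.
case: IH => [[t ->]|[a Ha]]; first by left; exists (c :: t).
by right; exists a; rewrite inE Ha orbT.
Qed.

Lemma coef_dsum_mixed i a c s : inL a \in s -> inR c \in s -> coef (dsum_pot X Y) (i, s) = 0.
Proof.
move=> Ha Hc; rewrite coefD !coef_pseries /=.
have -> : all (@dsum_right K n X Y) s = false by apply/negP=> /allP /(_ _ Ha).
have -> : all (@dsum_left K n X Y) s = false by apply/negP=> /allP /(_ _ Hc).
by rewrite !if_same addr0.
Qed.

Lemma coef_cyc_inL s : coef_cyc (dsum_pot X Y) (map inL s) = coef_cyc (pot X) s.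
Proof. by case: s => // a s; exact: (@coef_dsum_inL _ (a :: s)). Qed.

Lemma dsum_proj_cderL a : dsum_proj (cder (inL a) (dsum_pot X Y)) = cder a (pot X).
Proof.
apply: cpalgP => -[i s] Hs; rewrite coef_dsum_proj !coef_pseries is_path_inL Hs /=.
case: ifP => // _; rewrite size_map; apply: eq_bigr => l _.
by rewrite -coef_cyc_inL map_cat /= map_drop map_take.
Qed.

Lemma dsum_proj_cderR c : dsum_proj (cder (inR c) (dsum_pot X Y)) = 0.
Proof.
apply: cpalgP => -[i s] Hs; rewrite coef_dsum_proj coef_pseries is_path_inL Hs coef0 /=.
case: ifP => // _; rewrite big1 // => l _.
case: s Hs l => [|a s] Hs l /=.
  exact: (potential_madic2 (@dsum_potP K n X Y)).
set w := _ ++ _; have Hc : inR c \in w by rewrite mem_cat inE eqxx orbT.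
have Ha : inL a \in w.
  by apply: mem_rot_insert; rewrite inE eqxx.
by case: w Hc Ha => // b t Hc Ha; apply: coef_dsum_mixed Ha Hc.
Qed.

Lemma dsum_jac_killed E (HE := dsum_proj_morph) :
  jac_killed (pullmod HE E) (dsum_pot X Y) <-> jac_killed E (pot X).
Proof.
split=> H => [a|[a|c]].
- by have := H (inL a); rewrite pullmodE dsum_proj_cderL.
- by rewrite pullmodE dsum_proj_cderL H.
- by rewrite pullmodE dsum_proj_cderR linear0.
Qed.

(* The potential of the trivial part is quadratic, so modulo m^2 the closed ideal of its cyclic
   derivatives is their linear span. *)
Lemma dsum_inR_act0 (E : pamod K Q) : trivial_qp Y -> jac_killed E (dsum_pot X Y) ->
  forall c, act E (arr K (inR c)) = 0.
Proof.
move=> [Y2 YJ] HJ c.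
(* [L] lets the linear part of a series over [Y] act on [E]; the aim is that it vanishes on every
   arrow. *)
pose L (u : cpalg K Y) : 'End(space E) := \sum_b coef u (ahd b, [:: b]) *: act E (arr K (inR b)).
have linL : linear L.
  move=> z u v; rewrite /L scaler_sumr -big_split; apply: eq_bigr => b _ /=.
  by rewrite coefD coefZ scalerDl scalerA.
have L2 u : madic 2 u -> L u = 0.
  by move=> Hu; rewrite /L big1 // => b _; rewrite Hu ?scale0r.
(* The potential of [Y] is homogeneous of degree two and shares no letter with that of [X], so the
   derivative of the sum by an arrow of [Y] is exactly linear; it kills [E]. *)
have LJ a : L (cder a (pot Y)) = 0.
  rewrite -[RHS](HJ (inR a)); suff -> : cder (inR a) (dsum_pot X Y) =
      \sum_b coef (cder a (pot Y)) (ahd b, [:: b]) *: arr K (inR b).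
    by rewrite linear_sum; apply: eq_bigr => b _; rewrite linearZ.
  apply: cpalgP => -[i s] Hs; rewrite coef_pseries Hs coef_sum /=.
  under [RHS]eq_bigr => b _ do rewrite coefZ coef_arr.
  have [[t Es]|[b Hb]] := inR_word s; last first.
    rewrite [RHS]big1 => [|b' _]; last first.
      by case: (s =P [:: inR b']) Hb => [->|_]; rewrite ?inE // andbF mulr0.
    case: ifP => // _; rewrite big1 // => l _.
    set w := _ ++ _; have Hc : inR a \in w by rewrite mem_cat inE eqxx orbT.
    have Ha : inL b \in w.
      exact: mem_rot_insert.
    by case: w Hc Ha => // b' w Hc Ha; apply: coef_dsum_mixed Ha Hc.
  have ES : \sum_(l < (size s).+1) coef_cyc (dsum_pot X Y) (drop l s ++ inR a :: take l s) =
      \sum_(l < (size t).+1) coef_cyc (pot Y) (drop l t ++ a :: take l t).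
    rewrite Es size_map; apply: eq_bigr => l _.
    by rewrite -coef_cyc_inR map_cat /= map_drop map_take.
  rewrite ES; case: t Es {ES} => [|b [|b' t]] Es; rewrite {}Es in Hs *.
  - rewrite [RHS]big1 => [|b _]; last by rewrite andbF mulr0.
    by case: ifP => // _; rewrite big_ord1 /= Y2.
  - have Ei := is_path_head Hs; rewrite [RHS](bigD1 b) //= [X in _ + X]big1 => [|b' Hb].
      rewrite addr0 -Ei !eqxx mulr1 coef_pseries is_path_arr /=.
      by case: (ahd b == atl a).
    by rewrite eqseq_cons andbT -[inr b == _]/(b == b') [b == b']eq_sym (negbTE Hb) andbF mulr0.
  - rewrite [RHS]big1 => [|b'' _]; last by rewrite eqseq_cons andbF andbF mulr0.
    case: ifP => // _; rewrite big1 // => l _; set w := _ ++ _.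
    have : (2 < size w)%N.
      rewrite /w size_cat /= size_drop size_take_min /=; have := ltn_ord l; rewrite /=; lia.
    by case: w => // c' w Hw; rewrite /coef_cyc Y2 //= gtn_eqF.
(* Triviality places [c] in the Jacobian ideal; precision two is enough because [L] sees only linear
   terms. *)
have /YJ /(_ 2) [y [m [u [g [v [Hg ->]]]]] Hy] : madic 1 (arr K c) by exact: madic_arr.
have -> : act E (arr K (inR c)) = L (arr K c).
  rewrite /L (bigD1 c) //= big1 => [|b Hb]; first by rewrite coef_arr !eqxx scale1r addr0.
  by rewrite coef_arr eqseq_cons (negbTE Hb) andbF scale0r.
rewrite -[arr K c](subrK (\sum_j u j * g j * v j)) (lin_funD linL) L2 // add0r.
rewrite (lin_fun_sum linL) big1 // => j _; have [a ->] := Hg j.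
have E1 i (w : cpalg K Y) : madic 1 (w * vtx K Y i - eps i w *: vtx K Y i).
  move=> [i' [|c' s]] //= _; rewrite coefD coefN coefZ coef_Mvtx coef_vtx andbT.
  by rewrite /wtail /= /eps; case: (i' =P i) => [->|_];
    rewrite ?mul1r ?mulr1 ?subrr // mul0r mulr0 subrr.
have E2 i (w : cpalg K Y) : madic 1 (vtx K Y i * w - eps i w *: vtx K Y i).
  move=> [i' [|c' s]] //= _; rewrite coefD coefN coefZ coef_vtxM coef_vtx andbT.
  by rewrite /eps; case: (i' =P i) => [->|_]; rewrite ?mul1r ?mulr1 ?subrr // mul0r mulr0 subrr.
set S := cder a (pot Y).
have HS : madic 1 S by apply: madic_cder; apply: potential_madic2; exact: potP.
set e := vtx K Y (atl a); set e' := vtx K Y (ahd a).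
have ES : S = e * S * e' by rewrite vtx_cder cder_vtx //; exact: potP.
(* Modulo m^2 the outer factors matter only through their constant terms at the two ends of the
   derivative [S]. *)
have -> : u j * S * v j = (u j * e - eps (atl a) (u j) *: e) * S * (e' * v j)
    + (eps (atl a) (u j) *: (S * (e' * v j - eps (ahd a) (v j) *: e')))
    + (eps (atl a) (u j) * eps (ahd a) (v j)) *: S.
  have S1 : S * e' = S by exact: (cder_vtx a (@potP K n Y)).
  have S2 : e * S = S by exact: vtx_cder.
  set z := eps _ _; set z' := eps _ _.
  have -> : (u j * e - z *: e) * S * (e' * v j) = u j * S * v j - z *: (S * (e' * v j)).
    by rewrite !mulrBl !scaleS_mull -!mulrA (mulrA S) S1 !mulrA -(mulrA _ e) S2.
  by rewrite mulrBr scaleS_mulr S1 scalerBr scalerA addrA !subrK.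
rewrite !(lin_funD linL) !(lin_funZ linL) LJ scaler0 addr0 !L2 ?scaler0 ?addr0 //.
- by apply: (@madicM _ _ _ 1 1) => //; exact: E2.
- by rewrite -[2%N]/(1 + 1 + 0)%N; apply: madicM => //; apply: madicM => //; exact: E1.
Qed.

End DirectSumProjection.

(** * Invariance under reduction *)

Section ConnMorph.
Variables (K : fieldType) (n : nat) (Q Q' : quiver n).

Lemma conn_morph (f : cpalg K Q -> cpalg K Q') (Hf : alg_morph f) (E : pamod K Q')
    (HE : nilpotent E) i (x : {ffun Q' -> space E}) u :
  conn i x (f u) = \sum_b act E (f (rquo b u)) (conn i x (f (arr K b))).
Proof.
have L := conn_linear i x; have Lf := am_lin Hf.
rewrite {1}(rquo_expand u) (lin_funD Lf) (lin_funD L) !(lin_fun_sum Lf) !(lin_fun_sum L).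
rewrite big1 ?add0r => [|j _]; last first.
  by rewrite (lin_funZ Lf) (lin_funZ L) (am_vtx Hf) conn_vtx scaler0.
apply: eq_bigr => b _; rewrite (am_mul Hf) (connM i x HE).
by rewrite (madic_eps i (am_madic Hf (@madic_arr K n Q b))) scale0r addr0.
Qed.

Lemma conn_linear_family (E : pamod K Q) i u :
  linear (fun x : {ffun Q -> space E} => conn i x u).
Proof.
move=> c x y; rewrite /conn scaler_sumr -big_split; apply: eq_bigr => b _ /=.
by rewrite !ffunE linearP.
Qed.

Lemma act_vtx_conn (E : pamod K Q) (HE : nilpotent E) i (x : {ffun Q -> space E}) j u :
  vtx K Q j * u = u -> act E (vtx K Q j) (conn i x u) = conn i x u.
Proof.
by move=> {2}<-; rewrite (connM i x HE) conn_vtx scaler0 addr0.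
Qed.

Lemma conn_Mvtx (E : pamod K Q) (HE : nilpotent E) i (x : {ffun Q -> space E}) j u :
  u * vtx K Q j = u -> j != i -> conn i x u = 0.
Proof.
move=> <- Hj; rewrite (connM i x HE) conn_vtx linear0 add0r eps_vtx eq_sym.
by rewrite (negbTE Hj) scale0r.
Qed.
End ConnMorph.

Lemma iso_on_dim (K : fieldType) (V W : vectType K) (f : 'Hom(V, W)) U U' :
  iso_on f U U' -> \dim U' = \dim U.
Proof. by move=> [<- H]; exact: limg_dim_eq. Qed.

Lemma iso_on_full (K : fieldType) (V W : vectType K) (f : 'Hom(V, W)) :
  iso_on f fullv fullv -> cancel f f^-1%VF /\ cancel f^-1%VF f.
Proof.
move=> [H1 H2]; split; first by apply: lker0_lfunK; rewrite -H2 capfv.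
by move=> y; apply: limg_lfunVK; rewrite H1 memvf.
Qed.

Section KerBeta.
Variables (K : fieldType) (n : nat) (X : qp K n) (M : qprep X).
Lemma ker_beta_madic k m u : m \in ker_beta M k -> madic 1 u -> act M u m = 0.
Proof.
move=> /mem_ker_beta [_ Hm] Hu; rewrite act_expand big1 ?add0r => [|i _].
  by rewrite big1 // => b _; rewrite Hm linear0.
by rewrite (madic_eps _ Hu) scale0r.
Qed.
End KerBeta.

(** * Morphisms of quiver representations *)

Section HomQ.
Variables (K : fieldType) (n : nat) (X : qp K n) (M N : qprep X).
Implicit Type f : 'Hom(space M, space N).

Lemma mem_Hom_Q f : reflect
  ((forall i m, f (act M (vtx K X i) m) = act N (vtx K X i) (f m)) /\
   (forall a m, f (act M (arr K a) m) = act N (arr K a) (f m))) (f \in Hom_Q M N).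
Proof.
have E u : (f \in lker (commutator M N u)) <->
    forall m, f (act M u m) = act N u (f m).
  have H : commutator M N u f = (f \o act M u)%VF - (act N u \o f)%VF.
    rewrite /commutator linfunE // => c g h.
    rewrite comp_lfunDl comp_lfunDr -comp_lfunZl -comp_lfunZr scalerBr.
    by rewrite opprD addrACA.
  rewrite memv_ker H subr_eq0; split=> [/eqP /lfunP H' m|H'].
    by have := H' m; rewrite !comp_lfunE.
  by apply/eqP/lfunP=> m; rewrite !comp_lfunE.
rewrite /Hom_Q memv_cap !memvE; apply: (iffP andP) => -[H1 H2].
  move/subv_bigcapP: H1 => H1; move/subv_bigcapP: H2 => H2.
  by split=> [i|a]; apply/E; rewrite memvE; [exact: H1 | exact: H2].
by split; apply/subv_bigcapP=> i _; rewrite -memvE; apply/E; [exact: H1|exact: H2].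
Qed.

Lemma Hom_Q_act f u m : f \in Hom_Q M N -> f (act M u m) = act N u (f m).
Proof.
case/mem_Hom_Q => Hv Ha; move: m u; apply: (nilpotent_ind (rep_nilpotent M)) => [|m IH] u.
  by rewrite !linear0.
rewrite act_expand [RHS]act_expand linearD !linear_sum; congr (_ + _).
  by apply: eq_bigr => i _; rewrite linearZ /= Hv.
by apply: eq_bigr => b _; rewrite /= IH Ha.
Qed.
End HomQ.

(** * Transport along the right-equivalence of a reduction *)

Section Transfer.
Variables (K : fieldType) (n : nat) (W X Y : qp K n).
Hypothesis HY : trivial_qp Y.
Variable phi : {rmorphism cpalg K W -> cpalg K (dsum X Y)}.
Hypothesis Hphi : right_equiv (Y := dsum X Y) phi.
Local Notation inL := (inl : X -> dsum_quiver X Y).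
Local Notation inR := (inr : Y -> dsum_quiver X Y).

Record transfer (Mt : qprep W) (Mb : qprep X) (f : 'Hom(space Mt, space Mb)) : Prop := Transfer {
  tr_iso : iso_on f fullv fullv;
  tr_vtx : forall i x, f (act Mt (vtx K _ i) x) = act Mb (vtx K _ i) (f x);
  tr_arr : forall c u x, phi u = arr K (inL c) -> f (act Mt u x) = act Mb (arr K c) (f x) }.

Let Hm : alg_morph phi := proj1 (right_equiv_morph Hphi).

Lemma right_equiv_cyc : cyc_equiv (phi (pot W)) (dsum_pot X Y).
Proof. by case: Hphi. Qed.

Definition redproj u := dsum_proj (phi u).

Lemma redproj_morph : alg_morph redproj.
Proof.
have Hp := @dsum_proj_morph K n X Y.
split=> [c u v|u v|i]; rewrite /redproj.
- by rewrite (am_lin Hm) (am_lin Hp).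
- by rewrite (am_mul Hm) (am_mul Hp).
- by rewrite (am_vtx Hm) (am_vtx Hp).
Qed.

Section One.
Variables (Mt : qprep W) (Mb : qprep X) (f : 'Hom(space Mt, space Mb)).
Hypothesis Hf : transfer f.
Let fK : cancel f f^-1%VF := proj1 (iso_on_full (tr_iso Hf)).
Let fVK : cancel f^-1%VF f := proj2 (iso_on_full (tr_iso Hf)).

(** Transported along [phi], the module is killed by the Jacobian ideal of the direct sum, so the
    arrows of the trivial part act as zero and the action factors through [dsum_proj]. *)
Lemma transfer_act u x : f (act Mt u x) = act Mb (redproj u) (f x).
Proof.
have [psi Hpsi [phiK psiK]] := proj2 (right_equiv_morph Hphi).
have HMt := rep_nilpotent Mt.
pose E := pullmod Hpsi Mt.
have HE : jac_killed E (dsum_pot X Y).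
  have HE0 : nilpotent E by exact: pullmod_nilpotent.
  apply/(jac_killed_pull Hm Hpsi phiK psiK HE0 (@potP _ _ W) (@dsum_potP _ _ X Y) right_equiv_cyc).
  by move=> a; rewrite -[LHS]/(act Mt (psi (phi _))) phiK; exact: rjac.
suff H x' v : f (act E v x') = act Mb (dsum_proj v) (f x').
  by rewrite -H -[act E _]/(act Mt (psi (phi _))) phiK.
have nE : nilpotent E by exact: pullmod_nilpotent.
have Hp := @dsum_proj_morph K n X Y.
move: x' v; apply: (nilpotent_ind nE) => [|x' IH] v; first by rewrite !linear0.
rewrite (act_expand (E := E)) [in RHS](rquo_expand v).
rewrite (lin_funD (am_lin Hp)) actDE linearD !(lin_fun_sum (am_lin Hp)) !act_sumE !linear_sum.
congr (_ + _); apply: eq_bigr => i _.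
  rewrite (lin_funZ (am_lin Hp)) actZE (am_vtx Hp) linearZ /=.
  by rewrite -[act E _]/(act Mt (psi _)) (am_vtx Hpsi) tr_vtx.
rewrite (am_mul Hp) actME; apply: etrans (IH _ _) _; congr (act Mb _ _); case: i => [c|c].
  by rewrite dsum_proj_inL -[act E _]/(act Mt (psi _)); apply: (tr_arr Hf); rewrite psiK.
by rewrite dsum_proj_inR act0E (dsum_inR_act0 HY HE) zero_lfunE linear0.
Qed.

Lemma transfer_vsp i x : (f x \in vsp Mb i) = (x \in vsp Mt i).
Proof. by rewrite !mem_vsp -(tr_vtx Hf) (can_eq fK). Qed.

Lemma transfer_dim_vsp i : \dim (vsp Mb i) = \dim (vsp Mt i).
Proof.
rewrite [RHS](dim_exact (f := f) (U0 := 0%VS) (U' := vsp Mb i)) ?dimv0 //.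
- by move=> x; rewrite transfer_vsp.
- by move=> y Hy; exists (f^-1%VF y); rewrite ?fVK // -transfer_vsp fVK.
- move=> x; rewrite memv0 -(can_eq fK) linear0 andb_idl // => /eqP Hx.
  by rewrite -transfer_vsp Hx mem0v.
Qed.

(** The kernel of beta is the part of M(k) killed by all of m, and both [redproj] and [psi] map m
    into m. *)
Lemma transfer_ker_beta k x : (f x \in ker_beta Mb k) = (x \in ker_beta Mt k).
Proof.
have [psi Hpsi [phiK psiK]] := proj2 (right_equiv_morph Hphi).
apply/idP/idP => H; apply/mem_ker_beta; have /mem_ker_beta [Hk _] := H.
  rewrite -transfer_vsp; split=> // b; apply: (can_inj fK); rewrite linear0 transfer_act.
  by apply: ker_beta_madic H _; apply: am_madic redproj_morph _ _ _; exact: madic_arr.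
rewrite transfer_vsp; split=> // c; rewrite -(tr_arr Hf (u := psi (arr K (inL c)))) ?psiK //.
rewrite (ker_beta_madic H) ?linear0 //; apply: (am_madic Hpsi); exact: madic_arr.
Qed.

Lemma transfer_dim_ker_beta k : \dim (ker_beta Mb k) = \dim (ker_beta Mt k).
Proof.
rewrite [RHS](dim_exact (f := f) (U0 := 0%VS) (U' := ker_beta Mb k)) ?dimv0 //.
- by move=> x; rewrite transfer_ker_beta.
- by move=> y Hy; exists (f^-1%VF y); rewrite ?fVK // -transfer_ker_beta fVK.
- move=> x; rewrite memv0 -(can_eq fK) linear0 andb_idl // => /eqP Hx.
  by rewrite -transfer_ker_beta Hx mem0v.
Qed.

(** A one-point extension over [X] is pulled back along [redproj]; by the critical point criterion
    it still satisfies the Jacobian relations. *)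
Lemma transfer_ker_gamma_le1 i : (\dim (ker_gamma Mb i) <= \dim (ker_gamma Mt i))%N.
Proof.
have [psi Hpsi [phiK psiK]] := proj2 (right_equiv_morph Hphi).
have HMt := rep_nilpotent Mt; have HMb := rep_nilpotent Mb.
pose T (y : {ffun X -> space Mb}) : {ffun W -> space Mt} :=
  [ffun b => f^-1%VF (conn i y (redproj (arr K b)))].
have linT : linear T.
  move=> c y y'; apply/ffunP=> b; rewrite !ffunE -linearP /=; congr (_ _).
  exact: conn_linear_family.
have Hr := redproj_morph.
have TE y u : y \in ker_gamma Mb i -> conn i (T y) u = f^-1%VF (conn i y (redproj u)).
  move=> Hy; rewrite (conn_morph Hr HMb) linear_sum [LHS]/conn big_mkcond; apply: eq_bigr => b _ /=.
  case: ifPn => Hb; last by rewrite (@conn_Mvtx K n X Mb HMb i y (atl b)) ?linear0 //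
    -(am_vtx Hr) -(am_mul Hr) arr_vtx.
  by rewrite ffunE; apply: (can_inj fK); rewrite transfer_act !fVK.
apply: (@dim_le_inj K _ _ (linfun T)) => y Hy; rewrite (linfunE linT).
  apply/mem_ker_gamma; split.
    apply/mem_M_out => b; rewrite ffunE; case: ifPn => Hb.
      rewrite -transfer_vsp fVK mem_vsp act_vtx_conn //.
      by rewrite -(am_vtx Hr) -(am_mul Hr) vtx_arr.
    by rewrite (@conn_Mvtx K n X Mb HMb i y (atl b)) ?linear0 // -(am_vtx Hr) -(am_mul Hr) arr_vtx.
  move=> a; rewrite TE //; suff -> : conn i y (redproj (cder a (pot W))) = 0 by rewrite linear0.
  have /mem_ker_gamma [_ HJ] := Hy.
  pose E := connmod i y HMb.
  have nE : nilpotent E by exact: connmod_nilpotent.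
  have HE : jac_killed E (pot X).
    by apply/(conn_jac_killed i y HMb (@potP _ _ X) (rep_jac_killed Mb)).
  have {}HE : jac_killed (pullmod Hm (pullmod (@dsum_proj_morph K n X Y) E)) (pot W).
    have nE' : nilpotent (pullmod (@dsum_proj_morph K n X Y) E) by exact: pullmod_nilpotent.
    apply/(jac_killed_pull Hm Hpsi phiK psiK nE' (@potP _ _ W) (@dsum_potP _ _ X Y) right_equiv_cyc).
    exact/dsum_jac_killed.
  have := congr1 (fun g : 'End(space E) => (g (0, 1)).1) (HE a).
  rewrite -[act _ _ in X in X -> _]/(act E (redproj _)).
  by rewrite connmodE zero_lfunE /= linear0 add0r scale1r.
move=> T0; have /mem_ker_gamma [/mem_M_out Hy' _] := Hy.
apply/ffunP=> c; have := Hy' c; rewrite [RHS]ffunE; case: ifPn => [Hc|_ /eqP //] /vsp_act <-.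
have := conn_arr i y c; rewrite Hc => <-.
(* Injectivity: each arrow [c] is the image under [redproj] of a series over [W], so the pulled back
   extension determines [y c]. *)
have -> : arr K c = redproj (psi (arr K (inL c))) by rewrite /redproj psiK dsum_proj_inL.
apply: (can_inj fVK); rewrite -TE // T0 linear0 /conn big1 // => b _.
by rewrite ffunE linear0.
Qed.

(** Conversely, on an extension of [Mt] killed by the Jacobian ideal the arrows of the trivial part
    act as zero, so it descends to an extension over [X]. *)
Lemma transfer_ker_gamma_le2 i : (\dim (ker_gamma Mt i) <= \dim (ker_gamma Mb i))%N.
Proof.
have [psi Hpsi [phiK psiK]] := proj2 (right_equiv_morph Hphi).
have HMt := rep_nilpotent Mt; have HMb := rep_nilpotent Mb.
pose T (x : {ffun W -> space Mt}) : {ffun X -> space Mb} :=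
  [ffun c => f (conn i x (psi (arr K (inL c))))].
have linT : linear T.
  move=> c y y'; apply/ffunP=> b; rewrite !ffunE -linearP /=; congr (_ _).
  exact: conn_linear_family.
have Hp := @dsum_proj_morph K n X Y.
have HE x : x \in ker_gamma Mt i ->
    jac_killed (pullmod Hpsi (connmod i x HMt)) (dsum_pot X Y).
  move=> Hx; have nE : nilpotent (pullmod Hpsi (connmod i x HMt)).
    by apply: pullmod_nilpotent; exact: connmod_nilpotent.
  apply/(jac_killed_pull Hm Hpsi phiK psiK nE (@potP _ _ W) (@dsum_potP _ _ X Y) right_equiv_cyc).
  have HJ : jac_killed (connmod i x HMt) (pot W).
    apply/(conn_jac_killed i x HMt (@potP _ _ W) (rep_jac_killed Mt)).
    by case/mem_ker_gamma: Hx.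
  by move=> a; rewrite -[LHS]/(act (connmod i x HMt) (psi (phi _))) phiK; exact: HJ.
have E0 x v : act (pullmod Hpsi (connmod i x HMt)) v = 0 -> conn i x (psi v) = 0.
  move=> H; have := congr1 (fun g : 'End(space (connmod i x HMt)) => (g (0, 1)).1) H.
  rewrite -[act _ _ in X in X -> _]/(act (connmod i x HMt) (psi v)).
  by rewrite connmodE zero_lfunE /= linear0 add0r scale1r.
have ER x c : x \in ker_gamma Mt i -> conn i x (psi (arr K (inR c))) = 0.
  by move=> Hx; apply: E0; apply: dsum_inR_act0 HY (HE _ Hx) c.
have psiv j : psi (vtx K (dsum X Y) j) = vtx K W j by rewrite (am_vtx Hpsi).
have TE x v : x \in ker_gamma Mt i -> conn i (T x) (dsum_proj v) = f (conn i x (psi v)).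
  move=> Hx; rewrite (conn_morph Hpsi HMt) linear_sum big_sumType /=.
  rewrite [X in _ + X]big1 ?addr0 => [|c _]; last by rewrite ER // linear0 linear0.
  rewrite [LHS]/conn big_mkcond; apply: eq_bigr => c _ /=.
  case: ifPn => Hc; last first.
    rewrite [X in act _ _ X](_ : _ = 0) ?linear0 ?linear0 //.
    apply: (@conn_Mvtx K n W Mt HMt i x (atl c)) => //.
    by rewrite -psiv -(am_mul Hpsi) (arr_vtx K (inL c)).
  by rewrite ffunE rquo_dsum_proj transfer_act /redproj psiK.
apply: (@dim_le_inj K _ _ (linfun T)) => x Hx; rewrite (linfunE linT).
  apply/mem_ker_gamma; split.
    apply/mem_M_out => c; rewrite ffunE; case: ifPn => Hc.
      rewrite transfer_vsp mem_vsp act_vtx_conn //.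
      by rewrite -psiv -(am_mul Hpsi) (vtx_arr K (inL c)).
    rewrite (@conn_Mvtx K n W Mt HMt i x (atl c)) ?linear0 //.
    by rewrite -psiv -(am_mul Hpsi) (arr_vtx K (inL c)).
  by move=> a; rewrite -(dsum_proj_cderL Y) TE // (E0 _ _ (HE _ Hx (inL a))) linear0.
move=> T0; have /mem_ker_gamma [/mem_M_out Hx' _] := Hx.
apply/ffunP=> b; have := Hx' b; rewrite [RHS]ffunE; case: ifPn => [Hb|_ /eqP //] /vsp_act <-.
have := conn_arr i x b; rewrite Hb => <-.
apply: (can_inj fK); rewrite -[arr K b]phiK -TE // T0 linear0 /conn big1 // => c _.
by rewrite ffunE linear0.
Qed.

Lemma transfer_dim_ker_gamma i : \dim (ker_gamma Mb i) = \dim (ker_gamma Mt i).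
Proof.
by apply/eqP; rewrite eqn_leq transfer_ker_gamma_le1 transfer_ker_gamma_le2.
Qed.
End One.

Lemma transfer_dim_Hom_Q (Mt Nt : qprep W) (Mb Nb : qprep X)
    (f : 'Hom(space Mt, space Mb)) (g : 'Hom(space Nt, space Nb)) :
  transfer f -> transfer g -> \dim (Hom_Q Mb Nb) = \dim (Hom_Q Mt Nt).
Proof.
have [psi Hpsi [phiK psiK]] := proj2 (right_equiv_morph Hphi).
move=> Hf Hg; have [fK fVK] := iso_on_full (tr_iso Hf); have [gK gVK] := iso_on_full (tr_iso Hg).
pose T (h : 'Hom(space Mt, space Nt)) : 'Hom(space Mb, space Nb) := (g \o h \o f^-1)%VF.
have linT : linear T.
  by move=> c h h'; rewrite /T comp_lfunDr comp_lfunDl -comp_lfunZr -comp_lfunZl.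
rewrite [RHS](dim_exact (f := linfun T) (U0 := 0%VS) (U' := Hom_Q Mb Nb)) ?dimv0 //.
- move=> h Hh; rewrite (linfunE linT); apply/mem_Hom_Q; split=> [i|c] m; rewrite !comp_lfunE.
    by rewrite -{1}[m]fVK -(tr_vtx Hf) fK (Hom_Q_act _ _ Hh) (tr_vtx Hg).
  rewrite -{1}[m]fVK -(tr_arr Hf (u := psi (arr K (inL c)))) ?psiK // fK (Hom_Q_act _ _ Hh).
  by rewrite -(tr_arr Hg (u := psi (arr K (inL c)))) ?psiK.
- move=> h Hh; exists (g^-1 \o h \o f)%VF; last first.
    by rewrite (linfunE linT); apply/lfunP=> x; rewrite !comp_lfunE fVK gVK.
  apply/mem_Hom_Q; split=> [i|a] m; rewrite !comp_lfunE; apply: (can_inj gK);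
    by rewrite (transfer_act Hf) (transfer_act Hg) !gVK (Hom_Q_act _ _ Hh).
- move=> h; rewrite memv0 (linfunE linT); apply/eqP/andP => [->|[_ /eqP Th]].
    by rewrite mem0v /T comp_lfun0r comp_lfun0l.
  apply/lfunP=> x; have /lfunP /(_ (f x)) := Th; rewrite !comp_lfunE !zero_lfunE fK => H.
  by apply: (can_inj gK); rewrite H linear0.
Qed.

End Transfer.

(** * Derivatives of the potential of the mutated quiver *)

Lemma sum_sig (V : nmodType) (T : finType) (P : pred T) (F : T -> V) :
  \sum_(x : {x : T | P x}) F (val x) = \sum_(x | P x) F x.
Proof.
rewrite [RHS](reindex_omap (val : {x : T | P x} -> T) insub) /=; last first.
  by move=> x Px; rewrite insubT.
by apply: eq_bigl => -[x Px] /=; rewrite insubT Px eqxx.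
Qed.

Lemma sum_delta (V : nmodType) (I : finType) (F : I -> V) i0 :
  \sum_i (if i0 == i then F i else 0) = F i0.
Proof.
rewrite (bigD1 i0) //= eqxx big1 ?addr0 // => i Hi.
by rewrite eq_sym (negbTE Hi).
Qed.

Lemma sum_delta2 (V : nmodType) (I J : finType) (F : I -> J -> V) i0 j0 :
  \sum_i \sum_j (if (j0 == j) && (i0 == i) then F i j else 0) = F i0 j0.
Proof.
rewrite -[RHS](sum_delta (F ^~ j0)); apply: eq_bigr => i _; case: (i0 == i).
  by under eq_bigr => j _ do rewrite andbT; rewrite sum_delta.
by rewrite big1 // => j _; rewrite andbF.
Qed.

Section Bracket.
Variables (K : fieldType) (n : nat) (X : quiver n) (k : 'I_n) (H2 : no2cyc_at X k).
Local Notation Qt := (mut_quiver H2).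
Local Notation unb := (@unbracket n k X H2).
Implicit Types (y : cpalg K X) (i j : 'I_n) (a b c : X) (s : seq Qt).

Local Notation oldT := {c : X | (ahd c != k) && (atl c != k)}.
Local Notation compT := {p : X * X | (atl p.1 == k) && (ahd p.2 == k)}.
Local Notation inT := {a : X | ahd a == k}.
Local Notation outT := {b : X | atl b == k}.
Implicit Types (o : oldT) (p : compT) (ai : inT) (bo : outT).

Definition old_arrow o : Qt := mut_old H2 o.
Definition comp_arrow p : Qt := inl (inl (inr p)).
Definition star_in ai : Qt := mut_star_in H2 ai.
Definition star_out bo : Qt := mut_star_out H2 bo.

Definition unbracket_word s : seq X := flatten (pmap unb s).

Lemma unbracket_word_cat s t : unbracket_word (s ++ t) = unbracket_word s ++ unbracket_word t.
Proof. by rewrite /unbracket_word pmap_cat flatten_cat. Qed.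

Lemma is_path_unbracket_word i s : all unb s -> is_path (i, unbracket_word s) = is_path (i, s).
Proof.
elim: s i => //= c s IH i /andP[Hc Hs].
rewrite -[c :: s]/([:: c] ++ s) unbracket_word_cat /is_path /= is_path_cat.
rewrite -[is_path_from _ (unbracket_word s)]/(is_path (_, unbracket_word s)) IH //.
case: c Hc => [[[c|[[b a] /= Hp]]|a]|b] //= _; rewrite /unbracket_word /= /is_path /= ?andbT //.
by case/andP: (Hp) => /eqP -> /eqP ->; rewrite eqxx /= andbT.
Qed.

Definition bracket y : cpalg K Qt := pullback unb y.

Lemma coef_bracket y i s : coef (bracket y) (i, s) =
  if all unb s then coef y (i, unbracket_word s) else 0.
Proof.
rewrite coef_pseries /=; case: ifPn => // Hs; case: ifP => // Ha.
by rewrite coef_out // is_path_unbracket_word.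
Qed.

Lemma eps_bracket i y : eps i (bracket y) = eps i y.
Proof. by rewrite /eps coef_bracket. Qed.

Lemma rquo_bracket_old o y : rquo (old_arrow o) (bracket y) = bracket (rquo (val o) y).
Proof.
apply: cpalgP => -[i s] _; rewrite coef_rquo !coef_bracket coef_rquo all_rcons /=.
by rewrite -!cats1 unbracket_word_cat.
Qed.

Lemma rquo_bracket_comp p y :
  rquo (comp_arrow p) (bracket y) = bracket (rquo (val p).1 (rquo (val p).2 y)).
Proof.
apply: cpalgP => -[i s] _; rewrite coef_rquo !coef_bracket !coef_rquo all_rcons /=.
by rewrite -!cats1 unbracket_word_cat -catA.
Qed.

Lemma rquo_bracket_star_in ai y : rquo (star_in ai) (bracket y) = 0.
Proof. by apply: cpalgP => -[i s] _; rewrite coef_rquo !coef_bracket coef0 all_rcons. Qed.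

Lemma rquo_bracket_star_out bo y : rquo (star_out bo) (bracket y) = 0.
Proof. by apply: cpalgP => -[i s] _; rewrite coef_rquo !coef_bracket coef0 all_rcons. Qed.

(* Cutting the composite word inside a bracket [ba] leaves a word that starts with a. *)
Lemma cut_unbracket_word (F : seq X -> seq X -> K) s : all unb s ->
    (forall a u v, ahd a = k -> F (a :: u) v = 0) ->
  \sum_(j < (size (unbracket_word s)).+1) F (drop j (unbracket_word s)) (take j (unbracket_word s)) =
  \sum_(j < (size s).+1) F (unbracket_word (drop j s)) (unbracket_word (take j s)).
Proof.
elim: s F => [|c s IH] F /= Hall HF; first by rewrite !big_ord1.
case/andP: Hall => Hc Hs; case: c Hc => [[[c|[[b a] /= Hp]]|a]|b] //= _.
  rewrite -[unbracket_word (_ :: s)]/(val c :: unbracket_word s) /= big_ord_recl [RHS]big_ord_recl;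
    congr (_ + _).
  by rewrite (IH (fun u v => F u (val c :: v))) // => a u v Ha; exact: HF.
rewrite -[unbracket_word (_ :: s)]/(b :: a :: unbracket_word s) /= big_ord_recl [RHS]big_ord_recl;
  congr (_ + _).
rewrite big_ord_recl /= HF ?add0r; last by case/andP: Hp => _ /eqP.
by rewrite (IH (fun u v => F u (b :: a :: v))) // => a' u v Ha; exact: HF.
Qed.

Variable S : cpalg K X.
Hypothesis HS : potential S.
Hypothesis HSk : forall t : seq X, coef S (k, t) = 0.

Lemma coef_cyc_bracket s : s != [::] ->
  coef_cyc (bracket S) s = if all unb s then coef_cyc S (unbracket_word s) else 0.
Proof.
case: s => // c s _; rewrite /coef_cyc coef_bracket; case: ifP => // /andP[Hc _].
by case: c Hc => [[[c|[[b a] /= Hp]]|a]|b].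
Qed.

Lemma coef_cyc_k a u : ahd a = k -> coef_cyc S (a :: u) = 0.
Proof. by rewrite /= => ->. Qed.

Lemma cder_bracket_old o : cder (old_arrow o) (bracket S) = bracket (cder (val o) S).
Proof.
apply: cpalgP => -[i s] Hs; rewrite coef_bracket coef_pseries Hs /=.
have [Ha|Ha] := boolP (all unb s).
  rewrite coef_pseries is_path_unbracket_word // Hs /=; case: ifP => // _.
  rewrite (cut_unbracket_word (F := fun u v => coef_cyc S (u ++ val o :: v)) Ha) => [|a u v /=];
    last exact: coef_cyc_k.
  apply: eq_bigr => l _; rewrite coef_cyc_bracket; last by case: (drop l s).
  rewrite all_cat /= andbC -all_cat cat_take_drop Ha unbracket_word_cat.
  by [].
case: ifP => // _; rewrite big1 // => l _; rewrite coef_cyc_bracket; last by case: (drop l s).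
by rewrite all_cat /= andbC -all_cat cat_take_drop (negbTE Ha).
Qed.

(** A cut inside a bracket would give a word of [S] starting at [k], and there is none; for the same
    reason [dder0] may be taken of [S] itself. *)
Lemma cder_bracket_comp p :
  cder (comp_arrow p) (bracket S) = bracket (dder0 (val p).1 (val p).2 S).
Proof.
apply: cpalgP => -[i s] Hs; rewrite coef_bracket coef_pseries Hs /=.
have [Ha|Ha] := boolP (all unb s).
  rewrite coef_pseries is_path_unbracket_word // Hs /=; case: ifP => // _.
  rewrite (cut_unbracket_word (F := fun u v => coef_cyc S (u ++ (val p).1 :: (val p).2 :: v)) Ha) =>
    [|a u v /=]; last exact: coef_cyc_k.
  apply: eq_bigr => l _; rewrite coef_cyc_bracket; last by case: (drop l s).
  rewrite all_cat /= andbC -all_cat cat_take_drop Ha unbracket_word_cat.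
  by [].
case: ifP => // _; rewrite big1 // => l _; rewrite coef_cyc_bracket; last by case: (drop l s).
by rewrite all_cat /= andbC -all_cat cat_take_drop (negbTE Ha).
Qed.

Lemma coef_arrM a u i c t : is_path (i, c :: t) ->
  coef (arr K a * u) (i, c :: t) = (c == a)%:R * coef u (atl c, t).
Proof.
move=> Hp; rewrite coefM 2!big_ord_recl big1 => [|[l Hl] _ /=].
  rewrite /= take0 drop0 !coef_arr andbF mul0r add0r addr0 eqseq_cons andbT.
  by rewrite -(is_path_head Hp); case: (c =P a) => [->|]; rewrite ?eqxx ?andbF.
rewrite coef_arr; case: t Hp Hl => [|c' t] //= _ _.
by rewrite eqseq_cons andbF andbF mul0r.
Qed.

(** No word of [S] starts at [k], hence no cycle in it ends with [b], and every [b] is followed by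
    an arrow into [k]. *)
Lemma cder_out b : atl b = k ->
  cder b S = \sum_(a | ahd a == k) arr K a * dder0 b a S.
Proof.
move=> Hb; apply: cpalgP => -[i s] Hs; rewrite coef_sum coef_pseries Hs /= Hb.
case: s Hs => [|c t] Hs.
  rewrite [RHS]big1 => [|a _]; last by rewrite coefM big_ord1 coef_arr andbF mul0r.
  case: ifP => // _; rewrite big_ord1 /= (potential_madic2 HS) //.
rewrite [RHS]big_mkcond (bigD1 c) //= [X in _ = _ + X]big1 ?addr0 => [|a Ha]; last first.
  by case: ifP => // _; rewrite coef_arrM // eq_sym (negbTE Ha) mul0r.
rewrite (is_path_head Hs); case: ifP => // /eqP Ei.
rewrite coef_arrM // eqxx mul1r coef_pseries /= eqxx.
have -> : is_path (atl c, t) by move: Hs => /andP[].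
rewrite big_ord_recl [X in X + _](_ : _ = 0) ?add0r //=.
by rewrite (is_path_head Hs) Ei HSk.
Qed.

Lemma cder_cube (Q : quiver n) (d c1 c2 c3 : Q) :
    atl c1 = ahd c2 -> atl c2 = ahd c3 -> atl c3 = ahd c1 ->
  cder d (arr K c1 * arr K c2 * arr K c3) =
  (if d == c1 then arr K c2 * arr K c3 else 0) +
  (if d == c2 then arr K c3 * arr K c1 else 0) +
  (if d == c3 then arr K c1 * arr K c2 else 0).
Proof.
have E2 (c c' : Q) : atl c = ahd c' -> arr K c * arr K c' = pathS K (ahd c, [:: c; c']).
  move=> E; rewrite {1 2}/arr; have H : is_path (ahd c, [:: c] ++ [:: c']).
    by rewrite /is_path /= E !eqxx.
  by rewrite -(pathSM _ H) -E.
move=> E12 E23 E31; rewrite !E2 //.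
have Hp : is_path (ahd c1, [:: c1; c2] ++ [:: c3]).
  by rewrite /is_path /= E12 E23 !eqxx.
have -> : pathS K (ahd c1, [:: c1; c2]) * arr K c3 = pathS K (ahd c1, [:: c1; c2; c3]).
  by rewrite -(pathSM _ Hp) /arr -E23.
have Hc : is_cycle (ahd c1, [:: c1; c2; c3]) by rewrite /is_cycle Hp /wtail /= E31 eqxx.
rewrite cderE // big_mkcond !big_ord_recl big_ord0 /= addr0 addrA.
congr (_ + _ + _).
- by rewrite -[Some c1 == _]/(c1 == d) eq_sym; case: eqP => // ->; rewrite E12.
- by rewrite -[Some c2 == _]/(c2 == d) eq_sym; case: eqP => // ->; rewrite E23.
- by rewrite -[Some c3 == _]/(c3 == d) eq_sym; case: eqP => // ->; rewrite E31.
Qed.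

Definition star_pot : cpalg K Qt := \sum_ai \sum_bo
  arr K (mut_comp H2 bo ai) * arr K (mut_star_in H2 ai) * arr K (mut_star_out H2 bo).

Lemma cder_star_pot d : cder d star_pot = \sum_ai \sum_bo (
  (if d == mut_comp H2 bo ai then arr K (star_in ai) * arr K (star_out bo) else 0) +
  (if d == star_in ai then arr K (star_out bo) * arr K (mut_comp H2 bo ai) else 0) +
  (if d == star_out bo then arr K (mut_comp H2 bo ai) * arr K (star_in ai) else 0)).
Proof.
rewrite /star_pot (lin_fun_sum (cder_linear d)); apply: eq_bigr => ai _.
rewrite (lin_fun_sum (cder_linear d)); apply: eq_bigr => bo _.
by rewrite cder_cube.
Qed.

Lemma cder_mut_pot d : cder d (mut_pot H2 S) = cder d (bracket S) + cder d star_pot.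
Proof. by rewrite /mut_pot (lin_funD (cder_linear d)). Qed.

Lemma cder_mut_old o : cder (old_arrow o) (mut_pot H2 S) = bracket (cder (val o) S).
Proof.
rewrite cder_mut_pot cder_bracket_old cder_star_pot big1 ?addr0 // => ai _.
by rewrite big1 // => bo _; rewrite !addr0.
Qed.

Lemma cder_mut_comp bo ai : cder (mut_comp H2 bo ai) (mut_pot H2 S) =
  bracket (dder0 (val bo) (val ai) S) + arr K (star_in ai) * arr K (star_out bo).
Proof.
rewrite cder_mut_pot; congr (_ + _); first exact: cder_bracket_comp.
have E ai' bo' : (mut_comp H2 bo ai == mut_comp H2 bo' ai') = (bo == bo') && (ai == ai').
  exact: erefl.
rewrite cder_star_pot; under eq_bigr => ai' _ do under eq_bigr => bo' _ do
  (rewrite E; rewrite -[mut_comp H2 bo ai == star_in ai']/false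
            -[mut_comp H2 bo ai == star_out bo']/false !addr0).
exact: (sum_delta2 (fun ai' bo' => arr K (star_in ai') * arr K (star_out bo')) ai bo).
Qed.

Lemma cder_bracket_star_in ai : cder (star_in ai) (bracket S) = 0.
Proof.
apply: cpalgP => -[i s] Hs; rewrite coef_pseries Hs coef0; case: ifP => // _.
rewrite big1 // => l _; rewrite coef_cyc_bracket; last by case: (drop l s).
by rewrite all_cat /= andbF.
Qed.

Lemma cder_bracket_star_out bo : cder (star_out bo) (bracket S) = 0.
Proof.
apply: cpalgP => -[i s] Hs; rewrite coef_pseries Hs coef0; case: ifP => // _.
rewrite big1 // => l _; rewrite coef_cyc_bracket; last by case: (drop l s).
by rewrite all_cat /= andbF.
Qed.

Lemma cder_mut_star_in ai : cder (star_in ai) (mut_pot H2 S) =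
  \sum_bo arr K (star_out bo) * arr K (mut_comp H2 bo ai).
Proof.
rewrite cder_mut_pot cder_bracket_star_in add0r cder_star_pot exchange_big.
apply: eq_bigr => bo _.
rewrite -[RHS](sum_delta (fun ai' => arr K (star_out bo) * arr K (mut_comp H2 bo ai'))).
apply: eq_bigr => ai' _; rewrite -[star_in ai == mut_comp H2 bo ai']/false.
by rewrite -[star_in ai == star_out bo]/false add0r addr0.
Qed.

Lemma cder_mut_star_out bo : cder (star_out bo) (mut_pot H2 S) =
  \sum_ai arr K (mut_comp H2 bo ai) * arr K (star_in ai).
Proof.
rewrite cder_mut_pot cder_bracket_star_out add0r cder_star_pot.
apply: eq_bigr => ai _.
rewrite -[RHS](sum_delta (fun bo' => arr K (mut_comp H2 bo' ai) * arr K (star_in ai))).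
apply: eq_bigr => bo' _; rewrite -[star_out bo == mut_comp H2 bo' ai]/false.
by rewrite -[star_out bo == star_in ai]/false !add0r.
Qed.

End Bracket.

(** * The action of bracketed series *)

Section BracketAction.
Variables (K : fieldType) (n : nat) (X : quiver n) (k : 'I_n) (H2 : no2cyc_at X k).
Variables (E : pamod K X) (Et : pamod K (mut_quiver H2)) (theta : 'Hom(space E, space Et)).
Hypothesis HE : nilpotent E.

Hypothesis theta_vtx : forall i m, i != k -> act E (vtx K X i) m = m ->
  act Et (vtx K _ i) (theta m) = theta m.
Hypothesis theta_old : forall o m, act E (vtx K X (atl (val o))) m = m ->
  act Et (arr K (old_arrow H2 o)) (theta m) = theta (act E (arr K (val o)) m).
Hypothesis theta_comp : forall bo ai m, act E (vtx K X (atl (val ai))) m = m ->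
  act Et (arr K (mut_comp H2 bo ai)) (theta m) =
  theta (act E (arr K (val bo)) (act E (arr K (val ai)) m)).

Lemma act_vtx_neq (Q : quiver n) (F : pamod K Q) i j m :
  act F (vtx K Q i) m = m -> j != i -> act F (vtx K Q j) m = 0.
Proof. by move=> <- Hj; rewrite -actME vtxM (negbTE Hj) act0E. Qed.

Lemma act_arr_neq (Q : quiver n) (F : pamod K Q) i b m :
  act F (vtx K Q i) m = m -> atl b != i -> act F (arr K b) m = 0.
Proof. by move=> Hm Hb; rewrite -(arr_vtx K b) actME (act_vtx_neq Hm) // linear0. Qed.

Lemma act_vtx_arr (Q : quiver n) (F : pamod K Q) b m :
  act F (vtx K Q (ahd b)) (act F (arr K b) m) = act F (arr K b) m.
Proof. by rewrite -actME vtx_arr. Qed.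

(** [theta] is controlled only away from [k]. At a vector of E(k) the induction therefore carries
    the claim for its images under the arrows leaving [k], so that a passage through [k] counts as
    one letter [ba]. The modules are arbitrary because one-point extensions are substituted for
    them. *)
Lemma bracket_act y i m : (forall s, coef y (k, s) = 0) -> i != k ->
  act E (vtx K X i) m = m -> act Et (bracket H2 y) (theta m) = theta (act E y m).
Proof.
move=> Hy Hi Hm; pose claim m := forall y, (forall s, coef y (k, s) = 0) ->
  act Et (bracket H2 y) (theta m) = theta (act E y m).
pose P m := forall i, act E (vtx K X i) m = m ->
  if i == k then forall b, atl b = k -> claim (act E (arr K b) m) else claim m.
suff H : P m by have := H i Hm; rewrite (negbTE Hi); apply.
move: m {y i Hy Hi Hm}; apply: (nilpotent_ind HE) => [i _|m IH i Hm].
  have H0 : claim 0 by move=> y _; rewrite !linear0.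
  by case: ifP => // _ b _; rewrite linear0.
case: ifPn => [_ b Hb|Hi y Hy].
  have := IH b (ahd b) (act_vtx_arr _ _); rewrite ifN // -Hb.
  by rewrite eq_sym noloop.
(* After division by an arrow into [k] no constant term is left at [k], as [y] has no word starting
   there; so one more letter can be split off. *)
have step b : act E (rquo b y) (act E (arr K b) m) =
    if ahd b == k then \sum_(c | atl c == k)
       act E (rquo c (rquo b y)) (act E (arr K c) (act E (arr K b) m))
    else act E (rquo b y) (act E (arr K b) m).
  case: ifP => // /eqP Hb; rewrite act_expand (bigD1 k) //= {1}/eps coef_rquo Hy scale0r add0r.
  rewrite big1 ?add0r => [|j Hj]; last first.
    by rewrite (act_vtx_neq (act_vtx_arr b m)) ?scaler0 // Hb.
  rewrite [RHS]big_mkcond; apply: eq_bigr => c _; case: ifPn => // Hc.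
  by rewrite (act_arr_neq (act_vtx_arr b m)) ?Hb // linear0.
rewrite act_expand [in RHS]act_expand linearD !linear_sum; congr (_ + _).
  apply: eq_bigr => j _; rewrite eps_bracket linearZ /=; congr (_ *: _).
  have [->|Hj] := eqVneq j i; first by rewrite theta_vtx // Hm.
  by rewrite (act_vtx_neq Hm) // linear0 (act_vtx_neq (theta_vtx Hi Hm)).
rewrite !big_sumType /= [X in _ + X]big1 ?addr0 => [|bo _]; last first.
  by rewrite [rquo _ _](rquo_bracket_star_out H2 bo) act0E.
rewrite [X in _ + X]big1 ?addr0 => [|ai _]; last first.
  by rewrite [rquo _ _](rquo_bracket_star_in H2 ai) act0E.
have Eo (o : {c : X | (ahd c != k) && (atl c != k)}) :
    act Et (rquo (old_arrow H2 o) (bracket H2 y)) (act Et (arr K (old_arrow H2 o)) (theta m)) =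
    theta (act E (rquo (val o) y) (act E (arr K (val o)) m)).
  rewrite rquo_bracket_old; have [Ho|Ho] := eqVneq (atl (val o)) i; last first.
    by rewrite (act_arr_neq (theta_vtx Hi Hm)) // (act_arr_neq Hm) // !linear0.
  rewrite theta_old ?Ho //; have := IH (val o) _ (act_vtx_arr _ _).
  rewrite ifN; last by case/andP: (valP o).
  by apply=> s; rewrite coef_rquo.
have Ec (p : {p : X * X | (atl p.1 == k) && (ahd p.2 == k)}) :
    act Et (rquo (comp_arrow H2 p) (bracket H2 y)) (act Et (arr K (comp_arrow H2 p)) (theta m)) =
    theta (act E (rquo (val p).1 (rquo (val p).2 y))
      (act E (arr K (val p).1) (act E (arr K (val p).2) m))).
  rewrite rquo_bracket_comp; case: p => -[b a] /= Hp; have /andP [Hb Ha] := Hp.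
  have Ecomp : comp_arrow H2 (exist _ (b, a) Hp) = mut_comp H2 (exist _ b Hb) (exist _ a Ha).
    by congr (inl (inl (inr _))); apply: val_inj.
  have [Ht|Ht] := eqVneq (atl a) i; last first.
    by rewrite (act_arr_neq (theta_vtx Hi Hm)) // (act_arr_neq Hm) // !linear0.
  rewrite Ecomp theta_comp /= ?Ht //.
  have := IH a _ (act_vtx_arr _ _); rewrite Ha => /(_ b (eqP Hb)).
  by apply=> s; rewrite !coef_rquo.
rewrite (eq_bigr _ (fun o _ => Eo o)) (eq_bigr _ (fun p _ => Ec p)).
under [RHS]eq_bigr => b _ do rewrite /= step.
rewrite (sum_sig _ (fun c => theta (act E (rquo c y) (act E (arr K c) m)))).
rewrite (sum_sig _ (fun p => theta (act E (rquo p.1 (rquo p.2 y))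
      (act E (arr K p.1) (act E (arr K p.2) m))))).
rewrite [RHS](bigID (fun b => ahd b == k)) /= [RHS]addrC; congr (_ + _).
  rewrite [LHS]big_mkcond [RHS]big_mkcond; apply: eq_bigr => c _.
  case: (ahd c == k) => //=; case: ifPn => //; rewrite negbK => /eqP Hc.
  by rewrite (act_arr_neq Hm) ?linear0 // Hc eq_sym.
rewrite -(pair_big_dep (fun b => atl b == k) (fun _ a => ahd a == k)
  (fun b a => theta (act E (rquo b (rquo a y)) (act E (arr K b) (act E (arr K a) m))))) /=.
rewrite exchange_big /=; apply: eq_bigr => a Ha; rewrite Ha linear_sum.
by [].
Qed.

End BracketAction.

(** * The mutated representation before reduction *)

Section IsoOn.
Variables (K : fieldType) (V W : vectType K).
Implicit Types (f : 'Hom(V, W)) (U : {vspace V}).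

Lemma iso_on_mem f U (U' : {vspace W}) x : iso_on f U U' -> x \in U -> f x \in U'.
Proof. by move=> [<- _]; exact: memv_img. Qed.

Lemma iso_on_surj f U (U' : {vspace W}) y : iso_on f U U' -> y \in U' -> exists2 x, x \in U & f x = y.
Proof. by move=> [<- _] /memv_imgP [x Hx ->]; exists x. Qed.

Lemma iso_on_inj f U (U' : {vspace W}) x : iso_on f U U' -> x \in U -> f x = 0 -> x = 0.
Proof.
move=> [_ H0] Hx /eqP Hf; apply/eqP; rewrite -memv0 -H0 memv_cap memv_ker.
by rewrite Hx Hf.
Qed.

Lemma is_quotient_dim f U U' : is_quotient f U U' -> \dim U = (\dim U' + \dim {:W})%N.
Proof. by move=> [H1 H2]; rewrite -(limg_ker_dim f U) H1 H2. Qed.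

Lemma is_quotient_mem f U U' x : is_quotient f U U' -> (x \in U') = (x \in U) && (f x == 0).
Proof. by move=> [_ <-]; rewrite memv_cap memv_ker. Qed.
End IsoOn.

Section Premut.
Variables (K : fieldType) (n : nat) (X : qp K n) (k : 'I_n) (D : qp_mutation X k).
Variables (M : qprep X) (Mt : qprep (qm_pre D)) (pr : premut_rep M Mt).
Local Notation H2 := (qm_no2cyc D).
Local Notation Qt := (mut_quiver H2).
Local Notation S := (qm_pot D).
Local Notation HS := (qm_potP D).
Local Notation theta := (pr_theta pr).
Local Notation inT := {a : X | ahd a == k}.
Local Notation outT := {b : X | atl b == k}.
Local Notation oldT := {c : X | (ahd c != k) && (atl c != k)}.
Implicit Types (i j : 'I_n) (x : {ffun X -> space M}) (m : space M).

Let HM : nilpotent M := rep_nilpotent M.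
Let HMt : nilpotent Mt := rep_nilpotent Mt.

Lemma theta_mem i m : i != k -> m \in vsp M i -> theta m \in vsp Mt i.
Proof. by move=> Hi; exact: iso_on_mem (pr_theta_iso pr Hi). Qed.

Lemma theta_surj i y : i != k -> y \in vsp Mt i -> exists2 m, m \in vsp M i & theta m = y.
Proof. by move=> Hi; exact: iso_on_surj (pr_theta_iso pr Hi). Qed.

Lemma theta_inj i m : i != k -> m \in vsp M i -> theta m = 0 -> m = 0.
Proof. by move=> Hi; exact: iso_on_inj (pr_theta_iso pr Hi). Qed.

Lemma theta_inj2 i m m' : i != k -> m \in vsp M i -> m' \in vsp M i ->
  theta m = theta m' -> m = m'.
Proof.
move=> Hi Hm Hm' E; apply/eqP; rewrite -subr_eq0; apply/eqP; apply: (theta_inj Hi).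
  exact: memvB.
by rewrite linearB /= E subrr.
Qed.

Lemma atl_in_neq (a : inT) : atl (val a) != k.
Proof. by case: a => a /= /eqP <-; exact: noloop. Qed.

Lemma ahd_out_neq (b : outT) : ahd (val b) != k.
Proof. by case: b => b /= /eqP <-; rewrite eq_sym noloop. Qed.

(** The map alpha of the mutation at [k], in the coordinates of M_out(k). *)
Definition phi_out x : space Mt :=
  \sum_(bo : outT) act Mt (arr K (star_out H2 bo)) (theta (x (val bo))).

Lemma phi_out_mem x : phi_out x \in vsp Mt k.
Proof. by apply: memv_suml => bo _; exact: (@arr_mem K n (qm_pre D) Mt (star_out H2 bo)). Qed.

Lemma M_out_sum x : x \in M_out M k -> x = \sum_(bo : outT) finj (space M) (val bo) (x (val bo)).
Proof.
move=> /mem_M_out Hx; rewrite {1}[x]finj_sum.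
rewrite (sum_sig (fun b => atl b == k) (fun b => finj (space M) b (x b))) [RHS]big_mkcond.
apply: eq_bigr => b _; have := Hx b; case: ifP => // _ /eqP ->; exact: linear0.
Qed.

Lemma gamma_mem x : x \in M_out M k -> gamma M k x \in im_gamma M k.
Proof. exact: memv_img. Qed.

Lemma psi_phi_out x : x \in M_out M k -> pr_psi pr (phi_out x) =
  (- pr_pi1 pr (pr_rho pr x), - vsproj (im_gamma M k) (gamma M k x), 0, 0).
Proof.
move=> Hx.
pose L x : (pr_X1 pr * subvs_of (im_gamma M k) * pr_X3 pr * dec M k)%type :=
  (- pr_pi1 pr (pr_rho pr x), - vsproj (im_gamma M k) (gamma M k x), 0, 0).
have linL : linear L.
  move=> c y y'; rewrite /L !linearP; congr (_, _, _, _);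
    by rewrite /= ?opprD ?scalerN ?scaler0 ?addr0.
rewrite -[RHS]/(L x) {2}(M_out_sum Hx) (lin_fun_sum linL) linear_sum.
apply: eq_bigr => bo _; rewrite /= (pr_star_out pr) //.
by have /mem_M_out /(_ (val bo)) := Hx; rewrite (valP bo).
Qed.

Lemma psi_inj y : y \in vsp Mt k -> pr_psi pr y = 0 -> y = 0.
Proof. exact: iso_on_inj (pr_psi_iso pr). Qed.

(** The second coordinate forces [x] into ker(gamma), where [rho] is the identity, so that the first
    coordinate is the class of [x] modulo im(beta), up to sign. *)
Lemma phi_out_eq0 x : x \in M_out M k -> (phi_out x == 0) = (x \in im_beta M k).
Proof.
move=> Hx; rewrite (is_quotient_mem _ (pr_quot1 pr)).
have -> : (phi_out x == 0) = (pr_psi pr (phi_out x) == 0).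
  apply/eqP/eqP => [->|]; first exact: linear0.
  by apply: psi_inj; exact: phi_out_mem.
rewrite psi_phi_out //; apply/eqP/andP => [[H1 H3]|[Hg /eqP H1]].
  have Hg : x \in ker_gamma M k.
    rewrite /ker_gamma memv_cap Hx memv_ker.
    move/eqP: H3; rewrite oppr_eq0 => /eqP H3.
    by rewrite -(vsprojK (gamma_mem Hx)) H3 eqxx.
  by split=> //; move/eqP: H1; rewrite oppr_eq0 pr_rho_id.
have -> : gamma M k x = 0.
  by move: Hg; rewrite /ker_gamma memv_cap memv_ker => /andP[_ /eqP].
by rewrite pr_rho_id // H1 (linear0 (vsproj _)) !oppr0.
Qed.

Lemma im_gamma_sub z : z \in im_gamma M k -> z \in ker_alpha M k /\ pr_pi3 pr z = 0.
Proof. by rewrite (is_quotient_mem _ (pr_quot3 pr)) => /andP[-> /eqP]. Qed.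

Lemma star_in_ker_alpha y : y \in vsp Mt k -> exists2 z, z \in ker_alpha M k &
  forall ai : inT, act Mt (arr K (star_in H2 ai)) y = theta (z (val ai)).
Proof.
move=> Hy; case E : (pr_psi pr y) => [[[x1 x2] x3] v].
exists (vsval x2 + pr_sigma pr x3) => [|ai].
  apply: memvD; last exact: pr_sigma_ker.
  by case: (im_gamma_sub (subvsP x2)).
by rewrite (pr_star_in (p := pr) ai Hy E) fprojE.
Qed.

(** With [star_in_ker_alpha], this says that beta of the mutation has image ker(alpha): the section
    [sigma] reassembles it from im(gamma) and the quotient. *)
Lemma ker_alpha_star_in z : z \in ker_alpha M k -> exists2 y, y \in vsp Mt k &
  forall ai : inT, act Mt (arr K (star_in H2 ai)) y = theta (z (val ai)).
Proof.
move=> Hz; set x3 := pr_pi3 pr z.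
have Hz' : z - pr_sigma pr x3 \in im_gamma M k.
  rewrite (is_quotient_mem _ (pr_quot3 pr)) memvB ?pr_sigma_ker //.
  by rewrite linearB /= pr_sigma_sec subrr.
have [y Hy E] := iso_on_surj (pr_psi_iso pr)
  (memvf (0, vsproj (im_gamma M k) (z - pr_sigma pr x3), x3, 0)).
exists y => // ai; rewrite (pr_star_in (p := pr) ai Hy E) fprojE vsprojK //.
by rewrite subrK.
Qed.

Lemma star_in_phi_out x (ai : inT) : x \in M_out M k ->
  act Mt (arr K (star_in H2 ai)) (phi_out x) = - theta (gamma M k x (val ai)).
Proof.
move=> Hx; rewrite (pr_star_in (p := pr) ai (phi_out_mem x) (psi_phi_out Hx)) fprojE.
by rewrite linear0 addr0 linearN /= vsprojK ?gamma_mem // !ffunE linearN.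
Qed.

Lemma premut_dim_vsp i : i != k -> \dim (vsp Mt i) = \dim (vsp M i).
Proof. by move=> Hi; exact: iso_on_dim (pr_theta_iso pr Hi). Qed.

Lemma premut_dim_dec i : i != k -> \dim {:dec Mt i} = \dim {:dec M i}.
Proof. by move=> Hi; exact: iso_on_dim (pr_dec_iso pr Hi). Qed.

Lemma premut_dim_dec_k :
  \dim (ker_beta M k) = (\dim (ker_beta M k :&: im_alpha M k) + \dim {:dec Mt k})%N.
Proof. exact: is_quotient_dim (pr_dec_quot pr). Qed.

Lemma premut_dim_vsp_k : (\dim (vsp Mt k) + \dim (im_beta M k))%N =
  (\dim (ker_gamma M k) + \dim (ker_alpha M k) + \dim {:dec M k})%N.
Proof.
rewrite -(iso_on_dim (pr_psi_iso pr)) (is_quotient_dim (pr_quot1 pr)) (is_quotient_dim (pr_quot3 pr)).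
have -> : \dim {:(pr_X1 pr * subvs_of (im_gamma M k) * pr_X3 pr * dec M k)%type} =
  (\dim {:pr_X1 pr} + \dim (im_gamma M k) + \dim {:pr_X3 pr} + \dim {:dec M k})%N.
  by rewrite !dimvf.
lia.
Qed.

Lemma mem_ker_beta_Mt y : y \in vsp Mt k ->
  (forall ai : inT, act Mt (arr K (star_in H2 ai)) y = 0) -> y \in ker_beta Mt k.
Proof.
move=> Hy H; apply/mem_ker_beta; split=> // -[[[o|p]|ai]|bo]; last 1 first.
- by apply: arr_act0 Hy _; rewrite eq_sym; exact: ahd_out_neq.
- by apply: arr_act0 Hy _; rewrite eq_sym; case/andP: (valP o).
- apply: arr_act0 Hy _; rewrite eq_sym.
  by case: p => -[b a] /= /andP[_ /eqP <-]; exact: noloop.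
- exact: H.
Qed.

(** The kernel of beta of the mutation consists of the first and the last of the four summands, as
    beta is injective on the two in the middle. *)
Lemma premut_dim_ker_beta : (\dim (ker_beta Mt k) + \dim (im_beta M k))%N =
  (\dim (ker_gamma M k) + \dim {:dec M k})%N.
Proof.
rewrite (is_quotient_dim (pr_quot1 pr)).
pose f y : (pr_X1 pr * dec M k)%type := ((pr_psi pr y).1.1.1, (pr_psi pr y).2).
have linf : linear f by move=> c y y'; rewrite /f linearP.
have fE := linfunE linf.
suff -> : \dim (ker_beta Mt k) = (\dim {:pr_X1 pr} + \dim {:dec M k})%N by lia.
rewrite (dim_exact (f := linfun f) (U0 := 0%VS) (U' := fullv)) ?dimv0 ?dimvf //.
- by move=> y _; exact: memvf.
- move=> [x1 v] _; have [y Hy E] := iso_on_surj (pr_psi_iso pr) (memvf (x1, 0, 0, v)).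
  exists y; last by rewrite fE /f E.
  apply: mem_ker_beta_Mt => // ai; rewrite (pr_star_in (p := pr) ai Hy E) !linear0 addr0.
  by rewrite !linear0.
- move=> y; rewrite memv0 fE; apply/eqP/andP => [->|[/mem_ker_beta [Hy Hb] /eqP]].
    by rewrite mem0v /f !linear0.
  rewrite /f; case E : (pr_psi pr y) => [[[x1 x2] x3] v] /= [Ex Ev].
  apply: psi_inj => //; rewrite E Ex Ev.
  have Hz : vsval x2 + pr_sigma pr x3 \in ker_alpha M k.
    by apply: memvD; [case: (im_gamma_sub (subvsP x2)) | exact: pr_sigma_ker].
  have z0 : vsval x2 + pr_sigma pr x3 = 0.
    have /mem_M_in Hz' : vsval x2 + pr_sigma pr x3 \in M_in M k.
      by move: Hz; rewrite /ker_alpha memv_cap => /andP[].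
    apply/ffunP=> a; have := Hz' a; rewrite [RHS]ffunE; case: ifPn => [Ha Hm|_ /eqP //].
    apply: theta_inj Hm _; first exact: (atl_in_neq (exist _ a Ha)).
    have := Hb (star_in H2 (exist _ a Ha)); rewrite (pr_star_in (p := pr) (exist _ a Ha) Hy E).
    by rewrite fprojE.
  have x30 : x3 = 0.
    rewrite -(pr_sigma_sec x3) -[RHS](linear0 (pr_pi3 pr)) -z0 linearD /=.
    by case: (im_gamma_sub (subvsP x2)) => _ ->; rewrite add0r.
  have x20 : x2 = 0.
    by apply: subvs_inj; move: z0; rewrite x30 linear0 addr0 => ->; rewrite linear0.
  by rewrite x30 x20.
Qed.

End Premut.

(** * The kernel of gamma away from the mutation vertex *)

Section PremutGamma.
Variables (K : fieldType) (n : nat) (X : qp K n) (k : 'I_n) (D : qp_mutation X k).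
Variables (M : qprep X) (Mt : qprep (qm_pre D)) (pr : premut_rep M Mt).
Local Notation H2 := (qm_no2cyc D).
Local Notation Qt := (mut_quiver H2).
Local Notation S := (qm_pot D).
Local Notation HS := (qm_potP D).
Local Notation HSk := (qm_start D).
Local Notation theta := (pr_theta pr).
Local Notation inT := {a : X | ahd a == k}.
Local Notation outT := {b : X | atl b == k}.
Local Notation oldT := {c : X | (ahd c != k) && (atl c != k)}.
Local Notation compT := {p : X * X | (atl p.1 == k) && (ahd p.2 == k)}.
Implicit Types (i j : 'I_n) (x : {ffun X -> space M}) (m : space M)
  (xt : {ffun Qt -> space Mt}).

Let HM : nilpotent M := rep_nilpotent M.
Let HMt : nilpotent Mt := rep_nilpotent Mt.

Lemma cder_pot a : cder a (pot X) = cder a S.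
Proof. exact: cder_cyc_equiv (qm_equiv D). Qed.

Lemma comp_components (p : compT) : exists bo : outT, exists ai : inT,
  [/\ comp_arrow H2 p = mut_comp H2 bo ai, val bo = (val p).1 & val ai = (val p).2].
Proof.
case: p => -[b a] Hp; have /andP [Hb Ha] := Hp.
exists (exist _ b Hb), (exist _ a Ha); split=> //.
by congr (inl (inl (inr _))); apply: val_inj.
Qed.

Lemma mem_M_out_Mt i xt : reflect
  ((forall c : Qt, atl c = i -> xt c \in vsp Mt (ahd c)) /\ (forall c : Qt, atl c != i -> xt c = 0))
  (xt \in M_out Mt i).
Proof.
apply: (iffP (mem_M_out _ _)) => [H|[H1 H0] c]; last first.
  by case: ifPn => [/eqP /H1|/H0 ->].
split=> c Hc; have := H c; first by rewrite Hc eqxx.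
by rewrite (negbTE Hc) => /eqP.
Qed.

Lemma mem_M_outP i x : reflect
  ((forall c : X, atl c = i -> x c \in vsp M (ahd c)) /\ (forall c : X, atl c != i -> x c = 0))
  (x \in M_out M i).
Proof.
apply: (iffP (mem_M_out _ _)) => [H|[H1 H0] c]; last first.
  by case: ifPn => [/eqP /H1|/H0 ->].
split=> c Hc; have := H c; first by rewrite Hc eqxx.
by rewrite (negbTE Hc) => /eqP.
Qed.

Lemma conn_arrow_Mt i xt : xt \in M_out Mt i -> forall c : Qt, conn i xt (arr K c) = xt c.
Proof.
move=> /mem_M_out_Mt [H1 H0] c; rewrite (conn_arr i xt c); case: eqP => [Hc|/eqP Hc].
  by rewrite (vsp_act (H1 c Hc)).
by rewrite (H0 c Hc).
Qed.

Lemma conn_arrow i x : x \in M_out M i -> forall c : X, conn i x (arr K c) = x c.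
Proof.
move=> /mem_M_outP [H1 H0] c; rewrite (conn_arr i x c); case: eqP => [Hc|/eqP Hc].
  by rewrite (vsp_act (H1 c Hc)).
by rewrite (H0 c Hc).
Qed.

(* theta + id maps the one-point extension defined by x to the one defined by xt. *)
Lemma conn_bracket i x xt y : i != k -> x \in M_out M i -> xt \in M_out Mt i ->
    (forall o : oldT, xt (old_arrow H2 o) = theta (x (val o))) ->
    (forall (bo : outT) (ai : inT),
      xt (mut_comp H2 bo ai) = theta (act M (arr K (val bo)) (x (val ai)))) ->
    (forall s, coef y (k, s) = 0) ->
  conn i xt (bracket H2 y) = theta (conn i x y).
Proof.
move=> Hi Hx Hxt Hold Hcomp Hy.
pose E := connmod i x HM; pose Et := connmod i xt HMt.
pose f (p : space E) : space Et := (theta p.1, p.2).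
have linf : linear f by move=> c p q; rewrite /f linearP.
have fE := linfunE linf.
have EE u (m : space M) (z : K^o) :
    act E u (m, z) = (act M u m + z *: conn i x u, eps i u *: z) by exact: connmodE.
have EtE (u : cpalg K Qt) (m : space Mt) (z : K^o) :
    act Et u (m, z) = (act Mt u m + z *: conn i xt u, eps i u *: z) by exact: connmodE.
(* A vector fixed by the idempotent at [j] has added coordinate zero unless [j] is the vertex
   [i]. *)
have vE j (m : space M) (z : K^o) : act E (vtx K X j) (m, z) = (m, z) ->
    act M (vtx K X j) m = m /\ (z = 0 \/ i = j).
  rewrite EE conn_vtx scaler0 addr0 eps_vtx => -[-> Hz]; split=> //.
  by move: Hz; case: eqP => [->|_]; [right | rewrite scale0r => <-; left].
have Hb : act Et (bracket H2 y) (linfun f (0, 1)) = linfun f (act E y (0, 1)).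
  apply: (bracket_act (connmod_nilpotent i x HM)) Hy Hi _.
  - move=> j [m z] Hj /vE [Hm Hz]; rewrite !fE /f /=.
    rewrite EtE conn_vtx scaler0 addr0 eps_vtx.
    rewrite (vsp_act (theta_mem pr Hj _)); last by rewrite mem_vsp Hm.
    by congr (_, _); case: Hz => [->|->]; rewrite ?scaler0 // eqxx scale1r.
  - move=> o [m z] /vE [Hm Hz]; rewrite !fE /f /= EE EtE !eps_arr !scale0r.
    rewrite (conn_arrow_Mt Hxt) (conn_arrow Hx) Hold linearD linearZ /=; congr (_ + _, _).
    by apply: (pr_old pr); rewrite mem_vsp Hm.
  - move=> bo ai [m z] /vE [Hm Hz]; rewrite !fE /f /= !EE EtE /= !eps_arr !scale0r.
    rewrite !addr0 (conn_arrow_Mt Hxt) (conn_arrow Hx) Hcomp linearD /= linearD /=.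
    rewrite !linearZ /=; congr (_ + _, _).
    by apply: (pr_comp pr); rewrite mem_vsp Hm.
  - by rewrite EE linear0 conn_vtx scaler0 addr0 eps_vtx eqxx scale1r.
have := congr1 fst Hb; rewrite !fE /f /= !linear0 EE EtE /= !linear0 !add0r.
by rewrite !scale1r.
Qed.

Lemma cder_off a s : atl a != k -> coef (cder a S) (k, s) = 0.
Proof.
by move=> Ha; rewrite coef_pseries; case: ifP => //= _; rewrite eq_sym (negbTE Ha).
Qed.

Lemma dder0_off b a s : atl a != k -> coef (dder0 b a S) (k, s) = 0.
Proof.
by move=> Ha; rewrite coef_pseries; case: ifP => //= _; rewrite eq_sym (negbTE Ha).
Qed.

Lemma old_atl (o : oldT) : atl (val o) != k.
Proof. by case/andP: (valP o). Qed.

Lemma old_ahd (o : oldT) : ahd (val o) != k.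
Proof. by case/andP: (valP o). Qed.

Lemma vsp_conn i x j u : vtx K X j * u = u -> conn i x u \in vsp M j.
Proof. by move=> Hu; rewrite mem_vsp (act_vtx_conn HM). Qed.

Lemma conn_MM i xt (c c' : Qt) : xt \in M_out Mt i ->
  conn i xt (arr K c * arr K c') = act Mt (arr K c) (xt c').
Proof.
by move=> Hxt; rewrite (connM i xt HMt) eps_arr scale0r addr0 conn_arrow_Mt.
Qed.

Lemma vtx_dder0 a b : vtx K X (atl a) * dder0 b a S = dder0 b a S.
Proof.
apply: cpalgP => -[i s] Hs; rewrite coef_vtxM coef_pseries Hs /=.
by case: eqP; rewrite ?mul1r ?mul0r.
Qed.

(** These are the relations of the mutated potential indexed by old arrows, arrows [ba] and arrows
    a* with head [i]; the arrows b* have head [k]. *)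
Lemma mem_ker_gamma_Mt i xt : i != k -> reflect
  [/\ xt \in M_out Mt i,
      forall o : oldT, ahd (val o) = i -> conn i xt (bracket H2 (cder (val o) S)) = 0,
      forall (bo : outT) (ai : inT), ahd (val bo) = i ->
        conn i xt (bracket H2 (dder0 (val bo) (val ai) S)) +
        act Mt (arr K (star_in H2 ai)) (xt (star_out H2 bo)) = 0 &
      forall ai : inT, atl (val ai) = i ->
        \sum_(bo : outT) act Mt (arr K (star_out H2 bo)) (xt (mut_comp H2 bo ai)) = 0]
  (xt \in ker_gamma Mt i).
Proof.
move=> Hi; have L := conn_linear i xt.
have Eo o : cder (old_arrow H2 o) (pot (qm_pre D)) = bracket H2 (cder (val o) S).
  exact: (cder_mut_old H2 HSk o).
have Ec bo ai : cder (mut_comp H2 bo ai) (pot (qm_pre D)) =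
    bracket H2 (dder0 (val bo) (val ai) S) + arr K (star_in H2 ai) * arr K (star_out H2 bo).
  exact: (cder_mut_comp H2 HSk bo ai).
have Es ai : cder (star_in H2 ai) (pot (qm_pre D)) =
    \sum_(bo : outT) arr K (star_out H2 bo) * arr K (mut_comp H2 bo ai).
  exact: (cder_mut_star_in H2 S ai).
apply: (iffP (mem_ker_gamma _ _)) => [[Hxt H]|[Hxt Ho Hc Hs]]; split=> //.
- by move=> o _; rewrite -Eo H.
- by move=> bo ai _; rewrite -(conn_MM _ _ Hxt) -(lin_funD L) -Ec H.
- move=> ai _; rewrite -[RHS](H (star_in H2 ai)) Es (lin_fun_sum L).
  by apply: eq_bigr => bo _; rewrite (conn_MM _ _ Hxt).
move=> d; have [Hd|Hd] := eqVneq (ahd d) i; last first.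
  by apply: (conn_cder0 xt HMt _ Hd); exact: (@potP _ _ (qm_pre D)).
case: d Hd => [[[o|p]|ai]|bo] Hd.
- by rewrite [cder _ _](Eo o) Ho.
- have [bo [ai [Ep Hb Ha]]] := comp_components p.
  rewrite [inl (inl (inr p))]Ep Ec (lin_funD L) (conn_MM _ _ Hxt); apply: Hc.
  by rewrite Hb.
- rewrite [cder _ _](Es ai) (lin_fun_sum L) -[RHS](Hs ai Hd).
  by apply: eq_bigr => bo _; rewrite (conn_MM _ _ Hxt).
- by move: Hi; rewrite -Hd /= eqxx.
Qed.

Lemma mem_ker_gamma_S i x : reflect
  (x \in M_out M i /\ forall a, ahd a = i -> conn i x (cder a S) = 0) (x \in ker_gamma M i).
Proof.
apply: (iffP (mem_ker_gamma _ _)) => -[Hx H]; split=> // a.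
  by move=> _; rewrite -cder_pot.
rewrite cder_pot; have [/H //|Ha] := eqVneq (ahd a) i.
by apply: (conn_cder0 x HM _ Ha); exact: HS.
Qed.

Lemma beta_ffun j m b : atl b = j -> beta M j m b = act M (arr K b) m.
Proof. by move=> Hb; rewrite betaE ffunE Hb eqxx. Qed.

Lemma beta_M_out m : beta M k m \in M_out M k.
Proof.
apply/mem_M_outP ; split=> c Hc; rewrite betaE ffunE ?Hc ?eqxx; first exact: arr_mem.
by rewrite (negbTE Hc).
Qed.

Lemma phi_out_beta m : m \in vsp M k -> phi_out pr (beta M k m) = 0.
Proof.
move=> Hm; apply/eqP; rewrite (phi_out_eq0 pr (beta_M_out m)).
exact: memv_img.
Qed.

Section NoOut.
Variable i : 'I_n.
Hypothesis Hi : i != k.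
Hypothesis Hout : forall b : X, atl b = k -> ahd b != i.

Let T x : {ffun Qt -> space Mt} := [ffun c : Qt =>
  match c return space Mt with
  | inl (inl (inl o)) => theta (x (val o))
  | inl (inl (inr p)) => theta (act M (arr K (val p).1) (x (val p).2))
  | _ => 0
  end].

Let linT : linear T.
Proof.
move=> z x y; apply/ffunP=> c; rewrite !ffunE.
by case: c => [[[o|p]|ai]|bo]; rewrite ?ffunE ?linearP ?linearP ?scaler0 ?addr0.
Qed.

Let TM x : x \in M_out M i -> T x \in M_out Mt i.
Proof.
move=> /mem_M_outP [H1 H0]; apply/mem_M_out_Mt; split=> [[[[o|p]|ai]|bo]|[[[o|p]|ai]|bo]] Hc;
  rewrite ffunE ?mem0v //.
- by apply: (theta_mem pr); [exact: old_ahd | exact: H1].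
- apply: (theta_mem pr); last exact: arr_mem.
  by have [bo [ai [_ Hb _]]] := comp_components p; rewrite /= -Hb; exact: ahd_out_neq.
- by rewrite H0 ?linear0.
- by rewrite H0 ?linear0 // linear0.
Qed.

Let Tconn x y : x \in M_out M i -> (forall s, coef y (k, s) = 0) ->
  conn i (T x) (bracket H2 y) = theta (conn i x y).
Proof.
move=> Hx Hy; apply: conn_bracket => //; first exact: TM.
  by move=> o; rewrite ffunE.
by move=> bo ai; rewrite ffunE.
Qed.

Let Tker x : x \in M_out M i -> (forall c, T x c = 0) ->
  forall a, ahd a = i -> conn i x (cder a S) = 0.
Proof.
(* No arrow leads from [k] to [i], so the words of this derivative start away from [k] and [Tconn]
   applies. *)
move=> Hx T0 a Ha; have Hak : atl a != k.
  by apply/eqP=> /Hout; rewrite Ha eqxx.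
apply: (theta_inj (pr := pr) Hak); first by apply: vsp_conn; exact: vtx_cder.
rewrite -Tconn //; last by move=> s; exact: cder_off.
by rewrite /conn big1 // => c _; rewrite T0 linear0.
Qed.

(** For fixed [a], the relation of a* forces the components at the arrows [ba] into the kernel of
    the mutated alpha, which is im(beta). They come from a vector of M(k), determined up to
    [ker_beta M], once for each arrow [a] from [i] to [k]. *)
Lemma ker_gamma_no_out : \dim (ker_gamma M i) =
  (\dim (ker_gamma Mt i) + \sum_(a : X | (ahd a == k) && (atl a == i)) \dim (ker_beta M k))%N.
Proof.
rewrite addnC -(dim_fsum _ (fun=> ker_beta M k)).
have TE := linfunE linT.
apply: (dim_exact (f := linfun T)).
- move=> x /mem_ker_gamma_S [Hx HJ]; rewrite TE.
  apply/mem_ker_gamma_Mt => //; split; first exact: TM.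
  + move=> o Ho; rewrite Tconn ?HJ ?linear0 // => s; apply: cder_off; exact: old_atl.
  + by move=> bo ai Hb; have := Hout (eqP (valP bo)); rewrite Hb eqxx.
  + move=> ai Ha; rewrite -[RHS](@phi_out_beta (x (val ai))); last first.
      have /mem_M_outP [H1 _] := Hx; have := H1 _ Ha; by rewrite (eqP (valP ai)).
    by apply: eq_bigr => bo _; rewrite ffunE beta_ffun // (eqP (valP bo)).
- move=> xt /mem_ker_gamma_Mt => /(_ Hi) [Hxt Ho _ Hs].
  have /mem_M_out_Mt [Hxt1 Hxt0] := Hxt.
  have ex c : exists m : space M, [/\ atl c != i -> m = 0,
      forall o : oldT, val o = c -> atl c = i -> m \in vsp M (ahd c) /\ theta m = xt (old_arrow H2 o) &
      forall ai : inT, val ai = c -> atl c = i -> m \in vsp M k /\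
        forall bo : outT, theta (act M (arr K (val bo)) m) = xt (mut_comp H2 bo ai)].
    have [Hci|Hci] := eqVneq (atl c) i; last by exists 0; split=> // o _ /eqP; rewrite (negbTE Hci).
    have [Hck|Hck] := eqVneq (ahd c) k.
      pose ai : inT := exist _ c (introT eqP Hck).
      have exb b : exists m : space M, forall bo : outT, val bo = b ->
          m \in vsp M (ahd b) /\ theta m = xt (mut_comp H2 bo ai).
        have [Hb|Hb] := boolP (atl b == k);
          last by exists 0 => bo Ebo; move: (valP bo); rewrite Ebo (negbTE Hb).
        pose bo : outT := exist _ b Hb.
        have [m Hm Em] := theta_surj pr (ahd_out_neq bo) (Hxt1 (mut_comp H2 bo ai) Hci).
        by exists m => bo' Ebo; rewrite (_ : bo' = bo) //; apply: val_inj.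
      have [z Hz] := fin_all_exists exb.
      pose z' : {ffun X -> space M} := [ffun b => if atl b == k then z b else 0].
      have Hz' : z' \in M_out M k.
        apply/mem_M_outP ; split=> b Hb; rewrite ffunE ?Hb ?eqxx ?(negbTE Hb) //.
        by have [] := Hz b (exist _ b (introT eqP Hb)) erefl.
      have : phi_out pr z' == 0.
        apply/eqP; rewrite -[RHS](Hs ai Hci); apply: eq_bigr => bo _.
        by rewrite ffunE (valP bo); have [_ ->] := Hz _ bo erefl.
      rewrite (phi_out_eq0 pr Hz') => /memv_imgP [m Hm Em].
      exists m; split=> [|o Eo _|ai' Eai _]; first by [] .
        by move: (old_ahd o); rewrite Eo Hck eqxx.
      split=> // bo; rewrite (_ : ai' = ai); last exact: val_inj.
      have [_ <-] := Hz _ bo erefl; congr (theta _).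
      have := congr1 (fun f : {ffun X -> space M} => f (val bo)) Em.
      by rewrite beta_ffun ?(eqP (valP bo)) // ffunE (valP bo) => <-.
    have Hck' : atl c != k by rewrite Hci.
    pose o : oldT := exist _ c (introT andP (conj Hck Hck')).
    have [m Hm Em] := theta_surj pr Hck (Hxt1 (old_arrow H2 o) Hci).
    exists m; split=> [|o' Eo _|ai' Eai _]; first by [] .
      by rewrite (_ : o' = o) //; exact: val_inj.
    by move: (valP ai'); rewrite Eai (negbTE Hck).
  have [g Hg] := fin_all_exists ex.
  pose x := finfun g.
  have Hx : x \in M_out M i.
    apply/mem_M_outP; split=> c Hc; rewrite ffunE; have [H0 H1 H3] := Hg c; last exact: H0.
    have [Hck|Hck] := eqVneq (ahd c) k.
      by rewrite Hck; have [] := H3 (exist _ c (introT eqP Hck)) erefl Hc.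
    have Hck' : atl c != k by rewrite Hc.
    by have [] := H1 (exist _ c (introT andP (conj Hck Hck'))) erefl Hc.
  have ETx : T x = xt.
    apply/ffunP=> c; rewrite ffunE; case: c => [[[o|p]|ai]|bo].
    - rewrite ffunE; have [H0 H1 _] := Hg (val o).
      have [Hc|Hc] := eqVneq (atl (val o)) i; first by have [] := H1 o erefl Hc.
      by rewrite H0 // linear0 Hxt0.
    - have [bo [ai [Ep Hb Ha]]] := comp_components p; rewrite -Hb -Ha [inl _]Ep ffunE.
      have [H0 _ H3] := Hg (val ai).
      have [Hc|Hc] := eqVneq (atl (val ai)) i; first by have [_ ->] := H3 ai erefl Hc.
      by rewrite H0 // !linear0 Hxt0.
    - by rewrite Hxt0 //= eq_sym.
    - by rewrite Hxt0 //=; apply: Hout; exact: eqP (valP bo).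
  exists x; last by rewrite TE.
  apply/mem_ker_gamma_S; split=> // a Ha.
  have Hak : atl a != k by apply/eqP=> /Hout; rewrite Ha eqxx.
  have Hah : ahd a != k by rewrite Ha.
  pose o : oldT := exist _ a (introT andP (conj Hah Hak)).
  apply: (theta_inj (pr := pr) Hak); first by apply: vsp_conn; exact: vtx_cder.
  rewrite -Tconn // ?ETx; last by move=> s; exact: cder_off.
  exact: (Ho o).
- move=> x; rewrite TE; apply/mem_fsum/andP => [H|[/mem_ker_gamma_S [Hx _] /eqP T0] a].
    have Hx : x \in M_out M i.
      apply/mem_M_outP; split=> c Hc; have := H c; rewrite ?Hc ?eqxx ?andbT ?(negbTE Hc) ?andbF.
        case: ifPn => [/eqP Hk|_ /eqP ->]; last by rewrite mem0v.
        by rewrite Hk => /mem_ker_beta [].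
      by move/eqP.
    have T0 c : T x c = 0.
      rewrite ffunE; case: c => [[[o|p]|ai]|bo] //.
        by have := H (val o); rewrite (negbTE (old_ahd o)) => /eqP ->; rewrite linear0.
      have := H (val p).2; case: ifP => [_ /mem_ker_beta [_ E0]|_ /eqP E0].
        by rewrite E0 linear0.
      by rewrite E0 !linear0.
    split; last by apply/eqP/ffunP=> c; rewrite T0 [RHS]ffunE.
    by apply/mem_ker_gamma_S; split=> //; exact: Tker.
  have {}T0 c : T x c = 0 by rewrite T0 [LHS]ffunE.
  have /mem_M_outP [Hx1 Hx0] := Hx.
  have [Hai|Hai] := eqVneq (atl a) i; last by rewrite andbF Hx0.
  rewrite andbT; case: ifPn => Hak; last first.
    have Hak' : atl a != k by rewrite Hai.
    have := T0 (old_arrow H2 (exist _ a (introT andP (conj Hak Hak')))); rewrite ffunE /=.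
    by move=> /(theta_inj (pr := pr) Hak (Hx1 a Hai)) ->.
  have Hxa := Hx1 a Hai; rewrite (eqP Hak) in Hxa.
  apply/mem_ker_beta; split=> // b.
  have [Hb|Hb] := boolP (atl b == k); last by apply: arr_act0 Hxa _; rewrite eq_sym.
  have := T0 (mut_comp H2 (exist _ b Hb) (exist _ a Hak)); rewrite ffunE /=.
  apply: (theta_inj (pr := pr) (ahd_out_neq (exist _ b Hb))); exact: arr_mem.
Qed.

End NoOut.

End PremutGamma.

Section PremutGamma2.
Variables (K : fieldType) (n : nat) (X : qp K n) (k : 'I_n) (D : qp_mutation X k).
Variables (M : qprep X) (Mt : qprep (qm_pre D)) (pr : premut_rep M Mt).
Local Notation H2 := (qm_no2cyc D).
Local Notation Qt := (mut_quiver H2).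
Local Notation S := (qm_pot D).
Local Notation HS := (qm_potP D).
Local Notation HSk := (qm_start D).
Local Notation theta := (pr_theta pr).
Local Notation inT := {a : X | ahd a == k}.
Local Notation outT := {b : X | atl b == k}.
Local Notation oldT := {c : X | (ahd c != k) && (atl c != k)}.
Local Notation compT := {p : X * X | (atl p.1 == k) && (ahd p.2 == k)}.
Implicit Types (i j : 'I_n) (x : {ffun X -> space M}) (m : space M)
  (xt : {ffun Qt -> space Mt}).

Let HM : nilpotent M := rep_nilpotent M.
Let HMt : nilpotent Mt := rep_nilpotent Mt.


(** The spaces M(j) with [j] other than [k] have independent images under [theta], so one linear map
    inverts it on all of them at once. *)
Lemma theta_retraction : exists g : 'Hom(space Mt, space M),
  forall j m, j != k -> m \in vsp M j -> g (theta m) = m.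
Proof.
pose off : 'End(space M) := (\1 - act M (vtx K X k))%VF.
have offE m : off m = m - act M (vtx K X k) m.
  by rewrite /off add_lfunE opp_lfunE id_lfunE.
have off_id j m : j != k -> m \in vsp M j -> off m = m.
  by move=> Hj Hm; rewrite offE (vsp_act0 Hm Hj) subr0.
have offk m : act M (vtx K X k) (off m) = 0.
  by rewrite offE linearB /= -actME vtxM eqxx subrr.
have th_inj m : act M (vtx K X k) m = 0 -> theta m = 0 -> m = 0.
  move=> Hk H0; rewrite (act_vtx_sum m) big1 // => j _.
  have [->//|Hj] := eqVneq j k.
  apply: (theta_inj (pr := pr) Hj); first exact: act_vtx_mem.
  have := congr1 (act Mt (vtx K _ j)) H0; rewrite linear0 [m in theta m]act_vtx_sum !linear_sum.
  rewrite (bigD1 j) //= big1 ?addr0 => [|l Hl].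
    by rewrite (vsp_act (theta_mem pr Hj (act_vtx_mem _ _))).
  have [->|Hlk] := eqVneq l k; first by rewrite Hk !linear0.
  by rewrite (vsp_act0 (theta_mem pr Hlk (act_vtx_mem _ _))).
exists (off \o (theta \o off)^-1)%VF => j m Hj Hm; rewrite comp_lfunE.
have Em : theta m = (theta \o off)%VF m by rewrite comp_lfunE (off_id j).
set y := (_^-1)%VF _.
have Ey : (theta \o off)%VF y = theta m.
  by rewrite /y Em; apply: limg_lfunVK; rewrite memv_img ?memvf.
apply/eqP; rewrite -subr_eq0 -{1}(off_id j m Hj Hm) -linearB /=; apply/eqP/th_inj.
  exact: offk.
by move: Ey; rewrite Em !comp_lfunE => Ey; rewrite linearB linearB /= Ey subrr.
Qed.

Section NoIn.
Variable i : 'I_n.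
Hypothesis Hi : i != k.
Hypothesis Hin : forall a : X, ahd a = k -> atl a != i.

(** Every arrow of [X] leaving [i] is old. The relations of the [ba] prescribe the image under the
    mutated beta of the component at b*. They are solvable exactly when the prescribed family lies
    in ker(alpha), which is the relation of [b]; the solution is unique up to [ker_beta Mt]. *)
Lemma ker_gamma_no_in : \dim (ker_gamma Mt i) =
  (\dim (ker_gamma M i) + \sum_(b : X | (atl b == k) && (ahd b == i)) \dim (ker_beta Mt k))%N.
Proof.
have [g Hg] := theta_retraction.
pose T xt : {ffun X -> space M} :=
  [ffun c => if insub c is Some o then g (xt (old_arrow H2 o)) else 0].
have linT : linear T.
  move=> z x y; apply/ffunP=> c; rewrite !ffunE.
  by case: insub => [o|]; rewrite ?ffunE ?linearP ?scaler0 ?addr0.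
have TE := linfunE linT.
have ToldE xt (o : oldT) : T xt (val o) = g (xt (old_arrow H2 o)) by rewrite ffunE valK.
have old_of (c : X) : atl c = i -> exists o : oldT, val o = c.
  move=> Hc; have Hh : ahd c != k by apply/eqP=> /Hin; rewrite Hc eqxx.
  have Ht : atl c != k by rewrite Hc.
  by exists (exist _ c (introT andP (conj Hh Ht))).
have Tcases xt c : (exists2 o : oldT, val o = c & T xt c = g (xt (old_arrow H2 o))) \/ T xt c = 0.
  rewrite ffunE; case: insubP => [o _ Eo|_]; last by right.
  by left; exists o.
have Tth xt (o : oldT) : xt \in M_out Mt i ->
    xt (old_arrow H2 o) = theta (T xt (val o)) /\ T xt (val o) \in vsp M (ahd (val o)).
  move=> /mem_M_out_Mt [H1 H0]; rewrite ToldE.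
  have [Ho|Ho] := eqVneq (atl (val o)) i; last by rewrite H0 // !linear0 mem0v.
  have [m Hm <-] := theta_surj pr (old_ahd o) (H1 (old_arrow H2 o) Ho).
  by rewrite (Hg _ _ (old_ahd o) Hm).
have TM xt : xt \in M_out Mt i -> T xt \in M_out M i.
  move=> Hxt; have /mem_M_out_Mt [H1 H0] := Hxt.
  apply/mem_M_outP; split=> c Hc.
    by have [o Eo] := old_of c Hc; rewrite -Eo; case: (Tth xt o Hxt).
  have [[o Eo ->]|//] := Tcases xt c; rewrite H0 ?linear0 //.
  by rewrite /= Eo.
have no_comp (ai : inT) : atl (val ai) != i by apply: Hin; exact: eqP (valP ai).
have Tconn xt y : xt \in M_out Mt i -> (forall s, coef y (k, s) = 0) ->
    conn i xt (bracket H2 y) = theta (conn i (T xt) y).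
  move=> Hxt Hy; have /mem_M_out_Mt [_ H0] := Hxt.
  have /mem_M_outP [_ HT0] := TM _ Hxt.
  apply: (conn_bracket Hi (TM _ Hxt) Hxt _ _ Hy) => [o|bo ai].
    by case: (Tth xt o Hxt).
  by rewrite H0 ?HT0 ?linear0 ?linear0 //; exact: no_comp.
pose P (c : Qt) := if c is inr bo then ahd (val bo) == i else false.
have -> : (\sum_(b : X | (atl b == k) && (ahd b == i)) \dim (ker_beta Mt k) =
    \sum_(c : Qt | P c) \dim (ker_beta Mt k))%N.
  rewrite [RHS]big_mkcond big_sumType /= [X in (_ = X + _)%N]big1 ?add0n; last first.
    by move=> [[o|p]|ai].
  rewrite (sum_sig (fun b : X => atl b == k)
    (fun b => if ahd b == i then \dim (ker_beta Mt k) else 0%N)).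
  by rewrite big_mkcondr.
rewrite addnC -(dim_fsum P (fun=> ker_beta Mt k)).
apply: (dim_exact (f := linfun T)).
- move=> xt /mem_ker_gamma_Mt => /(_ Hi) [Hxt Ho Hc _]; rewrite TE.
  apply/(mem_ker_gamma_S D); split=> [|d Hd]; first exact: TM.
  have [Hdk|Hdk] := eqVneq (atl d) k; last first.
    have Hdh : ahd d != k by rewrite Hd.
    pose o : oldT := exist _ d (introT andP (conj Hdh Hdk)).
    apply: (theta_inj (pr := pr) Hdk); first by apply: vsp_conn; exact: vtx_cder.
    by rewrite -Tconn // => [|s]; [exact: (Ho o) | exact: cder_off].
  pose bo : outT := exist _ d (introT eqP Hdk).
  have /mem_M_out_Mt [H1 _] := Hxt.
  have [z Hz Ez] := star_in_ker_alpha pr (H1 (star_out H2 bo) Hd).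
  have L := conn_linear i (T xt).
  have /mem_M_outP [_ HT0] := TM _ Hxt.
  have Hza : alpha M k z = 0 by move: Hz; rewrite /ker_alpha memv_cap memv_ker => /andP[_ /eqP].
  have /mem_M_in HzM : z \in M_in M k by move: Hz; rewrite /ker_alpha memv_cap => /andP[].
  transitivity (- alpha M k z); last by rewrite Hza oppr0.
  (* [cder_out] turns the relation of [b] into the vanishing of [alpha] on that family. *)
  rewrite (cder_out HS HSk Hdk) (lin_fun_sum L) alphaE -sumrN.
  apply: eq_bigr => a Ha; pose ai : inT := exist _ a Ha.
  rewrite (connM i (T xt) HM) (conn_arrow (TM _ Hxt)) HT0 ?scaler0 ?addr0; last exact: (no_comp ai).
  rewrite -linearN; congr (act M _ _); apply: (theta_inj2 (pr := pr) (atl_in_neq ai)).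
  + by apply: vsp_conn; exact: vtx_dder0.
  + by rewrite memvN; have := HzM a; rewrite Ha.
  rewrite -Tconn // => [|s]; last by apply: dder0_off; exact: (atl_in_neq ai).
  by rewrite linearN /= -(Ez ai); apply/eqP; rewrite -addr_eq0; apply/eqP; exact: (Hc bo ai).
- move=> x /(mem_ker_gamma_S D) [Hx HJ]; have /mem_M_outP [Hx1 Hx0] := Hx.
  have ex (bo : outT) : exists y : space Mt, ahd (val bo) = i -> y \in vsp Mt k /\
      forall ai : inT, act Mt (arr K (star_in H2 ai)) y =
        - theta (conn i x (dder0 (val bo) (val ai) S)).
    have [Hb|Hb] := eqVneq (ahd (val bo)) i; last by exists 0 => E; rewrite E eqxx in Hb.
    pose z : {ffun X -> space M} :=
      [ffun a => if ahd a == k then - conn i x (dder0 (val bo) a S) else 0].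
    have Hz : z \in ker_alpha M k.
      rewrite /ker_alpha memv_cap; apply/andP; split.
        apply/mem_M_in => a; rewrite !ffunE; case: (ahd a == k) => //; rewrite memvN.
        by apply: vsp_conn; exact: vtx_dder0.
      have L := conn_linear i x.
      rewrite memv_ker alphaE -oppr_eq0 -sumrN; apply/eqP; rewrite -[RHS](HJ _ Hb).
      rewrite (cder_out HS HSk (eqP (valP bo))) (lin_fun_sum L); apply: eq_bigr => a Ha.
      rewrite ffunE Ha linearN opprK (connM i x HM) (conn_arrow Hx) Hx0 ?scaler0 ?addr0 //.
      exact: (no_comp (exist _ a Ha)).
    have [y Hy Ey] := ker_alpha_star_in pr Hz.
    exists y => _; split=> // ai; rewrite Ey ffunE (valP ai).
    exact: linearN.
  have [y Hy] := fin_all_exists ex.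
  pose xt : {ffun Qt -> space Mt} := [ffun c : Qt =>
    match c return space Mt with
    | inl (inl (inl o)) => theta (x (val o))
    | inr bo => if ahd (val bo) == i then y bo else 0
    | _ => 0
    end].
  have Hxo (o : oldT) : x (val o) \in vsp M (ahd (val o)).
    by have [/Hx1 //|/Hx0 ->] := eqVneq (atl (val o)) i; rewrite mem0v.
  have Hxt : xt \in M_out Mt i.
    apply/mem_M_out_Mt; split=> [[[[o|p]|ai]|bo]|[[[o|p]|ai]|bo]] Hc; rewrite ffunE ?mem0v //.
    - by apply: (theta_mem pr) => //; exact: old_ahd.
    - by rewrite /= in Hc; rewrite Hc eqxx; have [] := Hy bo Hc.
    - by rewrite Hx0 ?linear0.
    - by rewrite /= in Hc; rewrite (negbTE Hc).
  have ETx : T xt = x.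
    apply/ffunP=> c; have [Hc|Hc] := eqVneq (atl c) i.
      have [o Eo] := old_of c Hc; rewrite -Eo ToldE ffunE.
      exact: Hg (old_ahd o) (Hxo o).
    rewrite (Hx0 c Hc); have [[o Eo ->]|//] := Tcases xt c.
    by rewrite ffunE /= Eo Hx0 // !linear0.
  exists xt; last by rewrite TE.
  apply/mem_ker_gamma_Mt => //; split=> //.
  + move=> o Ho; rewrite Tconn // ?ETx ?HJ ?linear0 // => s.
    by apply: cder_off; exact: old_atl.
  + move=> bo ai Hb; rewrite Tconn // ?ETx => [|s]; last first.
      by apply: dder0_off; exact: atl_in_neq.
    by rewrite [xt (star_out H2 bo)]ffunE /= Hb eqxx; have [_ ->] := Hy bo Hb; rewrite subrr.
  + by move=> ai Ha; have := no_comp ai; rewrite Ha eqxx.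
- move=> xt; rewrite TE; apply/mem_fsum/andP => [H|[Hker /eqP T0] c].
    have T0 : T xt = 0.
      apply/ffunP=> c; rewrite [RHS]ffunE; have [[o Eo ->]|//] := Tcases xt c.
      by have := H (old_arrow H2 o) => /eqP ->; rewrite linear0.
    have Hxt : xt \in M_out Mt i.
      apply/mem_M_out_Mt; split=> [[[[o|p]|ai]|bo]|[[[o|p]|ai]|bo]] Hc;
        try by (have := H (inl (inl (inl o))) => /eqP ->; rewrite ?mem0v).
      - by have := H (inl (inl (inr p))) => /eqP ->; rewrite mem0v.
      - by have := H (inl (inr ai)) => /eqP ->; rewrite mem0v.
      - have := H (inr bo); rewrite /P; case: ifP => [_ /mem_ker_beta []//|_ /eqP ->].
        exact: mem0v.
      - by have := H (inl (inl (inr p))) => /eqP ->.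
      - by have := H (inl (inr ai)) => /eqP ->.
      - by have := H (inr bo); rewrite /P; rewrite /= in Hc; rewrite (negbTE Hc) => /eqP ->.
    have C0 y : conn i (T xt) y = 0.
      by rewrite T0 /conn big1 // => c _; rewrite ffunE linear0.
    split; last by rewrite T0.
    apply/mem_ker_gamma_Mt => //; split=> //.
    + move=> o _; rewrite Tconn // ?C0 ?linear0 // => s.
      by apply: cder_off; exact: old_atl.
    + move=> bo ai Hb; rewrite Tconn // ?C0 ?linear0 ?add0r => [|s]; last first.
        by apply: dder0_off; exact: atl_in_neq.
      by have := H (inr bo); rewrite /P Hb eqxx => /mem_ker_beta [_]; apply.
    + by move=> ai Ha; have := no_comp ai; rewrite Ha eqxx.
  move: Hker => /mem_ker_gamma_Mt => /(_ Hi) [Hxt _ Hc _].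
  have C0 y : conn i (T xt) y = 0.
    by rewrite T0 /conn big1 // => c' _; rewrite ffunE linear0.
  have /mem_M_out_Mt [H1 H0] := Hxt.
  case: c => [[[o|p]|ai]|bo]; rewrite /P.
  + by have [-> _] := Tth xt o Hxt; rewrite T0 ffunE linear0 eqxx.
  + have [bo [ai [Ep _ _]]] := comp_components D p.
    by rewrite [inl (inl (inr p))]Ep H0 //; exact: no_comp.
  + by rewrite H0 //= eq_sym.
  case: ifPn => [/eqP Hb|Hb]; last by rewrite H0.
  apply: mem_ker_beta_Mt => [|ai]; first exact: (H1 (star_out H2 bo) Hb).
  have := Hc bo ai Hb; rewrite Tconn // ?C0 ?linear0 ?add0r // => s.
  by apply: dder0_off; exact: atl_in_neq.
Qed.

End NoIn.

Lemma beta_eq0 m : beta M k m = 0 <-> forall bo : outT, act M (arr K (val bo)) m = 0.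
Proof.
split=> [H bo|H].
  have := congr1 (fun f : {ffun X -> space M} => f (val bo)) H.
  by rewrite betaE !ffunE (valP bo).
apply/ffunP=> b; rewrite betaE !ffunE; case: ifPn => // Hb.
exact: (H (exist _ b Hb)).
Qed.

(* On M_in(k) = M_out(k) of the mutation, the map gamma is the composite beta alpha. *)
Lemma ker_gamma_k : \dim (ker_gamma Mt k) =
  (\dim (ker_alpha M k) + \dim (ker_beta M k :&: im_alpha M k))%N.
Proof.
(* [alpha] maps [Z] onto the intersection of ker(beta) and im(alpha), with kernel ker(alpha). *)
pose Z := (M_in M k :&: lker (beta M k \o alpha M k))%VS.
have memZ z : reflect (z \in M_in M k /\ beta M k (alpha M k z) = 0) (z \in Z).
  rewrite /Z memv_cap memv_ker comp_lfunE.
  by apply: (iffP andP) => -[Hz /eqP H]; split.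
have -> : (\dim (ker_alpha M k) + \dim (ker_beta M k :&: im_alpha M k))%N = \dim Z.
  symmetry; apply: (dim_exact (f := alpha M k)).
  - move=> z /memZ [Hz H]; rewrite memv_cap [in X in _ && X]memv_img // andbT.
    rewrite /ker_beta memv_cap memv_ker H eqxx andbT alphaE.
    apply: memv_suml => a /eqP Ha; rewrite -Ha; exact: arr_mem.
  - move=> y; rewrite memv_cap => /andP[Hb /memv_imgP [z Hz Ey]].
    exists z => //; apply/memZ; split=> //.
    by move: Hb; rewrite /ker_beta memv_cap memv_ker -Ey => /andP[_ /eqP].
  - move=> z; rewrite /ker_alpha memv_cap memv_ker.
    apply/andP/andP => -[H1 H2]; split=> //.
      by apply/memZ; rewrite (eqP H2) linear0.
    by have [] := memZ z H1.
symmetry.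
(* Places a family of M_in(k) on the arrows a*, the only arrows leaving [k] after mutation. *)
pose T (z : {ffun X -> space M}) : {ffun Qt -> space Mt} := [ffun c : Qt =>
  if c is inl (inr ai) return space Mt then theta (z (val ai)) else 0].
have linT : linear T.
  move=> c x y; apply/ffunP=> d; rewrite !ffunE.
  by case: d => [[[o|p]|ai]|bo]; rewrite ?ffunE ?linearP ?scaler0 ?addr0.
have TE := linfunE linT.
have atl_k (c : Qt) : atl c = k -> exists ai : inT, c = star_in H2 ai.
  case: c => [[[o|p]|ai]|bo] Hc; last first.
  - by have := ahd_out_neq bo; rewrite [ahd _]Hc eqxx.
  - by exists ai.
  - have [bo [ai [Ep _ _]]] := comp_components D p.
    by have := atl_in_neq ai; rewrite -[atl _]/(atl (mut_comp H2 bo ai)) -Ep [atl _]Hc eqxx.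
  - by have := old_atl o; rewrite [atl _]Hc eqxx.
have TM z : z \in M_in M k -> T z \in M_out Mt k.
  move=> /mem_M_in Hz; apply/mem_M_out_Mt; split=> c Hc.
    have [ai ->] := atl_k c Hc; rewrite ffunE; apply: (theta_mem pr (atl_in_neq ai)).
    by have := Hz (val ai); rewrite (valP ai).
  by rewrite ffunE; case: c Hc => [[[o|p]|ai]|bo] //=; rewrite eqxx.
have Tconn z bo : z \in M_in M k ->
    conn k (T z) (cder (star_out H2 bo) (pot (qm_pre D))) =
    theta (act M (arr K (val bo)) (alpha M k z)).
  move=> Hz; have L := conn_linear k (T z).
  rewrite [cder _ _](cder_mut_star_out H2 S bo) (lin_fun_sum L) alphaE !linear_sum.
  rewrite -(sum_sig (fun a : X => ahd a == k)
    (fun a => theta (act M (arr K (val bo)) (act M (arr K a) (z a))))).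
  apply: eq_bigr => ai _; rewrite (conn_MM _ _ (TM z Hz)) ffunE /=.
  apply: (pr_comp pr); have /mem_M_in /(_ (val ai)) := Hz.
  by rewrite (valP ai).
transitivity (\dim (0%VS : {vspace {ffun X -> space M}}) + \dim (ker_gamma Mt k))%N;
  last by rewrite dimv0.
apply: (dim_exact (f := linfun T)).
- move=> z /memZ [Hz /beta_eq0 Hb]; rewrite TE; apply/mem_ker_gamma; split; first exact: TM.
  move=> d; have [Hd|Hd] := eqVneq (ahd d) k; last first.
    by apply: (conn_cder0 (T z) HMt _ Hd); exact: (@potP _ _ (qm_pre D)).
  case: d Hd => [[[o|p]|ai]|bo] Hd.
  + by have := old_ahd o; rewrite [ahd _]Hd eqxx.
  + have [bo [ai [Ep _ _]]] := comp_components D p.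
    by have := ahd_out_neq bo; rewrite -[ahd _]/(ahd (mut_comp H2 bo ai)) -Ep [ahd _]Hd eqxx.
  + by have := atl_in_neq ai; rewrite [atl _]Hd eqxx.
  + by rewrite [LHS](Tconn z bo Hz) Hb linear0.
- move=> xt /mem_ker_gamma [Hxt HJ]; have /mem_M_out_Mt [H1 H0] := Hxt.
  have ex (a : X) : exists m : space M, (ahd a != k -> m = 0) /\
      forall ai : inT, val ai = a -> m \in vsp M (atl a) /\ theta m = xt (star_in H2 ai).
    have [Ha|Ha] := boolP (ahd a == k); last first.
      by exists 0; split=> // ai Eai; move: (valP ai); rewrite Eai (negbTE Ha).
    pose ai : inT := exist _ a Ha.
    have [m Hm Em] := theta_surj pr (atl_in_neq ai) (H1 (star_in H2 ai) erefl).
    exists m; split=> // ai' Eai; rewrite (_ : ai' = ai) //; exact: val_inj.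
  have [g Hg] := fin_all_exists ex.
  pose z := finfun g.
  have Hz : z \in M_in M k.
    apply/mem_M_in => a; rewrite ffunE; have [G0 G1] := Hg a.
    case: ifPn => Ha; last by rewrite G0.
    by have [] := G1 (exist _ a Ha) erefl.
  have ETz : T z = xt.
    apply/ffunP=> c; have [Hc|Hc] := eqVneq (atl c) k.
      by have [ai ->] := atl_k c Hc; rewrite ffunE /= ffunE; have [_ /(_ ai erefl) [_ ->]] :=
        Hg (val ai).
    rewrite H0 // ffunE; by case: c Hc => [[[o|p]|ai]|bo] //=; rewrite eqxx.
  exists z; last by rewrite TE.
  apply/memZ; split=> //; apply/beta_eq0 => bo.
  apply: (theta_inj (pr := pr) (ahd_out_neq bo)); first exact: arr_mem.
  by rewrite -Tconn // ETz; exact: HJ.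
- move=> z; rewrite memv0 TE; apply/eqP/andP => [->|[/memZ [/mem_M_in Hz _] /eqP T0]].
    by rewrite mem0v (lin_fun0 linT).
  apply/ffunP=> a; have := Hz a; rewrite [RHS]ffunE; case: ifPn => [Ha Hm|_ /eqP //].
  apply: (theta_inj (pr := pr) (atl_in_neq (exist _ a Ha)) Hm).
  have := congr1 (fun f : {ffun Qt -> space Mt} => f (star_in H2 (exist _ a Ha))) T0.
  by rewrite !ffunE.
Qed.

End PremutGamma2.

(** * Homomorphisms up to their component at a vertex *)

Section LinearAlgebra.
Variable K : fieldType.

(** On the image of [p] the values are forced by [u]; on a complement, any lift of [w] through [q]
    will do. *)
Lemma fill_square (P V V' W : vectType K) (p : 'Hom(P, V)) (u : 'Hom(P, V'))
    (q : 'Hom(V', W)) (w : 'Hom(V, W)) :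
    (forall z, p z = 0 -> u z = 0) -> (forall x, w x \in limg q) ->
    (forall z, q (u z) = w (p z)) ->
  exists f : 'Hom(V, V'), (forall z, f (p z) = u z) /\ (forall x, q (f x) = w x).
Proof.
move=> H1 H2 H3; pose pi := projv (limg p).
exists ((u \o p^-1 \o pi) + (q^-1 \o w \o (\1 - pi)))%VF.
have pK y : y \in limg p -> p (p^-1%VF y) = y by move=> Hy; exact: limg_lfunVK.
have qK x : q (q^-1%VF (w x)) = w x by exact: limg_lfunVK.
split=> [z|x]; rewrite add_lfunE !comp_lfunE add_lfunE opp_lfunE id_lfunE.
  have Hz : p z \in limg p by rewrite memv_img ?memvf.
  rewrite /pi projv_id // subrr linear0 linear0 addr0; apply/eqP.
  by rewrite -subr_eq0 -linearB /= H1 // linearB /= pK // subrr.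
rewrite linearD /= qK H3 pK ?memv_proj // linearB /=.
by rewrite addrC subrK.
Qed.

(** This space is Hom(V/U, W'), with a complement of [U] in place of the quotient. *)
Lemma dim_hom_between (V W : vectType K) (U : {vspace V}) (W' : {vspace W})
    (H : {vspace 'Hom(V, W)}) :
    (forall f, f \in H <-> (forall x, x \in U -> f x = 0) /\ (forall x, f x \in W')) ->
  \dim H = ((\dim {:V} - \dim U) * \dim W')%N.
Proof.
move=> memH; pose G (f : 'Hom(V, W)) : 'Hom(subvs_of (U^C)%VS, subvs_of W') :=
  (linfun (vsproj W') \o f \o linfun (@vsval _ _ (U^C)%VS))%VF.
have GE f x : G f x = vsproj W' (f (vsval x)) by rewrite !comp_lfunE !lfunE.
have linG : linear G.
  move=> c f g; apply/lfunP=> x; rewrite add_lfunE scale_lfunE !GE.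
  by rewrite add_lfunE scale_lfunE linearP.
have -> : ((\dim {:V} - \dim U) * \dim W')%N =
    \dim {:'Hom(subvs_of (U^C)%VS, subvs_of W')}.
  by rewrite -dimv_compl !dimvf.
have capU : (U^C :&: U = 0)%VS by rewrite capvC capv_compl.
have decU x : daddv_pi (U^C)%VS U x + daddv_pi U (U^C)%VS x = x.
  by apply: daddv_pi_add => //; rewrite addvC addv_complf memvf.
have piU x : x \in U -> daddv_pi (U^C)%VS U x = 0.
  move=> Hx; have := decU x; rewrite [X in _ + X]daddv_pi_id ?capv_compl // => E.
  by apply: (addIr x); rewrite E add0r.
rewrite (dim_exact (f := linfun G) (U0 := 0%VS) (U' := fullv)) ?dimv0 //.
- by move=> f _; exact: memvf.
- move=> h _.
  pose f := (linfun (@vsval _ _ W') \o h \o linfun (vsproj (U^C)%VS) \o daddv_pi (U^C)%VS U)%VF.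
  have fE x : f x = vsval (h (vsproj (U^C)%VS (daddv_pi (U^C)%VS U x))).
    by rewrite !comp_lfunE !lfunE.
  exists f.
    apply/memH; split=> x; rewrite fE; last exact: subvsP.
    by move=> /piU ->; rewrite !linear0.
  rewrite (linfunE linG); apply/lfunP=> x; rewrite GE fE vsvalK.
  by rewrite daddv_pi_id ?subvsP // vsvalK.
- move=> f; rewrite memv0 (linfunE linG); apply/eqP/andP => [->|[/memH [fU fW] /eqP G0]].
    by rewrite mem0v (lin_fun0 linG).
  apply/lfunP=> x; rewrite zero_lfunE -(decU x) linearD /= [X in _ + X]fU ?memv_pi // addr0.
  have /lfunP /(_ (vsproj (U^C)%VS (daddv_pi (U^C)%VS U x))) := G0.
  rewrite GE zero_lfunE vsprojK ?memv_pi // => E.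
  by rewrite -[LHS](vsprojK (fW _)) E linear0.
Qed.

Definition ffun_map (I : finType) (V W : vectType K) (f : 'Hom(V, W)) :
    'Hom({ffun I -> V}, {ffun I -> W}) :=
  linfun (fun x : {ffun I -> V} => [ffun i => f (x i)]).

Lemma ffun_mapE (I : finType) (V W : vectType K) (f : 'Hom(V, W)) (x : {ffun I -> V}) i :
  ffun_map I f x i = f (x i).
Proof.
rewrite /ffun_map linfunE ?ffunE // => c y z; apply/ffunP=> j; rewrite !ffunE.
by rewrite linearP.
Qed.

End LinearAlgebra.

(** * Restricting morphisms away from a vertex and extending them back *)

Section ExtendHom.
Variables (K : fieldType) (n : nat) (Y : qp K n) (k : 'I_n).
Implicit Types (M N : qprep Y) (j : 'I_n).

Definition offk M : 'End(space M) := (\1 - act M (vtx K Y k))%VF.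

Lemma offkE M m : offk M m = m - act M (vtx K Y k) m.
Proof. by rewrite /offk add_lfunE opp_lfunE id_lfunE. Qed.

Lemma offk_id M j m : j != k -> m \in vsp M j -> offk M m = m.
Proof. by move=> Hj Hm; rewrite offkE (vsp_act0 Hm Hj) subr0. Qed.

Lemma offk_k M m : m \in vsp M k -> offk M m = 0.
Proof. by move=> Hm; rewrite offkE (vsp_act Hm) subrr. Qed.

Lemma vtx_offk M j m : act M (vtx K Y j) (offk M m) = offk M (act M (vtx K Y j) m).
Proof. by rewrite !offkE linearB /= -!actME !vtxM eq_sym; case: eqP => [->|]. Qed.

Lemma offk_vtx M j m : offk M (act M (vtx K Y j) m) =
  if j == k then 0 else act M (vtx K Y j) m.
Proof.
case: eqP => [->|/eqP Hj]; first by rewrite offk_k ?act_vtx_mem.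
by rewrite (offk_id Hj) ?act_vtx_mem.
Qed.

Section Two.
Variables M N : qprep Y.

Definition restr (f : 'Hom(space M, space N)) := (f \o offk M)%VF.

Lemma restr_linear : linear restr.
Proof. by move=> c f g; rewrite /restr comp_lfunDl -comp_lfunZl. Qed.

Definition restr_Hom_Q : {vspace 'Hom(space M, space N)} := (linfun restr @: Hom_Q M N)%VS.

Lemma mem_restr g : reflect (exists2 f, f \in Hom_Q M N & (f \o offk M)%VF = g)
  (g \in restr_Hom_Q).
Proof.
apply: (iffP memv_imgP) => -[f Hf E]; exists f => //; move: E; rewrite (linfunE restr_linear).
  by move->.
by move<-.
Qed.

Lemma dim_Hom_Q_restr : \dim (Hom_Q M N) =
  ((\dim (vsp M k) - \dim (im_alpha M k)) * \dim (ker_beta N k) + \dim restr_Hom_Q)%N.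
Proof.
rewrite -(limg_ker_dim (linfun restr) (Hom_Q M N)); congr addn.
(* Vanishing on [U] encodes both the support at [k] and the compatibility with the arrows into
   [k]. *)
pose U := (limg (offk M) + im_alpha M k)%VS.
have im_sub : (im_alpha M k <= vsp M k)%VS.
  apply/subvP=> y /memv_imgP [z _ ->]; rewrite alphaE.
  by apply: memv_suml => a /eqP Ha; rewrite -Ha; exact: arr_mem.
have ker_off : lker (offk M) = vsp M k.
  apply/vspaceP=> x; rewrite memv_ker offkE subr_eq0 mem_vsp eq_sym //.
have dimU : (\dim {:space M} - \dim U = \dim (vsp M k) - \dim (im_alpha M k))%N.
  have := limg_ker_dim (offk M) fullv; rewrite capfv ker_off => <-.
  rewrite /U dimv_disjoint_sum; first by rewrite [X in (_ - X)%N]addnC subnDr.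
  apply/eqP; rewrite -subv0; apply/subvP=> x; rewrite memv_cap memv0.
  case/andP=> /memv_imgP [y _ Ex] /(subvP im_sub) /vsp_act <-.
  by rewrite Ex vtx_offk offk_vtx eqxx.
rewrite (@dim_hom_between K _ _ U (ker_beta N k)) ?dimU // => f.
rewrite memv_cap memv_ker (linfunE restr_linear).
split=> [/andP[Hf /eqP /lfunP H0]|[HU HK]].
  have f0 x : f (offk M x) = 0 by have := H0 x; rewrite /restr comp_lfunE zero_lfunE.
  have [Hv Ha] := elimT (mem_Hom_Q f) Hf.
  have fk x : f (act M (vtx K Y k) x) = f x.
    by apply/eqP; rewrite eq_sym -subr_eq0 -linearB /= -offkE f0.
  have fj j x : j != k -> x \in vsp M j -> f x = 0.
    by move=> Hj Hx; rewrite -(offk_id Hj Hx) f0.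
  split=> [x /memv_addP [y /memv_imgP [y' _ ->] [z Hz ->]]|x].
    rewrite linearD /= f0 add0r; have /memv_imgP [z' Hz' ->] := Hz.
    rewrite alphaE linear_sum big1 // => a Hak /=; rewrite Ha.
    have /mem_M_in /(_ a) := Hz'; rewrite Hak => Hza.
    rewrite (fj (atl a)) ?linear0 //; have := noloop a; by rewrite (eqP Hak).
  apply/mem_ker_beta; split; first by rewrite -fk Hv act_vtx_mem.
  move=> b; rewrite -fk -Ha; have [Hb|Hb] := eqVneq (atl b) k.
    by apply: (fj (ahd b)); [rewrite -Hb eq_sym noloop | exact: arr_mem].
  by rewrite (arr_act0 (act_vtx_mem _ _)) ?linear0 // eq_sym.
have foff x : f (offk M x) = 0.
  by apply: HU; rewrite -[offk M x]addr0; apply: memv_add; rewrite ?memv_img ?memvf ?mem0v.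
apply/andP; split; last by apply/eqP/lfunP=> x; rewrite /restr comp_lfunE foff zero_lfunE.
apply/mem_Hom_Q; split=> [j x|a x].
  have /mem_ker_beta [Hfx _] := HK x.
  have [->|Hj] := eqVneq j k.
    rewrite (vsp_act Hfx); apply/eqP; rewrite eq_sym -subr_eq0 -linearB /= -offkE.
    by rewrite foff.
  rewrite (vsp_act0 Hfx) 1?eq_sym // -(offk_id Hj (act_vtx_mem j x)).
  exact: foff.
have /mem_ker_beta [_ ->] := HK x.
have [Ha|Ha] := eqVneq (ahd a) k; last first.
  by rewrite -(offk_id Ha (arr_mem a x)) foff.
apply: HU; rewrite -[act M _ x]add0r; apply: memv_add; rewrite ?mem0v //.
apply/memv_imgP; exists (finj (space M) a (act M (vtx K Y (atl a)) x)).
  apply/mem_M_in => c; rewrite finjE ffunE; case: (c =P a) => [->|_].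
    by rewrite Ha eqxx act_vtx_mem.
  by case: ifP => //; rewrite mem0v.
rewrite alphaE (bigD1 a) ?Ha //= finjE ffunE eqxx arr_act_vtx big1 ?addr0 // => c /andP[_ Hc].
by rewrite ffunE (negbTE Hc) linear0.
Qed.

(** The last three hypotheses are those of [fill_square] at [k]: the missing component [f] has to
    satisfy f alpha = alpha F and beta f = F beta. *)
Lemma extend_hom (F : 'Hom(space M, space N)) :
    (forall j m, F (act M (vtx K Y j) m) = act N (vtx K Y j) (F m)) ->
    (forall m, F (act M (vtx K Y k) m) = 0) ->
    (forall c m, ahd c != k -> atl c != k -> F (act M (arr K c) m) = act N (arr K c) (F m)) ->
    (forall z, alpha M k z = 0 -> alpha N k (ffun_map Y F z) = 0) ->
    (forall m, ffun_map Y F (beta M k m) \in limg (beta N k)) ->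
    (forall z, beta N k (alpha N k (ffun_map Y F z)) = ffun_map Y F (beta M k (alpha M k z))) ->
  F \in restr_Hom_Q.
Proof.
move=> HV HZ HO H1 H2 H3.
have [f [fp fq]] := @fill_square K _ _ _ _ (alpha M k) (alpha N k \o ffun_map Y F)%VF (beta N k)
  (ffun_map Y F \o beta M k)%VF (fun z Hz => etrans (comp_lfunE _ _ _) (H1 z Hz))
  (fun m => eq_ind_r (fun t => t \in limg (beta N k)) (H2 m) (comp_lfunE _ _ _))
  (fun z => etrans (congr1 _ (comp_lfunE _ _ _)) (etrans (H3 z) (esym (comp_lfunE _ _ _)))).
pose g : 'Hom(space M, space N) :=
  (F + (act N (vtx K Y k) \o f \o act M (vtx K Y k)))%VF.
have gE m : g m = F m + act N (vtx K Y k) (f (act M (vtx K Y k) m)).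
  by rewrite /g add_lfunE !comp_lfunE.
have FkN m : act N (vtx K Y k) (F m) = 0 by rewrite -HV HZ.
have fa a m : ahd a = k -> f (act M (arr K a) m) = act N (arr K a) (F m).
  move=> Ha; have := fp (finj (space M) a m).
  rewrite comp_lfunE !alphaE (bigD1 a) ?Ha //= [in RHS](bigD1 a) ?Ha //=.
  rewrite [X in f (_ + X)]big1 => [|c /andP[_ Hc]]; last first.
    by rewrite finjE ffunE (negbTE Hc) linear0.
  rewrite [X in _ = _ + X]big1 => [|c /andP[_ Hc]]; last first.
    by rewrite ffun_mapE finjE ffunE (negbTE Hc) !linear0.
  by rewrite !addr0 ffun_mapE finjE ffunE eqxx.
have fb b m : atl b = k -> act N (arr K b) (f m) = F (act M (arr K b) m).
  move=> Hb; have := congr1 (fun h : {ffun Y -> space N} => h b) (fq m).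
  by rewrite comp_lfunE ffun_mapE !beta_ffun.
apply/mem_restr; exists g; last first.
  apply/lfunP=> m; rewrite comp_lfunE gE vtx_offk offk_vtx eqxx !linear0 addr0.
  by rewrite offkE linearB /= HZ subr0.
have atlk a : ahd a = k -> atl a != k by move=> <-; exact: noloop.
have ahdk b : atl b = k -> ahd b != k by move=> <-; rewrite eq_sym; exact: noloop.
have vtx0 (L : qprep Y) j (m : space L) : j != k ->
    act L (vtx K Y k) (act L (vtx K Y j) m) = 0.
  by move=> Hj; rewrite -actME vtxM eq_sym (negbTE Hj) act0E.
have arr0h (L : qprep Y) c (m : space L) : ahd c != k -> act L (vtx K Y k) (act L (arr K c) m) = 0.
  by move=> Hc; rewrite (vsp_act0 (arr_mem c m) Hc).
have arr0t (L : qprep Y) c (m : space L) : atl c != k -> act L (arr K c) (act L (vtx K Y k) m) = 0.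
  by move=> Hc; rewrite (arr_act0 (act_vtx_mem k m)) // eq_sym.
apply/mem_Hom_Q; split=> [j m|c m]; rewrite !gE linearD /=.
  rewrite HV; congr (_ + _); have [->|Hj] := eqVneq j k.
    by rewrite -!actME !vtxM eqxx.
  rewrite vtx0 // !linear0 -actME vtxM (negbTE Hj) act0E //.
have [Hh|Hh] := eqVneq (ahd c) k.
  rewrite arr0t ?atlk // addr0.
  have Ek : act M (vtx K Y k) (act M (arr K c) m) = act M (arr K c) m.
    by rewrite -Hh -actME vtx_arr.
  by rewrite Ek fa // -{1}Ek HZ add0r -Hh -actME vtx_arr.
rewrite arr0h // !linear0 addr0.
have [Ht|Ht] := eqVneq (atl c) k; last by rewrite HO // arr0t // addr0.
have Ekc (L : qprep Y) (x : space L) : act L (arr K c) (act L (vtx K Y k) x) = act L (arr K c) x.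
  by rewrite -Ht arr_act_vtx.
by rewrite -(Ekc _ (F m)) FkN linear0 add0r Ekc fb // Ekc.
Qed.

End Two.
End ExtendHom.

(** * Homomorphisms between mutated representations *)

Lemma vtx_commute (K : fieldType) (n : nat) (Y : qp K n) (M N : qprep Y)
    (F : 'Hom(space M, space N)) :
    (forall l m, m \in vsp M l -> F m \in vsp N l) ->
  forall j m, F (act M (vtx K Y j) m) = act N (vtx K Y j) (F m).
Proof.
move=> H j m; rewrite [m in RHS]act_vtx_sum !linear_sum (bigD1 j) //= big1 ?addr0 => [|l Hl].
  by rewrite (vsp_act (H _ _ (act_vtx_mem _ _))).
by rewrite (vsp_act0 (H _ _ (act_vtx_mem _ _))).
Qed.

Section MutateHom.
Variables (K : fieldType) (n : nat) (X : qp K n) (k : 'I_n) (D : qp_mutation X k).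
Variables (M N : qprep X) (Mt Nt : qprep (qm_pre D)).
Variables (prM : premut_rep M Mt) (prN : premut_rep N Nt).
Local Notation H2 := (qm_no2cyc D).
Local Notation Qt := (mut_quiver H2).
Local Notation thM := (pr_theta prM).
Local Notation thN := (pr_theta prN).
Local Notation inT := {a : X | ahd a == k}.
Local Notation outT := {b : X | atl b == k}.
Local Notation oldT := {c : X | (ahd c != k) && (atl c != k)}.
Implicit Types (j : 'I_n).

Variables (gM : 'Hom(space Mt, space M)) (gN : 'Hom(space Nt, space N)).
Hypothesis HgM : forall j m, j != k -> m \in vsp M j -> gM (thM m) = m.
Hypothesis HgN : forall j m, j != k -> m \in vsp N j -> gN (thN m) = m.

Lemma premut_arr_act_vtx (L : qprep (qm_pre D)) (c : Qt) m :
  act L (arr K c) (act L (vtx K _ (atl c)) m) = act L (arr K c) m.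
Proof. exact: (@arr_act_vtx K n (qm_pre D) L c). Qed.

Lemma alpha_phi_out (L : qprep X) (Lt : qprep (qm_pre D)) (pr : premut_rep L Lt)
    (z : {ffun Qt -> space Lt}) (x : {ffun X -> space L}) :
    (forall bo : outT, act Lt (arr K (star_out H2 bo)) (z (star_out H2 bo)) =
      act Lt (arr K (star_out H2 bo)) (pr_theta pr (x (val bo)))) ->
  alpha Lt k z = phi_out pr x.
Proof.
move=> H; rewrite alphaE big_mkcond !big_sumType /=.
rewrite [X in X + _](_ : _ = 0) ?add0r.
  by apply: eq_bigr => bo _; rewrite eqxx; exact: H.
rewrite [X in X + _](_ : _ = 0) ?add0r.
  rewrite big1 // => ai _; case: eqP => // E.
  by have := atl_in_neq ai; rewrite E eqxx.
rewrite [X in X + _]big1 ?add0r => [|o _].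
  rewrite big1 // => p _; case: eqP => // E.
  have [bo [ai [_ Hb _]]] := comp_components D p.
  by have := ahd_out_neq bo; rewrite Hb E eqxx.
by case: eqP => // E; have := old_ahd o; rewrite E eqxx.
Qed.

Lemma beta_star_in (L : qprep X) (Lt : qprep (qm_pre D)) (pr : premut_rep L Lt) (y : space Lt) :
  forall c : Qt, beta Lt k y c = if c is inl (inr ai) then act Lt (arr K (star_in H2 ai)) y else 0.
Proof.
move=> c; rewrite betaE ffunE; case: c => [[[o|p]|ai]|bo] /=.
- by rewrite (negbTE (old_atl o)).
- have [bo [ai [_ _ Ha]]] := comp_components D p.
  by rewrite -Ha (negbTE (atl_in_neq ai)).
- by rewrite eqxx.
- by rewrite (negbTE (ahd_out_neq bo)).
Qed.

Section Forward.
Variable f : 'Hom(space M, space N).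
Hypothesis Hf : f \in Hom_Q M N.

Definition hom_fwd : 'Hom(space Mt, space Nt) := (thN \o f \o gM \o offk k Mt)%VF.
Local Notation F := hom_fwd.

Lemma f_vsp j m : m \in vsp M j -> f m \in vsp N j.
Proof. by move=> Hm; rewrite mem_vsp -(Hom_Q_act _ _ Hf) (vsp_act Hm). Qed.

Lemma fwd_theta j m : j != k -> m \in vsp M j -> F (thM m) = thN (f m).
Proof.
move=> Hj Hm; rewrite /F !comp_lfunE (offk_id Hj); last exact: theta_mem.
by rewrite (HgM Hj Hm).
Qed.

Lemma fwd_k y : y \in vsp Mt k -> F y = 0.
Proof. by move=> Hy; rewrite /F !comp_lfunE (offk_k Hy) !linear0. Qed.

Lemma fwd_vsp j y : y \in vsp Mt j -> F y \in vsp Nt j.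
Proof.
have [->|Hj] := eqVneq j k; first by move=> Hy; rewrite (fwd_k Hy) mem0v.
move=> Hy; have [m Hm <-] := theta_surj prM Hj Hy.
by rewrite (fwd_theta Hj Hm); apply: theta_mem => //; exact: f_vsp.
Qed.

Lemma fwd_vtx j y : F (act Mt (vtx K _ j) y) = act Nt (vtx K _ j) (F y).
Proof. exact: vtx_commute fwd_vsp j y. Qed.

(** For the mutation, the three conditions of [extend_hom] at [k] are about im(beta), ker(alpha) and
    gamma of the original representations, and [f] is compatible with all of these. *)
Lemma fwd_restr : F \in restr_Hom_Q k Mt Nt.
Proof.
have fa a m : f (act M (arr K a) m) = act N (arr K a) (f m) by exact: Hom_Q_act.
have famb : forall m, ffun_map X f (beta M k m) = beta N k (f m).
  move=> m; apply/ffunP=> b; rewrite ffun_mapE !betaE !ffunE.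
  by case: ifP => _; rewrite ?fa // linear0.
have fgam x : gamma N k (ffun_map X f x) = ffun_map X f (gamma M k x).
  apply/ffunP=> a; rewrite ffun_mapE !gammaE !ffunE; case: ifP => _; last by rewrite linear0.
  by rewrite linear_sum; apply: eq_bigr => b _; rewrite ffun_mapE /= (Hom_Q_act _ _ Hf).
have fout x : x \in M_out M k -> ffun_map X f x \in M_out N k.
  move=> /mem_M_out Hx; apply/mem_M_out => b; rewrite ffun_mapE; have := Hx b.
  by case: ifP => _; [exact: f_vsp | move/eqP->; rewrite linear0].
(* Collects the components of [z] at the arrows b*, carried back to M_out(k). *)
pose xof (z : {ffun Qt -> space Mt}) : {ffun X -> space M} := [ffun b =>
  if insub b is Some bo then gM (act Mt (vtx K _ (ahd b)) (z (star_out H2 bo))) else 0].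
have xofE z (bo : outT) : thM (xof z (val bo)) = act Mt (vtx K _ (ahd (val bo))) (z (star_out H2 bo))
    /\ xof z (val bo) \in vsp M (ahd (val bo)).
  rewrite ffunE valK.
  have [m Hm Em] := theta_surj prM (ahd_out_neq bo) (act_vtx_mem (ahd (val bo)) (z (star_out H2 bo))).
  by rewrite -Em (HgM (ahd_out_neq bo) Hm).
have xofM z : xof z \in M_out M k.
  apply/mem_M_out => b; case: ifPn => Hb.
    by have [_] := xofE z (exist _ b Hb).
  by rewrite ffunE insubN.
have al z : alpha Mt k z = phi_out prM (xof z).
  apply: alpha_phi_out => bo; have [-> _] := xofE z bo.
  by rewrite (premut_arr_act_vtx (star_out H2 bo)).
have alF z : alpha Nt k (ffun_map Qt F z) = phi_out prN (ffun_map X f (xof z)).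
  apply: alpha_phi_out => bo; rewrite !ffun_mapE; have [E Hx] := xofE z bo.
  rewrite -(fwd_theta (ahd_out_neq bo) Hx) E fwd_vtx.
  by rewrite (premut_arr_act_vtx (star_out H2 bo)).
apply: extend_hom.
- exact: fwd_vtx.
- by move=> y; apply: fwd_k; exact: act_vtx_mem.
- move=> c y Hh Ht.
  rewrite -(arr_act_vtx c y) -[in RHS](arr_act_vtx c) -fwd_vtx.
  have [m Hm Em] := theta_surj prM Ht (act_vtx_mem (atl c) y); rewrite -Em.
  rewrite (fwd_theta Ht Hm).
  case: c Hh Ht Hm {Em} => [[[o|p]|ai]|bo] Hh Ht Hm; last 2 first.
  + by rewrite /= eqxx in Ht.
  + by rewrite /= eqxx in Hh.
  + rewrite [LHS](congr1 F (pr_old prM Hm)) [RHS](pr_old prN (f_vsp Hm)).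
    by rewrite (fwd_theta (old_ahd o) (arr_mem _ _)) fa.
  + have [bo [ai [Ep Hb Ha]]] := comp_components D p.
    have Hm' : m \in vsp M (atl (val ai)) by rewrite Ha.
    rewrite [inl (inl (inr p))]Ep.
    rewrite [LHS](congr1 F (pr_comp prM bo Hm')) [RHS](pr_comp prN bo (f_vsp Hm')).
    by rewrite (fwd_theta (ahd_out_neq bo) (arr_mem _ _)) !fa.
- move=> z; rewrite al => /eqP; rewrite (phi_out_eq0 prM (xofM z)) => /memv_imgP [m Hm Em].
  rewrite alF; apply/eqP; rewrite (phi_out_eq0 prN (fout _ (xofM z))) Em famb.
  by apply: memv_img; exact: f_vsp.
- move=> y; set y' := act Mt (vtx K _ k) y.
  have Hy' : y' \in vsp Mt k by exact: act_vtx_mem.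
  have [z Hz Ez] := star_in_ker_alpha prM Hy'.
  have /andP [Hz1 Hz2] : (z \in M_in M k) && (z \in lker (alpha M k)).
    by rewrite -memv_cap.
  have Hzm (ai : inT) : z (val ai) \in vsp M (atl (val ai)).
    by have /mem_M_in /(_ (val ai)) := Hz1; rewrite (valP ai).
  have Hfz : ffun_map X f z \in ker_alpha N k.
    rewrite /ker_alpha memv_cap; apply/andP; split.
      apply/mem_M_in => a; rewrite ffun_mapE; have /mem_M_in /(_ a) := Hz1.
      by case: ifP => _; [exact: f_vsp | move/eqP->; rewrite linear0].
    rewrite memv_ker alphaE; move: Hz2; rewrite memv_ker alphaE => /eqP E.
    apply/eqP; rewrite -[RHS](linear0 f) -E linear_sum; apply: eq_bigr => a _.
    by rewrite ffun_mapE -fa.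
  have [y2 Hy2 Ey2] := ker_alpha_star_in prN Hfz.
  apply/memv_imgP; exists y2; rewrite ?memvf //; apply/ffunP=> c.
  rewrite ffun_mapE (beta_star_in prM) (beta_star_in prN).
  case: c => [[[o|p]|ai]|bo]; rewrite ?linear0 //.
  rewrite Ey2 ffun_mapE -(fwd_theta (atl_in_neq ai) (Hzm ai)) -Ez.
  by rewrite (premut_arr_act_vtx (star_in H2 ai)).
- move=> z; rewrite alF al; apply/ffunP=> c; rewrite ffun_mapE (beta_star_in prM) (beta_star_in prN).
  case: c => [[[o|p]|ai]|bo]; rewrite ?linear0 //.
  rewrite (star_in_phi_out prN ai (fout _ (xofM z))) (star_in_phi_out prM ai (xofM z)) fgam ffun_mapE.
  rewrite linearN /= (fwd_theta (atl_in_neq ai)) //.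
  rewrite gammaE ffunE (valP ai); apply: memv_suml => b _.
  apply: vtx_act_mem; apply: cpalgP => -[i s] Hs.
  rewrite coef_vtxM coef_rquo coef_pseries; case: ifP => _; rewrite ?mulr0 //=.
  by case: ifP => // _; rewrite ?mulr0 // mul1r.
Qed.

End Forward.

Section Backward.
Variable f : 'Hom(space Mt, space Nt).
Hypothesis Hf : f \in Hom_Q Mt Nt.

Definition hom_bwd : 'Hom(space M, space N) := (gN \o f \o thM \o offk k M)%VF.
Local Notation G := hom_bwd.

Lemma ft_vsp j m : m \in vsp Mt j -> f m \in vsp Nt j.
Proof. by move=> Hm; rewrite mem_vsp -(Hom_Q_act _ _ Hf) (vsp_act Hm). Qed.

Lemma bwd_theta j m : j != k -> m \in vsp M j -> thN (G m) = f (thM m) /\ G m \in vsp N j.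
Proof.
move=> Hj Hm; rewrite /G !comp_lfunE (offk_id Hj) //.
have [m' Hm' <-] := theta_surj prN Hj (ft_vsp (theta_mem prM Hj Hm)).
by rewrite (HgN Hj Hm').
Qed.

Lemma bwd_k y : y \in vsp M k -> G y = 0.
Proof. by move=> Hy; rewrite /G !comp_lfunE (offk_k Hy) !linear0. Qed.

Lemma bwd_vsp j y : y \in vsp M j -> G y \in vsp N j.
Proof.
have [->|Hj] := eqVneq j k; first by move=> Hy; rewrite (bwd_k Hy) mem0v.
by move=> Hy; have [] := bwd_theta Hj Hy.
Qed.

Lemma bwd_vtx j y : G (act M (vtx K _ j) y) = act N (vtx K _ j) (G y).
Proof. exact: vtx_commute bwd_vsp j y. Qed.

(** Here ker(alpha) is lifted to the mutated space at [k], im(beta) is recognized by [phi_out], and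
    the condition on beta alpha is the compatibility with the arrows [ba]. *)
Lemma bwd_restr : G \in restr_Hom_Q k M N.
Proof.
have fa a m : f (act Mt (arr K a) m) = act Nt (arr K a) (f m) by exact: Hom_Q_act.
have Gab (bo : outT) (ai : inT) m : act N (arr K (val bo)) (act N (arr K (val ai)) (G m)) =
    G (act M (arr K (val bo)) (act M (arr K (val ai)) m)).
  rewrite -(arr_act_vtx (val ai) m) -[in LHS](arr_act_vtx (val ai)) -bwd_vtx.
  set m' := act M (vtx _ _ _) m; have Hm' : m' \in vsp M (atl (val ai)) by exact: act_vtx_mem.
  have [EG HG] := bwd_theta (atl_in_neq ai) Hm'.
  have HM2 := arr_mem (val bo) (act M (arr K (val ai)) m').
  have [EG2 HG2] := bwd_theta (ahd_out_neq bo) HM2.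
  apply: (theta_inj2 (pr := prN) (ahd_out_neq bo) (arr_mem _ _) HG2).
  by rewrite EG2 -(pr_comp prM bo Hm') fa -EG (pr_comp prN bo HG).
have Ga a m : act N (arr K a) (G m) = act N (arr K a) (G (act M (vtx K _ (atl a)) m)).
  by rewrite bwd_vtx arr_act_vtx.
apply: extend_hom.
- exact: bwd_vtx.
- by move=> y; apply: bwd_k; exact: act_vtx_mem.
- move=> c y Hh Ht; pose o : oldT := exist _ c (introT andP (conj Hh Ht)).
  rewrite Ga -(arr_act_vtx c y); set m := act M (vtx _ _ _) y.
  have Hm : m \in vsp M (atl (val o)) by exact: act_vtx_mem.
  have [EG HG] := bwd_theta Ht Hm.
  have [EG2 HG2] := bwd_theta Hh (arr_mem c m).
  apply: (theta_inj2 (pr := prN) Hh HG2 (arr_mem _ _)).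
  rewrite EG2 -[LHS](congr1 f (pr_old prM Hm)) fa -EG; exact: (pr_old (c := o) prN HG).
- move=> z Hz; pose z' : {ffun X -> space M} :=
    [ffun a => if ahd a == k then act M (vtx K _ (atl a)) (z a) else 0].
  have Hz' : z' \in ker_alpha M k.
    rewrite /ker_alpha memv_cap; apply/andP; split.
      apply/mem_M_in => a; rewrite !ffunE; case: (ahd a == k) => //; exact: act_vtx_mem.
    rewrite memv_ker -Hz !alphaE; apply/eqP; apply: eq_bigr => a Ha.
    by rewrite ffunE Ha arr_act_vtx.
  have [y Hy Ey] := ker_alpha_star_in prM Hz'.
  have [z2 Hz2 Ez2] := star_in_ker_alpha prN (ft_vsp Hy).
  have /andP [Hz3 Hz4] : (z2 \in M_in N k) && (z2 \in lker (alpha N k)).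
    by rewrite -memv_cap.
  move: Hz4; rewrite memv_ker => /eqP <-; rewrite !alphaE; apply: eq_bigr => a Ha.
  rewrite ffun_mapE Ga; congr (act N _ _); pose ai : inT := exist _ a Ha.
  have Hza : act M (vtx K X (atl a)) (z a) \in vsp M (atl a) by exact: act_vtx_mem.
  have [EG HG] := bwd_theta (atl_in_neq ai) Hza.
  apply: (theta_inj2 (pr := prN) (atl_in_neq ai) HG).
    by have /mem_M_in /(_ a) := Hz3; rewrite Ha.
  rewrite EG -(Ez2 ai) -fa Ey ffunE.
  by rewrite (valP ai).
- move=> m; set m' := act M (vtx K _ k) m.
  have Hm' : m' \in vsp M k by exact: act_vtx_mem.
  have Hx : ffun_map X G (beta M k m') \in M_out N k.
    apply/mem_M_out => b; rewrite ffun_mapE betaE ffunE; case: (atl b == k);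
      last by rewrite linear0 eqxx.
    by apply: bwd_vsp; exact: arr_mem.
  have Ebm : beta M k m = beta M k m'.
    apply/ffunP=> b; rewrite !betaE !ffunE; case: ifP => // /eqP Hb.
    by rewrite /m' -Hb arr_act_vtx.
  rewrite Ebm; have : ffun_map X G (beta M k m') \in im_beta N k.
    rewrite -(phi_out_eq0 prN Hx); apply/eqP.
    rewrite -[RHS](linear0 f) -(phi_out_beta prM Hm') linear_sum; apply: eq_bigr => bo _.
    rewrite /= fa; congr (act Nt _ _); rewrite ffun_mapE beta_ffun ?(eqP (valP bo)) //.
    by have [] := bwd_theta (ahd_out_neq bo) (arr_mem (val bo) m').
  by apply: subvP; apply: limgS; exact: subvf.
- move=> z; apply/ffunP=> b; rewrite ffun_mapE !betaE !ffunE; case: ifPn => Hb; last by rewrite linear0.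
  rewrite !alphaE !linear_sum; apply: eq_bigr => a Ha /=.
  by rewrite ffun_mapE (Gab (exist _ b Hb) (exist _ a Ha)).
Qed.

End Backward.

Lemma restr_le1 : (\dim (restr_Hom_Q k M N) <= \dim (restr_Hom_Q k Mt Nt))%N.
Proof.
pose T (h : 'Hom(space M, space N)) : 'Hom(space Mt, space Nt) := (thN \o h \o gM \o offk k Mt)%VF.
have linT : linear T.
  move=> c h h'; apply/lfunP=> x.
  by rewrite add_lfunE scale_lfunE !comp_lfunE add_lfunE scale_lfunE linearP.
apply: (dim_le_inj (f := linfun T)) => h /mem_restr [f Hf <-]; rewrite (linfunE linT).
  (* Only vectors away from [k] enter, so [f] may be replaced by its restriction. *)
  suff -> : T (f \o offk k M)%VF = hom_fwd f by exact: fwd_restr.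
  apply/lfunP=> y; rewrite (act_vtx_sum y) !linear_sum; apply: eq_bigr => j _.
  rewrite /= /T /hom_fwd !comp_lfunE !offk_vtx; case: ifPn => Hj; first by rewrite !linear0.
  have [m Hm <-] := theta_surj prM Hj (act_vtx_mem j y).
  by rewrite (HgM Hj Hm) (offk_id Hj Hm).
move=> T0; apply/lfunP=> m; rewrite zero_lfunE (act_vtx_sum m) linear_sum big1 // => j _ /=.
rewrite comp_lfunE offk_vtx; case: ifPn => Hj; first by rewrite linear0.
set m' := act M _ _; have Hm' : m' \in vsp M j by exact: act_vtx_mem.
apply: (theta_inj (pr := prN) Hj); first exact: f_vsp.
have /lfunP /(_ (thM m')) := T0; rewrite /T !comp_lfunE zero_lfunE.
by rewrite (offk_id Hj (theta_mem prM Hj Hm')) (HgM Hj Hm') (offk_id Hj Hm').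
Qed.

Lemma restr_le2 : (\dim (restr_Hom_Q k Mt Nt) <= \dim (restr_Hom_Q k M N))%N.
Proof.
pose T (h : 'Hom(space Mt, space Nt)) : 'Hom(space M, space N) := (gN \o h \o thM \o offk k M)%VF.
have linT : linear T.
  move=> c h h'; apply/lfunP=> x.
  by rewrite add_lfunE scale_lfunE !comp_lfunE add_lfunE scale_lfunE linearP.
apply: (dim_le_inj (f := linfun T)) => h /mem_restr [f Hf <-]; rewrite (linfunE linT).
  suff -> : T (f \o offk k Mt)%VF = hom_bwd f by exact: bwd_restr.
  apply/lfunP=> y; rewrite (act_vtx_sum y) !linear_sum; apply: eq_bigr => j _.
  rewrite /= /T /hom_bwd !comp_lfunE !offk_vtx; case: ifPn => Hj; first by rewrite !linear0.
  by rewrite (offk_id Hj) ?theta_mem ?act_vtx_mem.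
move=> T0; apply/lfunP=> m; rewrite zero_lfunE (act_vtx_sum m) linear_sum big1 // => j _ /=.
rewrite comp_lfunE offk_vtx; case: ifPn => Hj; first by rewrite linear0.
have [m' Hm' Em] := theta_surj prM Hj (act_vtx_mem j m); rewrite -Em.
have [m2 Hm2 Em2] := theta_surj prN Hj (ft_vsp Hf (theta_mem prM Hj Hm')).
have /lfunP /(_ m') := T0; rewrite /T !comp_lfunE zero_lfunE (offk_id Hj Hm').
rewrite (offk_id Hj (theta_mem prM Hj Hm')) -Em2 (HgN Hj Hm2) => ->.
by rewrite linear0.
Qed.

End MutateHom.

Lemma dim_restr_mutation (K : fieldType) (n : nat) (X : qp K n) (k : 'I_n)
    (D : qp_mutation X k) (M N : qprep X) (Mt Nt : qprep (qm_pre D)) :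
  premut_rep M Mt -> premut_rep N Nt ->
  \dim (restr_Hom_Q k Mt Nt) = \dim (restr_Hom_Q k M N).
Proof.
move=> prM prN; have [gM HgM] := theta_retraction prM; have [gN HgN] := theta_retraction prN.
by apply/eqP; rewrite eqn_leq (restr_le2 prM HgN) (restr_le1 prN HgM).
Qed.

(** * The E-invariant *)

Section RankAlpha.
Variables (K : fieldType) (n : nat) (X : qp K n) (k : 'I_n) (D : qp_mutation X k).
Variables (M : qprep X) (Mt : qprep (qm_pre D)) (pr : premut_rep M Mt).
Local Notation outT := {b : X | atl b == k}.
Local Notation H2 := (qm_no2cyc D).

(** Alpha of the mutation has the same image as [phi_out], whose kernel on M_out(k) is im(beta). *)
Lemma premut_dim_im_alpha :
  \dim (M_out M k) = (\dim (im_beta M k) + \dim (im_alpha Mt k))%N.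
Proof.
have linp : linear (phi_out pr).
  move=> c x y; rewrite /phi_out scaler_sumr -big_split; apply: eq_bigr => bo _ /=.
  by rewrite !ffunE !linearP.
have [g Hg] := theta_retraction pr.
apply: (dim_exact (f := linfun (phi_out pr))).
- move=> x /mem_M_out Hx; rewrite (linfunE linp).
  pose z : {ffun mut_quiver H2 -> space Mt} := [ffun c : mut_quiver H2 =>
    if c is inr bo return space Mt then pr_theta pr (x (val bo)) else 0].
  have -> : phi_out pr x = alpha Mt k z.
    by symmetry; apply: alpha_phi_out => bo; rewrite ffunE.
  apply: memv_img; apply/mem_M_in => c; rewrite ffunE; case: c => [[[o|p]|ai]|bo];
    rewrite ?mem0v ?eqxx ?if_same //.
  apply: (theta_mem pr (ahd_out_neq bo)); have := Hx (val bo).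
  by rewrite (valP bo).
- move=> y /memv_imgP [z /mem_M_in Hz ->].
  pose x : {ffun X -> space M} :=
    [ffun b => if insub b is Some bo then g (z (star_out H2 bo)) else 0].
  have Hxb (bo : outT) : pr_theta pr (x (val bo)) = z (star_out H2 bo) /\
      x (val bo) \in vsp M (ahd (val bo)).
    rewrite ffunE valK; have := Hz (star_out H2 bo); rewrite /= eqxx => Hzb.
    have [m Hm <-] := theta_surj pr (ahd_out_neq bo) Hzb.
    by rewrite (Hg _ _ (ahd_out_neq bo) Hm).
  exists x; last first.
    rewrite (linfunE linp); symmetry; apply: alpha_phi_out => bo.
    by have [-> _] := Hxb bo.
  apply/mem_M_out => b; case: ifPn => Hb; last by rewrite ffunE insubN.
  by have [_] := Hxb (exist _ b Hb).
- move=> x; rewrite (linfunE linp); apply/idP/andP => [Hx|[Hx]]; last by rewrite phi_out_eq0.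
  have Hxo : x \in M_out M k by have /memv_imgP [m _ ->] := Hx; exact: beta_M_out.
  by rewrite phi_out_eq0.
Qed.

(** Without 2-cycles through [k] one of the two sums is empty, and one of the two one-sided counts
    applies. *)
Lemma premut_ker_gamma i : i != k ->
  (\dim (ker_gamma Mt i) +
     \sum_(a : X | (ahd a == k) && (atl a == i)) \dim (ker_beta M k) =
   \dim (ker_gamma M i) +
     \sum_(b : X | (atl b == k) && (ahd b == i)) \dim (ker_beta Mt k))%N.
Proof.
move=> Hi; have [/existsP [b /andP[/eqP Hb /eqP Hbi]]|Hno] :=
  boolP [exists b : X, (atl b == k) && (ahd b == i)].
  have Hin (a : X) : ahd a = k -> atl a != i by move=> Ha; rewrite -Hbi; exact: H2.
  rewrite [X in (_ + X)%N]big1 ?addn0; first exact: ker_gamma_no_in.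
  by move=> a /andP[/eqP /Hin]; case: eqP.
have Hout (b : X) : atl b = k -> ahd b != i.
  move=> Hb; apply/negP=> Hbi; move/existsP: Hno; apply; exists b.
  by rewrite Hb eqxx.
rewrite [X in (_ = _ + X)%N]big1 ?addn0; first by rewrite (ker_gamma_no_out pr Hi Hout).
by move=> b /andP[/eqP /Hout]; case: eqP.
Qed.

End RankAlpha.

Section PremutE.
Variables (K : fieldType) (n : nat) (X : qp K n) (k : 'I_n) (D : qp_mutation X k).
Variables (M N : qprep X) (Mt Nt : qprep (qm_pre D)).
Hypotheses (prM : premut_rep M Mt) (prN : premut_rep N Nt).

Let nin i := #|[pred a : X | (ahd a == k) && (atl a == i)]|.
Let nout i := #|[pred b : X | (atl b == k) && (ahd b == i)]|.

Lemma sum_in : (\sum_(i | i != k) \dim (vsp M i) * nin i)%N = \dim (M_in M k).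
Proof.
rewrite dim_M_in (partition_big (fun a : X => atl a) (fun i => i != k)); last first.
  by move=> a /eqP <-; exact: noloop.
apply: eq_bigr => i _; rewrite mulnC -sum_nat_const; apply: eq_bigr => a.
by case/andP=> _ /eqP ->.
Qed.

Lemma sum_out : (\sum_(i | i != k) \dim (vsp M i) * nout i)%N = \dim (M_out M k).
Proof.
rewrite dim_M_out (partition_big (fun b : X => ahd b) (fun i => i != k)); last first.
  by move=> b /eqP <-; rewrite eq_sym; exact: noloop.
apply: eq_bigr => i _; rewrite mulnC -sum_nat_const; apply: eq_bigr => b.
by case/andP=> _ /eqP ->.
Qed.

Lemma premut_g_inv i : i != k -> g_inv Nt i =
  g_inv N i + (nout i * \dim (ker_beta Nt k))%:Z - (nin i * \dim (ker_beta N k))%:Z.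
Proof.
move=> Hi; have := premut_ker_gamma prN Hi; rewrite !sum_nat_const /g_inv.
rewrite (premut_dim_vsp prN Hi) (premut_dim_dec prN Hi) -/(nin i) -/(nout i).
lia.
Qed.

(** The intersection of ker(beta) and im(alpha) enters through ker(gamma) and again, with opposite
    sign, through the new decoration, so it cancels. *)
Lemma premut_g_inv_k : g_inv Nt k = - g_inv N k.
Proof.
rewrite /g_inv (ker_gamma_k prN).
have := premut_dim_vsp_k prN; have := premut_dim_dec_k prN.
have : (\dim (ker_beta N k) + \dim (im_beta N k) = \dim (vsp N k))%N by exact: limg_ker_dim.
lia.
Qed.

Lemma premut_E_inj : E_inj Mt Nt - E_inj M N =
  h_inv Mt k * h_inv N k - h_inv M k * h_inv Nt k.
Proof.
rewrite /E_inj (dim_Hom_Q_restr k Mt Nt) (dim_Hom_Q_restr k M N).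
rewrite (dim_restr_mutation prM prN).
rewrite (bigD1 k) //= [X in _ - (_ + X)](bigD1 k) //= premut_g_inv_k.
have -> : \sum_(i < n | i != k) (\dim (vsp Mt i))%:Z * g_inv Nt i =
    \sum_(i < n | i != k) (\dim (vsp M i))%:Z * g_inv N i +
    (\dim (M_out M k) * \dim (ker_beta Nt k))%:Z - (\dim (M_in M k) * \dim (ker_beta N k))%:Z.
  (* Weighted by the dimensions of M(i), the numbers of arrows add up to the dimensions of M_in(k)
     and M_out(k). *)
  rewrite -sum_in -sum_out !big_distrl /= !(big_morph Posz PoszD (erefl 0%:Z)).
  rewrite -sumrN -!big_split; apply: eq_bigr => i Hi /=.
  by rewrite (premut_dim_vsp prM Hi) premut_g_inv // !PoszM; ring.
have R1 : (\dim (ker_alpha M k) + \dim (im_alpha M k) = \dim (M_in M k))%N by exact: limg_ker_dim.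
have R2 : (\dim (ker_beta M k) + \dim (im_beta M k) = \dim (vsp M k))%N by exact: limg_ker_dim.
have R3 : (\dim (ker_beta N k) + \dim (im_beta N k) = \dim (vsp N k))%N by exact: limg_ker_dim.
have R4 := premut_dim_vsp_k prM; have R5 := premut_dim_ker_beta prM.
have R6 := premut_dim_ker_beta prN; have R7 := premut_dim_im_alpha prM.
have im_sub (Y : qp K n) (L : qprep Y) : (\dim (im_alpha L k) <= \dim (vsp L k))%N.
  apply: dimvS; apply/subvP=> y /memv_imgP [z _ ->]; rewrite alphaE.
  by apply: memv_suml => a /eqP Ha; rewrite -Ha; exact: arr_mem.
have R8 := im_sub _ M; have R9 := im_sub _ Mt.
rewrite /g_inv /h_inv !PoszD !PoszM -!subzn //.
move: (\sum_(i < n | i != k) _) => Sg.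
(* The remaining dimensions are eliminated as linear forms in those of [M] and [N], which leaves a
   polynomial identity. *)
have E1 : (\dim (im_alpha M k))%:Z = (\dim (M_in M k))%:Z - (\dim (ker_alpha M k))%:Z by lia.
have E2 : (\dim (im_alpha Mt k))%:Z =
  (\dim (M_out M k))%:Z - (\dim (vsp M k))%:Z + (\dim (ker_beta M k))%:Z by lia.
have E3 : (\dim (vsp Mt k))%:Z = (\dim (ker_gamma M k))%:Z + (\dim (ker_alpha M k))%:Z +
  (\dim {:dec M k})%:Z - (\dim (vsp M k))%:Z + (\dim (ker_beta M k))%:Z by lia.
have E4 : (\dim (ker_beta Mt k))%:Z = (\dim (ker_gamma M k))%:Z + (\dim {:dec M k})%:Z
  - (\dim (vsp M k))%:Z + (\dim (ker_beta M k))%:Z by lia.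
have E5 : (\dim (ker_beta Nt k))%:Z = (\dim (ker_gamma N k))%:Z + (\dim {:dec N k})%:Z
  - (\dim (vsp N k))%:Z + (\dim (ker_beta N k))%:Z by lia.
rewrite E1 E2 E3 E4 E5; ring.
Qed.

End PremutE.

(** * Passage to the reduced part and the final formulas *)

Section Reduction.
Variables (K : fieldType) (n : nat) (X : qp K n) (k : 'I_n) (D : qp_mutation X k).

Lemma reduction_transfer (Mt : qprep (qm_pre D)) (Mb : qprep (qm_target D))
    (r : reduction_rep Mt Mb) :
  transfer (red_phi (qm_red D)) (rr_iso r).
Proof.
split; first exact: rr_isoP.
  exact: rr_vtx.
by move=> c u x; exact: rr_arr.
Qed.

Let HY := trivP (qm_red D).
Let Hphi := red_phiP (qm_red D).

Lemma reduction_h_inv (Mt : qprep (qm_pre D)) (Mb : qprep (qm_target D)) i :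
  reduction_rep Mt Mb -> h_inv Mb i = h_inv Mt i.
Proof.
move=> r; congr (- Posz _).
exact: (transfer_dim_ker_beta HY Hphi (reduction_transfer r)).
Qed.

Lemma reduction_E_inj (Mt Nt : qprep (qm_pre D)) (Mb Nb : qprep (qm_target D)) :
  reduction_rep Mt Mb -> reduction_rep Nt Nb -> E_inj Mb Nb = E_inj Mt Nt.
Proof.
move=> rM rN; have tM := reduction_transfer rM; have tN := reduction_transfer rN.
rewrite /E_inj; congr (Posz _ + _); first exact: (transfer_dim_Hom_Q HY Hphi tM tN).
apply: eq_bigr => i _; congr (Posz _ * (Posz _ - Posz _ + Posz _)).
- exact: (transfer_dim_vsp tM).
- exact: (transfer_dim_ker_gamma HY Hphi tN).
- exact: (transfer_dim_vsp tN).
- exact: (iso_on_dim (rr_dec_iso rN i)).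
Qed.

Lemma mutation_E_inj (M N : qprep X) (Mb Nb : qprep (qm_target D)) :
    rep_mutation D M Mb -> rep_mutation D N Nb ->
  E_inj Mb Nb - E_inj M N = h_inv Mb k * h_inv N k - h_inv M k * h_inv Nb k.
Proof.
move=> [Mt pM rM] [Nt pN rN]; rewrite (reduction_E_inj rM rN).
by rewrite (reduction_h_inv k rM) (reduction_h_inv k rN) premut_E_inj.
Qed.

End Reduction.

Theorem theorem7p1 (R : realType) (n : nat) (X : qp R[i] n) (k : 'I_n)
    (HX : nondegenerate_qp X) (D : qp_mutation X k) :
  (forall (M N : qprep X) (Mb Nb : qprep (qm_target D)),
     rep_mutation D M Mb -> rep_mutation D N Nb ->
     E_inj Mb Nb - E_inj M N = h_inv Mb k * h_inv N k - h_inv M k * h_inv Nb k) /\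
  (forall (M N : qprep X) (Mb Nb : qprep (qm_target D)),
     rep_mutation D M Mb -> rep_mutation D N Nb -> E_sym Mb Nb = E_sym M N) /\
  (forall (M : qprep X) (Mb : qprep (qm_target D)),
     rep_mutation D M Mb -> E_self Mb = E_self M).
Proof.
split; first exact: mutation_E_inj.
split=> [M N Mb Nb HM HN|M Mb HM].
  have E1 := mutation_E_inj HM HN; have E2 := mutation_E_inj HN HM.
  (* The right-hand side is antisymmetric in the two representations, so the two differences
     cancel. *)
  apply/eqP; rewrite -subr_eq0 /E_sym opprD addrACA E1 E2; apply/eqP; ring.
apply/eqP; rewrite -subr_eq0 /E_self (mutation_E_inj HM HM); apply/eqP; ring.
Qed.
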